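(* Let $k$ be a positive integer, let $\alpha,\beta$ be two nonconstant inner functions and let $k\leq\dim K_\alpha$. Let $\varphi\in L^2$ be such that $U_{\varphi}^{\alpha,\beta}\in\mathcal{S}_k(\alpha,\beta)$. Then $$S_\beta U_{\varphi}^{\alpha,\beta}=U_{\varphi}^{\alpha,\beta}S_\alpha^k$$ if and only if $$\varphi\in\overline{\alpha H^2}+\overline{z}^{k-1}(W^*_k\beta)H^2+\overline{z}^{k-1}\tfrac{W^*_k\beta}{\gcd(\alpha,W^*_k\beta)}K_{\gcd(\alpha,W^*_k\beta)}.$$
   Context: $L^2=L^2(\mathbb{T},m)$ with $m$ normalized Lebesgue measure on the unit circle $\mathbb{T}$; $H^2\subset L^2$ is the Hardy space of the unit disk and $H^\infty=H^2\cap L^\infty$. An inner function is $\alpha\in H^\infty$ with $|\alpha|=1$ a.e. on $\mathbb{T}$; $K_\alpha=H^2\ominus\alpha H^2$ (so $K_\alpha=\{0\}$ if $\alpha$ is constant), $P_\alpha$ is the orthogonal projection of $L^2$ onto $K_\alpha$, $K_\alpha^\infty=K_\alpha\cap H^\infty$ (dense in $K_\alpha$), and $S_\alpha f=P_\alpha(zf)$, $f\in K_\alpha$, is the compressed shift. $\gcd$ denotes the greatest common inner divisor. A bar over a set of functions denotes the set of complex conjugates. $W_k:L^2\to L^2$ is the bounded linear operator with $W_k(z^n)=z^{n/k}$ if $k\mid n$ and $W_k(z^n)=0$ otherwise ($n\in\mathbb{Z}$); its adjoint is $W_k^*g(z)=g(z^k)$, so $W_k^*\beta$ is inner. For $\varphi\in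 L^2$ put $U_\varphi^{\alpha,\beta}f=P_\beta W_k(\varphi f)$, $f\in K_\alpha^\infty$. $\mathcal{S}_k(\alpha,\beta)$ is the set of all operators $U_\varphi^{\alpha,\beta}$, $\varphi\in L^2$, that extend boundedly to $K_\alpha$ (each identified with its bounded extension $K_\alpha\to K_\beta$). *)

(* Defs.v *)
From HB Require Import structures.
From mathcomp Require Import all_boot all_order all_algebra.
From mathcomp Require Import all_classical all_reals all_analysis.
From mathcomp Require Import complex.

Set Implicit Arguments.
Unset Strict Implicit.
Unset Printing Implicit Defensive.

Import Order.TTheory GRing.Theory Num.Theory.
Import ComplexField Normc.

Local Open Scope classical_set_scope.
Local Open Scope ring_scope.
Local Open Scope complex_scope.

Record circle (R : realType) := Circle {
  circle_val :> R[i];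
  circle_valP : normc circle_val == 1 }.

HB.instance Definition _ (R : realType) :=
  [isSub for @circle_val R].
HB.instance Definition _ (R : realType) := [Choice of circle R by <:].

Section Circle.
Variable R : realType.

Lemma normc_cis (t : R) :
  normc (cos (2 * pi * t) +i* sin (2 * pi * t)) == 1.
Proof. by rewrite /normc cos2Dsin2 sqrtr1. Qed.

Definition cexp (t : R) : circle R := Circle (normc_cis t).

Lemma normc_expn (z : circle R) (n : nat) : normc ((z : R[i]) ^+ n) == 1.
Proof.
elim: n => [|n IHn]; first by rewrite expr0 normc1.
by rewrite exprS normcM (eqP (circle_valP z)) (eqP IHn) mulr1.
Qed.

Definition circle_expn (z : circle R) (n : nat) : circle R :=
  Circle (normc_expn z n).

HB.instance Definition _ := isPointed.Build (circle R) (cexp 0).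

(* [cexp] is a quotient map from the line onto the circle, and it restricts to
   a Borel isomorphism from [0, 1[; these are therefore the Borel sets. *)
Definition circle_measurable : set (set (circle R)) :=
  [set B | measurable (cexp @^-1` B)].

Lemma circle_measurable0 : circle_measurable set0.
Proof. by rewrite /circle_measurable /= preimage_set0. Qed.

Lemma circle_measurableC A : circle_measurable A -> circle_measurable (~` A).
Proof. by rewrite /circle_measurable /= preimage_setC; exact: measurableC. Qed.

Lemma circle_measurable_bigcup (F : (set (circle R))^nat) :
  (forall i, circle_measurable (F i)) -> circle_measurable (\bigcup_i F i).
Proof.
move=> mF; rewrite /circle_measurable /= preimage_bigcup.
by apply: bigcup_measurable => i _; exact: mF.
Qed.

HB.instance Definition _ := isMeasurable.Build default_measure_display
  (circle R) circle_measurable0 circle_measurableC circle_measurable_bigcup.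

Lemma measurable_cexp : measurable_fun [set: R] cexp.
Proof. by move=> _ B mB; rewrite setTI. Qed.

HB.instance Definition _ :=
  isMeasurableFun.Build _ _ _ _ cexp measurable_cexp.

Definition arc01 : set R := `[0, 1[.

Lemma measurable_arc01 : measurable arc01.
Proof. exact: measurable_itv. Qed.

Definition circle_measure : set (circle R) -> \bar R :=
  pushforward (mrestr lebesgue_measure measurable_arc01) cexp.

Let circle_measure0 : circle_measure set0 = 0%E.
Proof. by rewrite /circle_measure /pushforward preimage_set0 measure0. Qed.

Let circle_measure_ge0 A : (0 <= circle_measure A)%E.
Proof. by rewrite /circle_measure /pushforward /mrestr; exact: measure_ge0. Qed.

Let circle_measure_sigma_additive : semi_sigma_additive circle_measure.
Proof.
move=> F mF tF mUF; rewrite /circle_measure /pushforward preimage_bigcup.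
apply: measure_semi_sigma_additive.
- by move=> n; exact: mF.
- by move=> i j _ _ [x [Fi Fj]]; apply: tF => //; exists (cexp x).
- by rewrite -preimage_bigcup.
Qed.

HB.instance Definition _ := isMeasure.Build _ _ _ circle_measure
  circle_measure0 circle_measure_ge0 circle_measure_sigma_additive.

Lemma circle_measure_setT : circle_measure [set: circle R] = 1%E.
Proof.
rewrite /circle_measure /pushforward /mrestr preimage_setT setTI.
by rewrite lebesgue_measure_itv /= lte_fin ltr01 oppr0 adde0.
Qed.

HB.instance Definition _ :=
  Measure_isProbability.Build _ _ _ circle_measure circle_measure_setT.

End Circle.

(* Elements of L^2 are represented by measurable functions. All the sets of
   functions below are stable under almost everywhere equality of measurable
   functions, and identities between functions are stated almost everywhere. *)

Section Spaces.
Variable R : realType.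
Local Notation T := (circle R).
Local Notation C := R[i].
Local Notation m := (@circle_measure R).
Implicit Types (f g h : T -> C) (M N : set (T -> C)).

Definition cmeasurable f : Prop :=
  measurable_fun [set: T] (fun z => complex.Re (f z)) /\
  measurable_fun [set: T] (fun z => complex.Im (f z)).

Definition cintegral f : C :=
  (\int[m]_z complex.Re (f z)) +i* (\int[m]_z complex.Im (f z)).

Definition conjf f : T -> C := fun z => (f z)^*.

Definition zpow (n : int) : T -> C := fun z => (z : C) ^ n.

Definition L2 : set (T -> C) :=
  [set f | cmeasurable f /\
           m.-integrable [set: T] (fun z => ((normc (f z)) ^+ 2)%:E)].

Definition Linf : set (T -> C) :=
  [set f | cmeasurable f /\ exists B : R, {ae m, forall z, normc (f z) <= B}].

Definition inner_prod f g : C := cintegral (f * conjf g).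

Definition L2norm f : R := Num.sqrt (\int[m]_z ((normc (f z)) ^+ 2)).

Definition fourier f (n : int) : C := inner_prod f (zpow n).

(* H^2 of the disk, identified with its space of boundary functions. *)
Definition H2 : set (T -> C) :=
  [set f | L2 f /\ forall n : int, n < 0 -> fourier f n = 0].

Definition Hinf : set (T -> C) := H2 `&` Linf.

Definition inner_fun : set (T -> C) :=
  [set a | Hinf a /\ {ae m, forall z, normc (a z) = 1}].

Definition nonconstant f : Prop := ~ exists c : C, f = cst c %[ae m].

Definition inner_dvd (d a : T -> C) : Prop :=
  exists2 h, inner_fun h & a = d * h %[ae m].

(* A greatest common inner divisor is unique up to a unimodular constant. *)
Definition inner_gcd (d a b : T -> C) : Prop :=
  [/\ inner_fun d, inner_dvd d a, inner_dvd d b &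
      forall e, inner_fun e -> inner_dvd e a -> inner_dvd e b ->
        inner_dvd e d].

Definition model (a : T -> C) : set (T -> C) :=
  [set f | H2 f /\ forall h, H2 h -> inner_prod f (a * h) = 0].

Definition model_inf (a : T -> C) : set (T -> C) := model a `&` Hinf.

Definition dim_ge M (n : nat) : Prop :=
  exists v : 'I_n -> T -> C, (forall i, M (v i)) /\
    forall c : 'I_n -> C,
      \sum_(i < n) c i *: v i = 0 %[ae m] -> forall i, c i = 0.

(* For f in L^2 and M a closed subspace the set below is a single class modulo
   almost everywhere equality; the default value 0 is then never used. *)
Definition oproj M f : T -> C :=
  xget 0 [set g | M g /\ forall h, M h -> inner_prod (f - g) h = 0].

Definition bounded_linear_op M N (A : (T -> C) -> (T -> C)) : Prop :=
  [/\ forall f, M f -> N (A f),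
      forall (c : C) f g, M f -> M g ->
        A (c *: f + g) = c *: A f + A g %[ae m] &
      exists B : R, forall f, M f -> L2norm (A f) <= B * L2norm f].

(* The operator W_k of L^2; [W] is determined up to almost everywhere
   equality since the trigonometric polynomials are dense. *)
Definition slant_op (k : nat) (W : (T -> C) -> (T -> C)) : Prop :=
  bounded_linear_op L2 L2 W /\
  forall n : int, W (zpow n) =
    (if (k %| n)%Z then zpow (n %/ k)%Z else 0) %[ae m].

Definition slant_adj (k : nat) g : T -> C := fun z => g (circle_expn z k).

Definition compressed_shift (a : T -> C) f : T -> C :=
  oproj (model a) (zpow 1 * f).

Definition slant_toeplitz (W : (T -> C) -> (T -> C))
    (b phi : T -> C) f : T -> C :=
  oproj (model b) (W (phi * f)).

(* The truncated operator with symbol [phi] extends boundedly from the dense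
   subspace [model_inf a] to [model a], and [U] is its extension. *)
Definition bounded_extension (W : (T -> C) -> (T -> C))
    (a b phi : T -> C) (U : (T -> C) -> (T -> C)) : Prop :=
  bounded_linear_op (model a) (model b) U /\
  forall f, model_inf a f -> U f = slant_toeplitz W b phi f %[ae m].

End Spaces.

(* Main.v *)
(* For f in K_alpha write z^k f = S_alpha^k f + alpha y with y a polynomial of
   degree < k, and F = phi alpha. Pairing S_beta U f - U S_alpha^k f with g in
   K_beta and moving W to its adjoint V g = g(z^k), the intertwining relation
   becomes <F y, V g> = conj(g(0)) <phi f, z^-k> for all bounded f in K_alpha
   and all g in K_beta.

   If phi has the required form, both sides are computed by comparing Fourier
   supports. Conversely, dim K_alpha >= k allows every z^j with j < k as a y:
   the Gram matrix of the projections of 1, ..., z^(k-1) onto K_alpha is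
   invertible. This gives F = conj(h1) + z^(1-k) (V beta) h with h1, h in H^2,
   and the relation then says that (V beta) h is orthogonal to K_alpha, hence
   lies in alpha H^2. Writing alpha = gamma a' and V beta = gamma b', coprimality
   of a' and b' forces a' to divide h, by Beurling's theorem applied to the
   invariant subspace of all u in H^2 such that b' u is in a' H^2. *)

(* The symbol [phi] is only in L^2, so [phi * f] is known to be in L^2 for bounded [f] alone. The
   relation is therefore tested on K_alpha^infty, which S_alpha^k preserves because y is a
   polynomial, and extended to K_alpha by continuity. The product F = phi alpha is the natural
   unknown: multiplication by alpha turns conj(alpha H^2) into conj(H^2). The exponent k - 1 is
   dictated by the supports: V moves frequencies <= -1 to frequencies <= -k, and z^(1-k) H^2 starts
   just above them. Nonconstancy of beta provides g in K_beta with g(0) <> 0, so that the factor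
   conj(g(0)) can be cancelled. The quotient by the gcd is b' = V beta / gamma: once h = a' u, one
   has conj(alpha) (V beta) h = b' u, and splitting u along H^2 = gamma H^2 + K_gamma produces the
   last two summands of the symbol. *)
Require Import Defs.
From mathcomp Require Import all_boot all_order all_algebra.
From mathcomp Require Import all_classical all_reals all_analysis.
From mathcomp Require Import complex ring lra zify measurable_realfun.
Set Implicit Arguments.
Unset Strict Implicit.
Unset Printing Implicit Defensive.
Import Order.TTheory GRing.Theory Num.Theory.
Import numFieldNormedType.Exports.
Import ComplexField Normc.
Local Open Scope classical_set_scope.
Local Open Scope ring_scope.
Local Open Scope complex_scope.

(** * Square-integrable real functions *)

Section RealIntegrable.
Context d (T : measurableType d) (R : realType).
Variable mu : {finite_measure set T -> \bar R}.
Implicit Types a b : T -> R.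

Definition rint a : Prop := mu.-integrable [set: T] (EFin \o a).

Definition rL2 a : Prop :=
  measurable_fun [set: T] a /\ rint (fun x => a x ^+ 2).

Lemma rint_meas a : rint a -> measurable_fun [set: T] a.
Proof. by move=> /integrableP[ma _]; exact/measurable_EFinP. Qed.

Lemma rintD a b : rint a -> rint b -> rint (fun x => a x + b x).
Proof.
move=> ia ib; have := integrableD measurableT ia ib.
by apply: eq_integrable.
Qed.

Lemma rintZ (c : R) a : rint a -> rint (fun x => c * a x).
Proof.
move=> ia; have := integrableZl measurableT c ia.
by apply: eq_integrable.
Qed.

Lemma rintN a : rint a -> rint (fun x => - a x).
Proof. by move=> /(rintZ (-1)); under eq_fun do rewrite mulN1r. Qed.

Lemma rintB a b : rint a -> rint b -> rint (fun x => a x - b x).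
Proof. by move=> ia ib; apply: rintD => //; exact: rintN. Qed.

Lemma rint_le a b : measurable_fun [set: T] a ->
  (forall x, `|a x| <= b x) -> rint b -> rint a.
Proof.
move=> ma ab; apply: le_integrable => //; first exact/measurable_EFinP.
by move=> x _; rewrite /= lee_fin (le_trans (ab x))// ler_norm.
Qed.

Lemma rint_cst (c : R) : rint (fun=> c).
Proof. exact: finite_measure_integrable_cst. Qed.

Lemma rint_bounded_mul a b (B : R) : rint a -> measurable_fun [set: T] b ->
  (forall x, `|b x| <= B) -> rint (fun x => a x * b x).
Proof.
move=> ia mb bB; apply: (@rint_le _ (fun x => B * `|a x|)).
- by apply: measurable_funM => //; exact: rint_meas.
- by move=> x; rewrite normrM mulrC ler_wpM2r.
- by apply: rintZ; exact: integrable_norm.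
Qed.

Lemma rL2_mul a b : rL2 a -> rL2 b -> rint (fun x => a x * b x).
Proof.
move=> [ma ia] [mb ib]; apply: (@rint_le _ (fun x => a x ^+ 2 + b x ^+ 2)).
- exact: measurable_funM.
- move=> x; rewrite normrM -(real_normK (num_real (a x))) -(real_normK (num_real (b x))).
  by have := sqr_ge0 (`|a x| - `|b x|); nra.
- exact: rintD.
Qed.

Lemma rL2D a b : rL2 a -> rL2 b -> rL2 (fun x => a x + b x).
Proof.
move=> La Lb; split.
  by apply: measurable_funD; [case: La | case: Lb].
rewrite (_ : (fun x => _) = (fun x => (a x ^+ 2 + b x ^+ 2) + 2 * (a x * b x))).
  by apply: rintD; [apply: rintD; [case: La|case: Lb]|apply/rintZ/rL2_mul].
by apply/funext => x; ring.
Qed.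

Lemma rL2_bounded_mul a b (B : R) : rL2 a -> measurable_fun [set: T] b ->
  (forall x, `|b x| <= B) -> rL2 (fun x => a x * b x).
Proof.
move=> [ma ia] mb bB; split; first exact: measurable_funM.
under eq_fun do rewrite exprMn.
apply: (@rint_bounded_mul _ _ (B ^+ 2)) => //; first exact: measurable_funX.
by move=> x; rewrite normrX ler_pXn2r ?nnegrE// (le_trans _ (bB x)).
Qed.

Lemma rL2_bounded a (B : R) : measurable_fun [set: T] a ->
  (forall x, `|a x| <= B) -> rL2 a.
Proof.
move=> ma aB; have := @rL2_bounded_mul (fun=> 1) a B.
rewrite (_ : (fun x => 1 * a x) = a); last by apply/funext => x; rewrite mul1r.
apply => //; split; first exact: measurable_cst.
exact: (rint_cst (1 ^+ 2)).
Qed.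

Lemma rint_ae a b : rint a -> measurable_fun [set: T] b ->
  a = b %[ae mu] -> rint b.
Proof.
move=> ia mb ab; apply/integrableP; split; first exact/measurable_EFinP.
case/integrableP : ia => ma; congr (_ < _)%E.
apply: ae_eq_integral => //.
- exact: measurableT_comp.
- by apply: measurableT_comp => //; exact/measurable_EFinP.
- by apply: filterS ab => x /= h xT; rewrite (h xT).
Qed.

Lemma Rintegral_ae a b : measurable_fun [set: T] a ->
  measurable_fun [set: T] b -> a = b %[ae mu] ->
  \int[mu]_x a x = \int[mu]_x b x.
Proof.
move=> ma mb ab; congr fine; apply: ae_eq_integral => //;
  try exact/measurable_EFinP.
by apply: filterS ab => x /= h xT; rewrite (h xT).
Qed.

Lemma Rintegral_sqr_eq0 a : rL2 a -> \int[mu]_x (a x ^+ 2) = 0 ->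
  a = 0 %[ae mu].
Proof.
move=> [ma ia] a0.
have : (\int[mu]_x `|(a x ^+ 2)%:E| = 0)%E.
  under eq_integral do rewrite abse_EFin ger0_norm ?sqr_ge0//.
  by rewrite -[LHS]fineK ?integrable_fin_num// -/(Rintegral _ _ _) a0.
move/ae_eq_integral_abs => /(_ measurableT) [].
  by apply/measurable_EFinP; exact: measurable_funX.
move=> N [mN N0 sN]; exists N; split => // x /= ax; apply: sN => /= h; apply: ax => _.
by have := h I => -[] /eqP; rewrite sqrf_eq0 => /eqP.
Qed.

Lemma Rintegral_EFin a : rint a ->
  (\int[mu]_x (a x)%:E = (\int[mu]_x a x)%:E)%E.
Proof. by move=> ia; rewrite fineK// integrable_fin_num. Qed.

Lemma limn_einf_le (v : (\bar R)^nat) (c : \bar R) :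
  (forall n, (v n <= c)%E) -> (limn_einf v <= c)%E.
Proof.
move=> vc; rewrite limn_einf_lim; apply: lime_le; first exact: is_cvg_einfs.
apply: nearW => n; apply: le_trans (vc n).
by apply: ereal_inf_lbound; exists n => //=.
Qed.

(** The increments are at most [Num.sqrt H] times 2^-n, so the telescoping series converges
    absolutely; the weight is 4 = 2^2 because the increments enter squared. *)
Lemma cvg_of_summable_increments (v : R^nat) (H : R) :
  (forall n, 4 ^+ n * (v n - v n.+1) ^+ 2 <= H) -> cvgn v.
Proof.
move=> vH.
have H0 : 0 <= H by apply: le_trans (vH 0%N); rewrite expr0 mul1r sqr_ge0.
have dle n : `|telescope v n| <= geometric (Num.sqrt H) 2^-1 n.
  rewrite /telescope /geometric/= -sqrtr_sqr.
  have -> : (2^-1 ^+ n : R) = Num.sqrt (4 ^- n).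
    rewrite -exprVn (_ : 4^-1 = (2^-1) ^+ 2 :> R); last by field.
    by rewrite -exprM mulnC exprM sqrtr_sqr ger0_norm// exprn_ge0.
  rewrite -sqrtrM// ler_wsqrtr// ler_pdivlMr ?exprn_gt0// mulrC.
  by rewrite -sqrrN opprB.
rewrite (_ : v = fun n => v 0%N + series (telescope v) n); last first.
  by apply/funext => n; rewrite -eq_sum_telescope.
have cs : cvgn (series (telescope v)).
  apply: normed_cvg; apply: (@series_le_cvg _ _ (geometric (Num.sqrt H) 2^-1)) => //.
  - by move=> n; exact: normr_ge0.
  - by move=> n; apply: mulr_ge0; [exact: sqrtr_ge0|exact: exprn_ge0].
  by apply: is_cvg_geometric_series; rewrite ger0_norm// invf_lt1// ltr1n.
apply: is_cvgD => //; exact: is_cvg_cst.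
Qed.

Lemma rL2B a b : rL2 a -> rL2 b -> rL2 (fun x => a x - b x).
Proof.
move=> La Lb; apply: rL2D => //; have := @rL2_bounded_mul b (fun=> -1) 1 Lb.
rewrite (_ : (fun x => b x * -1) = (fun x => - b x)); last first.
  by apply/funext => x; rewrite mulrN1.
by apply; [exact: measurable_cst | move=> x; rewrite normrN1].
Qed.

Lemma rL2_ae a b : rL2 a -> measurable_fun [set: T] b -> a = b %[ae mu] ->
  rL2 b.
Proof.
move=> [ma ia] mb ab; split => //; apply: rint_ae ia _ _.
  exact: measurable_funX.
by apply: filterS ab => x /= h xT; rewrite (h xT).
Qed.

(* The weights [4 ^+ n] make the increments summable almost everywhere. *)
Lemma rL2_cauchy_ae_cvg (u : (T -> R)^nat) :
  (forall n, rL2 (u n)) ->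
  (forall n m, (n <= m)%N -> \int[mu]_x ((u n x - u m x) ^+ 2) <= 8 ^- n) ->
  {ae mu, forall x, cvgn (u ^~ x)}.
Proof.
move=> Lu cu.
pose g n x := 4 ^+ n * (u n x - u n.+1 x) ^+ 2.
have ig n : rint (g n) by apply: rintZ; case: (rL2B (Lu n) (Lu n.+1)).
have g0 n x : 0 <= g n x by apply: mulr_ge0; [exact: exprn_ge0|exact: sqr_ge0].
have mg n : measurable_fun [set: T] (EFin \o g n).
  by apply/measurable_EFinP; exact: rint_meas.
pose h x := (\sum_(0 <= n <oo) (g n x)%:E)%E.
have ih : mu.-integrable [set: T] h.
  apply/integrableP; split.
    apply: (@ge0_emeasurable_sum _ _ _ _ (fun n x => (g n x)%:E) predT).
      by move=> n x _ _; rewrite lee_fin.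
    by move=> n _; exact: mg.
  under eq_integral.
    move=> x _; rewrite gee0_abs; last by apply: nneseries_ge0 => n _ _; rewrite lee_fin.
    over.
  rewrite integral_nneseries//; last by move=> n x _; rewrite lee_fin.
  (* The n-th integral is at most 4^n 8^-n = 2^-n. *)
  apply: (@le_lt_trans _ _ (\sum_(0 <= n <oo) (geometric 1 2^-1 n)%:E)%E).
    apply: lee_nneseries => [n *|n *]; first by apply: integral_ge0 => x _; rewrite lee_fin.
    rewrite Rintegral_EFin// lee_fin RintegralZl//; last first.
      by case: (rL2B (Lu n) (Lu n.+1)).
    rewrite /geometric/= mul1r (_ : 2^-1 = 4 / 8 :> R); last by field.
    by rewrite exprMn exprVn ler_wpM2l ?exprn_ge0// cu.
  apply: (@le_lt_trans _ _ 2%:E); last exact: ltry.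
  apply: lime_le.
    by apply: is_cvg_nneseries => n _ _; rewrite lee_fin /geometric/= mul1r exprn_ge0.
  apply: nearW => n; rewrite sumEFin lee_fin.
  rewrite -[leLHS]/(series (geometric 1 2^-1) n) geometric_seriesE/=.
    by have : 0 <= (2^-1 : R) ^+ n by [exact: exprn_ge0]; set y := _ ^+ n => y0;
      rewrite (_ : _ / _ = 2 * (1 - y)); [lra|field].
  by rewrite lt_eqF// invf_lt1// ltr1n.
have := integrable_ae measurableT ih.
apply: filterS => x /= /(_ I) hfin.
apply: (@cvg_of_summable_increments _ (fine (h x))) => n.
rewrite -lee_fin fineK//; apply: le_trans (nneseries_lim_ge n.+1 _); last first.
  by move=> k _ _; rewrite lee_fin.
rewrite big_nat_recr//= -[leLHS]add0e leeD2r// sume_ge0// => k _.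
by rewrite lee_fin.
Qed.

(** Completeness with a prescribed rate, which avoids extracting subsequences: the sequence
    converges almost everywhere, and Fatou's lemma transfers the same rate to the limit. *)
Lemma riesz_fischer (u : (T -> R)^nat) :
  (forall n, rL2 (u n)) ->
  (forall n m, (n <= m)%N -> \int[mu]_x ((u n x - u m x) ^+ 2) <= 8 ^- n) ->
  exists2 f, rL2 f & forall n, \int[mu]_x ((u n x - f x) ^+ 2) <= 8 ^- n.
Proof.
move=> Lu cu; have [N [mN N0 sN]] := rL2_cauchy_ae_cvg Lu cu.
(* Cutting to 0 on the null set [N] makes the sequence converge at every point, so that the
   pointwise limit is measurable. *)
pose v n x := u n x * \1_(~` N) x.
have mI : measurable_fun [set: T] (\1_(~` N) : T -> R).
  by apply: measurable_indic; exact: measurableC.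
have mv n : measurable_fun [set: T] (v n).
  by apply: measurable_funM => //; case: (Lu n).
have vu n : u n = v n %[ae mu].
  exists N; split => // x /= H; apply: contrapT => Nx; apply: H => _.
  by rewrite /v indicE mem_set// mulr1.
have Lv n : rL2 (v n) by exact: rL2_ae (Lu n) _ _.
pose f x := limn (v ^~ x).
have vf x : v ^~ x @ \oo --> f x.
  have [Nx|Nx] := pselect (N x).
    rewrite (_ : v ^~ x = fun=> 0); last first.
      apply/funext => n; rewrite /v indicE memNset ?mulr0//.
    rewrite (_ : f x = 0); first exact: cvg_cst.
    rewrite /f (_ : v ^~ x = fun=> 0) ?lim_cst//.
    by apply/funext => n; rewrite /v indicE memNset ?mulr0//.
  rewrite (_ : v ^~ x = u ^~ x); last first.
    by apply/funext => n; rewrite /v indicE mem_set// mulr1.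
  rewrite /f (_ : v ^~ x = u ^~ x); last first.
    by apply/funext => n; rewrite /v indicE mem_set// mulr1.
  by have := contra_notP (@sN x) Nx.
have mf : measurable_fun [set: T] f by exact: measurable_fun_cvg.
(* Fatou's lemma for fixed [n]; the index [m + n] stays beyond [n], where the hypothesis applies. *)
have fa n : (\int[mu]_x ((v n x - f x) ^+ 2)%:E <= (8 ^- n)%:E)%E.
  have cn x : ((v n x - v (m + n)%N x) ^+ 2)%:E @[m --> \oo] --> ((v n x - f x) ^+ 2)%:E.
    apply: cvg_EFin; first by apply: nearW.
    have vfn : v (m + n)%N x @[m --> \oo] --> f x by rewrite (cvg_shiftn n (v ^~ x)).
    have := cvgB (cvg_cst (v n x)) vfn => /(_ _ _) h.
    rewrite (_ : _ \o _ = ((fun=> v n x) - (fun m => v (m + n)%N x)) *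
      ((fun=> v n x) - (fun m => v (m + n)%N x))); first by rewrite expr2; exact: cvgM.
    by apply/funext.
  rewrite (_ : (fun x => _) = (fun x => limn_einf (fun m => ((v n x - v (m + n)%N x) ^+ 2)%:E))); last first.
    by apply/funext => x; rewrite (cvg_limn_einf_sup (cn x)).1.
  apply: le_trans (fatou _ _ _ _) _ => //.
    by move=> m; apply/measurable_EFinP; apply: measurable_funX; exact: measurable_funB.
  by move=> m x _; rewrite lee_fin sqr_ge0.
  apply: limn_einf_le => m; rewrite Rintegral_EFin; last by case: (rL2B (Lv n) (Lv (m + n)%N)).
  rewrite lee_fin; apply: le_trans (cu n (m + n)%N (leq_addl _ _)).
  rewrite le_eqVlt; apply/orP; left; apply/eqP; apply: Rintegral_ae.
  - by apply: measurable_funX; exact: measurable_funB.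
  - by apply: measurable_funX; apply: measurable_funB; [case: (Lu n)|case: (Lu (m + n)%N)].
  - by apply: filterS2 (vu n) (vu (m + n)%N) => x /= h1 h2 xT; rewrite (h1 xT) (h2 xT).
have Lvf : rL2 (fun x => v 0%N x - f x).
  split; first exact: measurable_funB.
  apply/integrableP; split.
    by apply/measurable_EFinP; apply: measurable_funX; exact: measurable_funB.
  apply: le_lt_trans (ltry (8 ^- 0)); apply: le_trans (fa 0%N).
  by under eq_integral do rewrite /= ger0_norm ?sqr_ge0//.
have Lf : rL2 f.
  have := rL2B (Lv 0%N) Lvf; congr rL2; apply/funext => x; ring.
exists f => // n; have := fa n.
rewrite Rintegral_EFin; last by case: (rL2B (Lv n) Lf).
rewrite lee_fin; apply: le_trans; rewrite le_eqVlt; apply/orP; left; apply/eqP.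
apply: Rintegral_ae.
- by apply: measurable_funX; apply: measurable_funB => //; case: (Lu n).
- by apply: measurable_funX; exact: measurable_funB.
- by apply: filterS (vu n) => x /= h xT; rewrite (h xT).
Qed.

End RealIntegrable.

(** * Integration of complex functions on the circle, bounded and square-integrable functions *)

Section ComplexIntegral.
Variable R : realType.
Local Notation T := (circle R).
Local Notation C := R[i].
Local Notation m := (@circle_measure R).
Local Notation re := (@complex.Re R).
Local Notation im := (@complex.Im R).
Implicit Types (f g h p : T -> C) (c : C).

Lemma reM (x y : C) : re (x * y) = re x * re y - im x * im y.
Proof. by case: x; case: y. Qed.

Lemma imM (x y : C) : im (x * y) = re x * im y + im x * re y.
Proof. by case: x; case: y. Qed.

Lemma reD (x y : C) : re (x + y) = re x + re y.
Proof. by case: x; case: y. Qed.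

Lemma imD (x y : C) : im (x + y) = im x + im y.
Proof. by case: x; case: y. Qed.

Lemma reJ (x : C) : re (x^*) = re x.
Proof. by case: x. Qed.

Lemma imJ (x : C) : im (x^*) = - im x.
Proof. by case: x. Qed.

Lemma normc_sqr (x : C) : normc x ^+ 2 = re x ^+ 2 + im x ^+ 2.
Proof. by case: x => a b /=; rewrite sqr_sqrtr// addr_ge0// sqr_ge0. Qed.

Lemma mulcJ (x : C) : x * x^* = (normc x ^+ 2)%:C.
Proof.
rewrite normc_sqr; case: x => a b /=.
by apply/eqP; rewrite eq_complex/=; apply/andP; split; apply/eqP; ring.
Qed.

Lemma normc_nonneg (x : C) : 0 <= normc x.
Proof. by case: x => a b; exact: sqrtr_ge0. Qed.

Lemma re_le_normc (x : C) : `|re x| <= normc x.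
Proof.
rewrite -(@ler_pXn2r _ 2)// ?nnegrE ?normc_nonneg//.
by rewrite normc_sqr real_normK ?num_real// lerDl sqr_ge0.
Qed.

Lemma im_le_normc (x : C) : `|im x| <= normc x.
Proof.
rewrite -(@ler_pXn2r _ 2)// ?nnegrE ?normc_nonneg//.
by rewrite normc_sqr real_normK ?num_real// lerDr sqr_ge0.
Qed.

Lemma normc_conj (x : C) : normc x^* = normc x.
Proof. by case: x => a b /=; rewrite sqrrN. Qed.

Lemma complex_ext (x y : C) : re x = re y -> im x = im y -> x = y.
Proof. by case: x; case: y => a b c d /= -> ->. Qed.

Lemma cmeasurableD f g : cmeasurable f -> cmeasurable g -> cmeasurable (f + g).
Proof.
move=> [rf jf] [rg ig]; split.
  by under eq_fun do rewrite reD; exact: measurable_funD.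
by under eq_fun do rewrite imD; exact: measurable_funD.
Qed.

Lemma cmeasurableM f g : cmeasurable f -> cmeasurable g -> cmeasurable (f * g).
Proof.
move=> [rf jf] [rg ig]; split.
  by under eq_fun do rewrite reM; apply: measurable_funB; exact: measurable_funM.
by under eq_fun do rewrite imM; apply: measurable_funD; exact: measurable_funM.
Qed.

Lemma cmeasurable_conj f : cmeasurable f -> cmeasurable (conjf f).
Proof.
move=> [rf jf]; split; first by under eq_fun do rewrite reJ.
by under eq_fun do rewrite imJ; exact: measurable_funN.
Qed.

Lemma cmeasurable_cst c : cmeasurable (cst c).
Proof. by split; exact: measurable_cst. Qed.

Lemma scalefE c f : c *: f = cst c * f.
Proof. by []. Qed.

Lemma cmeasurableZ c f : cmeasurable f -> cmeasurable (c *: f).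
Proof. by rewrite scalefE; apply: cmeasurableM; exact: cmeasurable_cst. Qed.

Lemma cmeasurable_real (r : T -> R) : measurable_fun [set: T] r ->
  cmeasurable (fun z => (r z)%:C).
Proof. by move=> mr; split => //=; exact: measurable_cst. Qed.

(** The sigma-algebra of the circle is carried over by [cexp], so measurability may be tested after
    composition with [cexp], where the coordinates become a cosine and a sine. *)
Lemma measurable_circle_val : cmeasurable (fun z : T => z : C).
Proof.
have mk (q : T -> R) : measurable_fun [set: R] (q \o cexp (R:=R)) ->
    measurable_fun [set: T] q.
  by move=> mq _ Y mY; have := mq measurableT Y mY; rewrite !setTI.
have m2 : measurable_fun [set: R] (fun t : R => 2 * pi * t).
  by apply: measurable_funM => //; exact: measurable_cst.
split; apply: mk; apply: measurableT_comp m2 => //.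
- by apply: continuous_measurable_fun; exact: continuous_cos.
- by apply: continuous_measurable_fun; exact: continuous_sin.
Qed.

Lemma circle_unit (z : T) : (z : C) * (z : C)^* = 1.
Proof. by rewrite mulcJ (eqP (circle_valP z)) expr1n. Qed.

Lemma circle_neq0 (z : T) : (z : C) != 0.
Proof.
apply/eqP => z0; have := circle_unit z; rewrite z0 mul0r => /esym/eqP.
by rewrite oner_eq0.
Qed.

Lemma circle_inv (z : T) : (z : C)^-1 = (z : C)^*.
Proof. by rewrite -[LHS]mulr1 -(circle_unit z) mulKf// circle_neq0. Qed.

Lemma zpow0 : zpow 0 = cst 1 :> (T -> C).
Proof. by apply/funext => z; rewrite /zpow expr0z. Qed.

Lemma zpowD (n k : int) : zpow (n + k) = zpow n * zpow k :> (T -> C).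
Proof. by apply/funext => z; rewrite /zpow expfzDr// circle_neq0. Qed.

Lemma conj_zpow (n : int) : conjf (zpow n) = zpow (- n) :> (T -> C).
Proof.
apply/funext => z; rewrite /zpow /conjf -exprz_inv circle_inv.
by rewrite rmorphXz// unitfE circle_neq0.
Qed.

Lemma cmeasurable_zpow (n : int) : cmeasurable (zpow n : T -> C).
Proof.
have H k : cmeasurable (zpow k%:Z : T -> C).
  elim: k => [|k IH]; first by rewrite zpow0; exact: cmeasurable_cst.
  rewrite -addn1 PoszD zpowD; apply: cmeasurableM => //.
  by rewrite (_ : zpow 1 = fun z => z : C);
    [exact: measurable_circle_val|apply/funext => z; rewrite /zpow expr1z].
case: n => // k; rewrite NegzE -conj_zpow; exact: cmeasurable_conj.
Qed.

Lemma normc_zpow (n : int) (z : T) : normc (zpow n z) = 1.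
Proof.
have /complexI : (normc (zpow n z) ^+ 2)%:C = 1%:C.
  rewrite -mulcJ; transitivity ((zpow n * conjf (zpow n)) z); first by [].
  by rewrite conj_zpow -zpowD subrr zpow0.
by move=> /eqP; rewrite sqrf_eq1 => /orP[/eqP//|/eqP]; have := normc_nonneg (zpow n z); lra.
Qed.

Lemma conjfM f g : conjf (f * g) = conjf f * conjf g.
Proof. by apply/funext => z; rewrite /conjf /= -[RHS]/(_ * _) -rmorphM. Qed.

Lemma conjfK f : conjf (conjf f) = f.
Proof. by apply/funext => z; rewrite /conjf conjcK. Qed.

Lemma ae_pointwise f g : (\forall z \ae m, f z = g z) <-> f = g %[ae m].
Proof.
by split; apply: filterS => z; [move=> + _|move=> /(_ I)].
Qed.

Definition cint f : Prop :=
  rint m (fun z => re (f z)) /\ rint m (fun z => im (f z)).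

Lemma cintD f g : cint f -> cint g -> cint (f + g).
Proof.
move=> [rf jf] [rg ig]; split.
  by under eq_fun do rewrite reD; exact: rintD.
by under eq_fun do rewrite imD; exact: rintD.
Qed.

Lemma cintZ c f : cint f -> cint (c *: f).
Proof.
move=> [rf jf]; split.
  by under eq_fun do rewrite reM; apply: rintB; exact: rintZ.
by under eq_fun do rewrite imM; apply: rintD; exact: rintZ.
Qed.

Lemma cintegralD f g : cint f -> cint g ->
  cintegral (f + g) = cintegral f + cintegral g.
Proof.
move=> [rf jf] [rg ig]; apply: complex_ext; rewrite ?reD ?imD/=.
  by under eq_Rintegral do rewrite reD; exact: RintegralD.
by under eq_Rintegral do rewrite imD; exact: RintegralD.
Qed.

Lemma cintegralZ c f : cint f -> cintegral (c *: f) = c * cintegral f.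
Proof.
move=> [rf jf]; apply: complex_ext; rewrite ?reM ?imM/=.
  under eq_Rintegral do rewrite reM.
  by rewrite RintegralB//; [rewrite !RintegralZl|exact: rintZ|exact: rintZ].
under eq_Rintegral do rewrite imM.
by rewrite RintegralD//; [rewrite !RintegralZl|exact: rintZ|exact: rintZ].
Qed.

Lemma cintegral_conj f : cint f -> cintegral (conjf f) = (cintegral f)^*.
Proof.
move=> [rf jf]; apply: complex_ext; rewrite ?reJ ?imJ/=.
  by under eq_Rintegral do rewrite reJ.
under eq_Rintegral do rewrite imJ -mulN1r.
by rewrite RintegralZl// mulN1r.
Qed.

Lemma cintegral_ae f g : cmeasurable f -> cmeasurable g -> f = g %[ae m] ->
  cintegral f = cintegral g.
Proof.
move=> [rf jf] [rg ig] /ae_pointwise fg; apply: complex_ext => /=.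
  by apply: Rintegral_ae => //; apply: filterS fg => z + _ => ->.
by apply: Rintegral_ae => //; apply: filterS fg => z + _ => ->.
Qed.

Lemma cintegral0 : cintegral 0 = 0 :> C.
Proof.
rewrite (_ : 0 = 0 *: (cst 1) :> (T -> C)); last by rewrite scale0r.
rewrite cintegralZ ?mul0r//.
by split; exact: rint_cst.
Qed.

(** The bound holds everywhere, not just almost everywhere, so that domination arguments are
    pointwise; [Linf_repr] brings essentially bounded functions to this case. *)
Definition bmeas p : Prop :=
  cmeasurable p /\ exists B : R, forall z, normc (p z) <= B.

Lemma bmeas_cst c : bmeas (cst c).
Proof. by split; [exact: cmeasurable_cst|exists (normc c)]. Qed.

Lemma bmeas_zpow (n : int) : bmeas (zpow n).
Proof.
by split; [exact: cmeasurable_zpow|exists 1 => z; rewrite normc_zpow].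
Qed.

Lemma bmeasM f g : bmeas f -> bmeas g -> bmeas (f * g).
Proof.
move=> [mf [A fA]] [mg [B gB]]; split; first exact: cmeasurableM.
exists (A * B) => z; rewrite normcM; apply: ler_pM => //; exact: normc_nonneg.
Qed.

Lemma bmeasD f g : bmeas f -> bmeas g -> bmeas (f + g).
Proof.
move=> [mf [A fA]] [mg [B gB]]; split; first exact: cmeasurableD.
by exists (A + B) => z; apply: le_trans (le_normcD _ _) _; exact: lerD.
Qed.

Lemma bmeasZ c f : bmeas f -> bmeas (c *: f).
Proof. by rewrite scalefE; apply: bmeasM; exact: bmeas_cst. Qed.

Lemma bmeas_re p : bmeas p ->
  exists B : R, forall z, `|re (p z)| <= B.
Proof.
by move=> [_ [B pB]]; exists B => z; exact: le_trans (re_le_normc _) _.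
Qed.

Lemma bmeas_im p : bmeas p ->
  exists B : R, forall z, `|im (p z)| <= B.
Proof.
by move=> [_ [B pB]]; exists B => z; exact: le_trans (im_le_normc _) _.
Qed.

Lemma cint_bmeasM f p : cint f -> bmeas p -> cint (f * p).
Proof.
move=> [rf jf] bp; have [B1 h1] := bmeas_re bp; have [B2 h2] := bmeas_im bp.
case: bp => -[rp ip] _; split.
  under eq_fun do rewrite reM.
  by apply: rintB; apply: rint_bounded_mul; eassumption.
under eq_fun do rewrite imM.
by apply: rintD; apply: rint_bounded_mul; eassumption.
Qed.

Lemma cint_bmeas p : bmeas p -> cint p.
Proof.
move=> bp; rewrite -[p]mul1r; apply: cint_bmeasM => //.
by split; exact: rint_cst.
Qed.

Lemma Linf_repr p : Linf p -> exists2 q, bmeas q & p = q %[ae m].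
Proof.
move=> [mp [B pB]].
have mn : measurable_fun [set: T] (fun z => normc (p z) ^+ 2).
  under eq_fun do rewrite normc_sqr.
  by case: mp => ? ?; apply: measurable_funD; exact: measurable_funX.
(* Squares avoid the square root in [normc] and keep the test measurable; they compare like the
   moduli because [Num.max B 0] is nonnegative. The representative is 0 outside [A]. *)
pose A := [set z : T | normc (p z) ^+ 2 <= (Num.max B 0) ^+ 2].
have mA : measurable A.
  rewrite -[A]setTI; have := mn measurableT _ (measurable_itv `]-oo, (Num.max B 0) ^+ 2]).
  by congr (measurable (_ `&` _)); apply/seteqP; split => z /=; rewrite in_itv.
have M0 : 0 <= Num.max B 0 by rewrite le_max lexx orbT.
exists (p * (fun z => (\1_A z)%:C)).
  split.
    by apply: cmeasurableM => //; apply: cmeasurable_real; exact: measurable_indic.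
  exists (Num.max B 0) => z; rewrite normcM indicE.
  have [zA|zA] := pselect (A z).
    rewrite mem_set//= expr0n addr0 expr1n sqrtr1 mulr1.
    by rewrite -(@ler_pXn2r _ 2)// ?nnegrE ?normc_nonneg.
  by rewrite memNset//= expr0n addr0 sqrtr0 mulr0.
apply/ae_pointwise; apply: filterS pB => z zB.
rewrite -[RHS]/(p z * _) indicE mem_set ?mulr1//.
rewrite /A/= ler_pXn2r ?nnegrE ?normc_nonneg//.
by rewrite le_max zB.
Qed.

Lemma L2P f : L2 f <->
  rL2 m (fun z => re (f z)) /\ rL2 m (fun z => im (f z)).
Proof.
split.
  move=> [[rf jf] nf]; split; split => //; apply: rint_le nf.
  - exact: measurable_funX.
  - by move=> z; rewrite normrX real_normK ?num_real// normc_sqr lerDl sqr_ge0.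
  - exact: measurable_funX.
  - by move=> z; rewrite normrX real_normK ?num_real// normc_sqr lerDr sqr_ge0.
move=> [[rf irf] [jf ijf]]; split => //.
by under eq_fun do rewrite normc_sqr; exact: rintD.
Qed.

Lemma L2_cmeasurable f : L2 f -> cmeasurable f.
Proof. by case. Qed.

Lemma L2_bmeasM f p : L2 f -> bmeas p -> L2 (f * p).
Proof.
move=> /L2P[rf jf] bp; have [B1 h1] := bmeas_re bp; have [B2 h2] := bmeas_im bp.
case: bp => -[rp ip] _; apply/L2P; split.
  under eq_fun do rewrite reM.
  by apply: rL2B; apply: rL2_bounded_mul; eassumption.
under eq_fun do rewrite imM.
by apply: rL2D; apply: rL2_bounded_mul; eassumption.
Qed.

Lemma L2D f g : L2 f -> L2 g -> L2 (f + g).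
Proof.
move=> /L2P[rf jf] /L2P[rg ig]; apply/L2P; split.
  by under eq_fun do rewrite reD; exact: rL2D.
by under eq_fun do rewrite imD; exact: rL2D.
Qed.

Lemma L2_bmeas p : bmeas p -> L2 p.
Proof.
move=> bp; have [B1 h1] := bmeas_re bp; have [B2 h2] := bmeas_im bp.
by case: bp => -[rp ip] _; apply/L2P; split; apply: rL2_bounded; eassumption.
Qed.

Lemma L2Z c f : L2 f -> L2 (c *: f).
Proof.
by move=> Lf; rewrite scalefE mulrC; apply: L2_bmeasM => //; exact: bmeas_cst.
Qed.

Lemma L2_lin c f g : L2 f -> L2 g -> L2 (c *: f + g).
Proof. by move=> Lf Lg; apply: L2D => //; exact: L2Z. Qed.

Lemma L2N f : L2 f -> L2 (- f).
Proof. by move=> Lf; rewrite -scaleN1r; exact: L2Z. Qed.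

Lemma L2B f g : L2 f -> L2 g -> L2 (f - g).
Proof. by move=> Lf Lg; apply: L2D => //; exact: L2N. Qed.

Lemma L2_0 : L2 (0 : T -> C).
Proof. by apply: L2_bmeas; exact: bmeas_cst. Qed.

Lemma L2_conj f : L2 f -> L2 (conjf f).
Proof.
move=> [mf nf]; split; first exact: cmeasurable_conj.
by under eq_fun do rewrite normc_conj.
Qed.

Lemma L2_zpow (n : int) : L2 (zpow n : T -> C).
Proof. exact/L2_bmeas/bmeas_zpow. Qed.

Lemma L2_ae f g : L2 f -> cmeasurable g -> f = g %[ae m] -> L2 g.
Proof.
move=> /L2P[rf jf] [rg ig] /ae_pointwise fg; apply/L2P; split.
  by apply: rL2_ae rf _ _ => //; apply: filterS fg => z + _ => ->.
by apply: rL2_ae jf _ _ => //; apply: filterS fg => z + _ => ->.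
Qed.

Lemma L2_LinfM f p : L2 f -> Linf p -> L2 (f * p).
Proof.
move=> Lf Lp; have [q bq pq] := Linf_repr Lp.
apply: (@L2_ae (f * q)); first exact: L2_bmeasM.
  by apply: cmeasurableM; [case: Lf|case: Lp].
apply/ae_pointwise; move/ae_pointwise : pq; apply: filterS => z h.
by rewrite -[LHS]/(f z * q z) -h.
Qed.

Lemma cint_L2M f g : L2 f -> L2 g -> cint (f * g).
Proof.
move=> /L2P[rf jf] /L2P[rg ig]; split.
  by under eq_fun do rewrite reM; apply: rintB; exact: rL2_mul.
by under eq_fun do rewrite imM; apply: rintD; exact: rL2_mul.
Qed.

Lemma L2_cint f : L2 f -> cint f.
Proof.
move=> Lf; rewrite -[f]mulr1; apply: cint_L2M => //.
by apply: L2_bmeas; exact: bmeas_cst.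
Qed.

End ComplexIntegral.

(** * The Hilbert space L^2 *)

Section Hilbert.
Variable R : realType.
Local Notation T := (circle R).
Local Notation C := R[i].
Local Notation m := (@circle_measure R).
Local Notation re := (@complex.Re R).
Local Notation im := (@complex.Im R).
Local Notation ip := (@inner_prod R).
Implicit Types (f g h p : T -> C) (c : C).

Lemma ip_lin c f g h : L2 f -> L2 g -> L2 h ->
  ip (c *: f + g) h = c * ip f h + ip g h.
Proof.
move=> Lf Lg Lh; rewrite /inner_prod mulrDl scalefE -mulrA -scalefE.
have Lh' := L2_conj Lh.
rewrite cintegralD ?cintegralZ//; try exact: cint_L2M.
by apply: cintZ; exact: cint_L2M.
Qed.

Lemma ipC f g : L2 f -> L2 g -> ip g f = (ip f g)^*.
Proof.
move=> Lf Lg; rewrite /inner_prod -cintegral_conj; last first.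
  by apply: cint_L2M => //; exact: L2_conj.
by rewrite conjfM conjfK mulrC.
Qed.

Lemma ipDl f g h : L2 f -> L2 g -> L2 h -> ip (f + g) h = ip f h + ip g h.
Proof. by move=> *; rewrite -[f in LHS]scale1r ip_lin// mul1r. Qed.

Lemma ip0l f : ip 0 f = 0.
Proof. by rewrite /inner_prod mul0r cintegral0. Qed.

Lemma ipZl c f h : L2 f -> L2 h -> ip (c *: f) h = c * ip f h.
Proof.
move=> Lf Lh; rewrite -[c *: f]addr0 ip_lin// ?ip0l ?addr0//; exact: L2_0.
Qed.

Lemma ipNl f h : L2 f -> L2 h -> ip (- f) h = - ip f h.
Proof. by move=> *; rewrite -scaleN1r ipZl// mulN1r. Qed.

Lemma ipBl f g h : L2 f -> L2 g -> L2 h -> ip (f - g) h = ip f h - ip g h.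
Proof. by move=> *; rewrite ipDl// ?ipNl//; exact: L2N. Qed.

Lemma ipDr f g h : L2 f -> L2 g -> L2 h -> ip h (f + g) = ip h f + ip h g.
Proof.
move=> Lf Lg Lh; rewrite ipC//; last exact: L2D.
by rewrite ipDl// [ip h f]ipC// [ip h g]ipC// rmorphD.
Qed.

Lemma ipZr c f h : L2 f -> L2 h -> ip h (c *: f) = c^* * ip h f.
Proof.
move=> Lf Lh; rewrite ipC//; last exact: L2Z.
by rewrite ipZl// [ip h f]ipC// rmorphM.
Qed.

Lemma ipBr f g h : L2 f -> L2 g -> L2 h -> ip h (f - g) = ip h f - ip h g.
Proof.
move=> Lf Lg Lh; rewrite ipC//; last exact: L2B.
by rewrite ipBl// [ip h f]ipC// [ip h g]ipC// rmorphB.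
Qed.

Lemma ip0r f : ip f 0 = 0.
Proof.
rewrite /inner_prod (_ : conjf 0 = 0) ?mulr0 ?cintegral0//.
by apply/funext => z; rewrite /conjf conjc0.
Qed.

Lemma ip_sumr I (s : seq I) (F : I -> T -> C) h : (forall i, L2 (F i)) ->
  L2 h -> ip h (\sum_(i <- s) F i) = \sum_(i <- s) ip h (F i).
Proof.
move=> LF Lh; elim: s => [|i s IH]; first by rewrite !big_nil ip0r.
rewrite !big_cons ipDr ?IH//.
by elim/big_ind : _ => // *; [exact: L2_0|exact: L2D].
Qed.

Lemma ip_suml I (s : seq I) (F : I -> T -> C) h : (forall i, L2 (F i)) ->
  L2 h -> ip (\sum_(i <- s) F i) h = \sum_(i <- s) ip (F i) h.
Proof.
move=> LF Lh; elim: s => [|i s IH]; first by rewrite !big_nil ip0l.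
rewrite !big_cons ipDl ?IH//.
by elim/big_ind : _ => // *; [exact: L2_0|exact: L2D].
Qed.

Lemma L2_sum I (s : seq I) (F : I -> T -> C) : (forall i, L2 (F i)) ->
  L2 (\sum_(i <- s) F i).
Proof. by move=> LF; elim/big_ind : _ => // *; [exact: L2_0|exact: L2D]. Qed.

Lemma ip_ael f g h : L2 f -> L2 g -> L2 h -> f = g %[ae m] -> ip f h = ip g h.
Proof.
move=> Lf Lg Lh /ae_pointwise fg; apply: cintegral_ae.
- by apply: cmeasurableM; [case: Lf|case: (L2_conj Lh)].
- by apply: cmeasurableM; [case: Lg|case: (L2_conj Lh)].
- by apply/ae_pointwise; apply: filterS fg => z fg; rewrite -[LHS]/(_ z * _) fg.
Qed.

Lemma ip_aer f g h : L2 f -> L2 g -> L2 h -> f = g %[ae m] -> ip h f = ip h g.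
Proof.
by move=> Lf Lg Lh fg; rewrite ipC// (ip_ael Lf Lg Lh fg) -ipC.
Qed.

Definition nrm2 f : R := \int[m]_z (normc (f z) ^+ 2).

Lemma ip_nrm2 f : L2 f -> ip f f = (nrm2 f)%:C.
Proof.
move=> Lf; apply: complex_ext => /=.
  by apply: eq_Rintegral => z _; rewrite -[_ z]/(f z * (f z)^*) mulcJ.
rewrite (@eq_Rintegral _ _ _ _ _ (cst 0)); last first.
  by move=> z _; rewrite -[_ z]/(f z * (f z)^*) mulcJ.
by rewrite Rintegral_cst// mul0r.
Qed.

Lemma nrm2_ge0 f : 0 <= nrm2 f.
Proof. by apply: Rintegral_ge0 => z _; exact: sqr_ge0. Qed.

Lemma nrm2_re f : L2 f -> nrm2 f = re (ip f f).
Proof. by move=> Lf; rewrite ip_nrm2. Qed.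

Lemma nrm2E f : L2 f ->
  nrm2 f = \int[m]_z (re (f z) ^+ 2) + \int[m]_z (im (f z) ^+ 2).
Proof.
move=> /L2P[[mr ir] [mi ii]]; rewrite -RintegralD//.
by apply: eq_Rintegral => z _; rewrite normc_sqr.
Qed.

Lemma nrm2_eq0 f : L2 f -> nrm2 f = 0 -> f = 0 %[ae m].
Proof.
move=> Lf; rewrite nrm2E//; set a := \int[m]_z _; set b := \int[m]_z _.
have a0 : 0 <= a by apply: Rintegral_ge0 => z _; exact: sqr_ge0.
have b0 : 0 <= b by apply: Rintegral_ge0 => z _; exact: sqr_ge0.
move=> ab0; have {}a0 : a = 0 by lra.
have {}b0 : b = 0 by lra.
case/L2P : Lf => Lr Li.
have h1 := Rintegral_sqr_eq0 Lr a0; have h2 := Rintegral_sqr_eq0 Li b0.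
apply/ae_pointwise; apply: filterS2 h1 h2 => z /= /(_ I) h1 /(_ I) h2.
by apply: complex_ext.
Qed.

Lemma nrm2_sub f g c : L2 f -> L2 g ->
  nrm2 (f - c *: g) =
  nrm2 f - 2 * re (c^* * ip f g) + normc c ^+ 2 * nrm2 g.
Proof.
move=> Lf Lg; have Lcg := L2Z c Lg; rewrite nrm2_re; last exact: L2B.
rewrite ipBl ?ipBr ?ipZl ?ipZr//; try exact: L2B.
rewrite [ip g f]ipC// !ip_nrm2//.
have -> : c * (c^* * (nrm2 g)%:C) = (normc c ^+ 2 * nrm2 g)%:C.
  by rewrite mulrA mulcJ; apply: complex_ext => /=; ring.
move: (ip f g) => [a b]; case: c {Lcg} => x y /=; ring.
Qed.

Lemma nrm2Z c f : L2 f -> nrm2 (c *: f) = normc c ^+ 2 * nrm2 f.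
Proof.
move=> Lf; apply: complexI; rewrite -ip_nrm2; last exact: L2Z.
by rewrite ipZl ?ipZr ?ip_nrm2 ?mulrA ?mulcJ ?rmorphM//; exact: L2Z.
Qed.

Lemma parallelogram f g : L2 f -> L2 g ->
  nrm2 (f - g) + nrm2 (f + g) = 2 * nrm2 f + 2 * nrm2 g.
Proof.
move=> Lf Lg.
have LB := L2B Lf Lg; have LD := L2D Lf Lg.
rewrite !nrm2_re// ipBl// ipDl// !ipBr// !ipDr//.
case: (ip f f) => a1 a2; case: (ip f g) => b1 b2.
by case: (ip g f) => c1 c2; case: (ip g g) => d1 d2 /=; ring.
Qed.

(** For c = t <f, h> with t real, the hypothesis becomes 2 t q - t^2 q n <= e, where q = |<f, h>|^2
    and n = |h|^2, and t = 1/n is optimal. With e = |f|^2 this is the Cauchy-Schwarz inequality;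
    with e small it says that a nearly minimal vector is nearly orthogonal. *)
Lemma almost_orthogonal f h (e : R) : L2 f -> L2 h ->
  (forall c, nrm2 f - e <= nrm2 (f - c *: h)) ->
  normc (ip f h) ^+ 2 <= e * nrm2 h.
Proof.
move=> Lf Lh H; set q := normc _ ^+ 2; set n := nrm2 h.
have n0 : 0 <= n := nrm2_ge0 _.
have q0 : 0 <= q := sqr_ge0 _.
have {}H t : 2 * t * q - t ^+ 2 * q * n <= e.
  have := H (t%:C * ip f h); rewrite nrm2_sub// normcM exprMn -/q -/n.
  have -> : re ((t%:C * ip f h)^* * ip f h) = t * q.
    by rewrite /q normc_sqr; case: (ip f h) => a b /=; ring.
  have -> : normc t%:C ^+ 2 = t ^+ 2 by rewrite normc_sqr/= expr0n addr0.
  lra.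
have [n_eq0|n_neq0] := eqVneq n 0.
  rewrite n_eq0 mulr0 leNgt; apply/negP => q_gt0.
  (* When n = 0 the left side is linear in t, and this t gives it the value e + 1. *)
  have := H ((e + 1) / (2 * q)).
  rewrite n_eq0 mulr0 subr0 (_ : _ * q = e + 1); last by field; lra.
  lra.
have := H n^-1; rewrite (_ : _ - _ = q / n); last by field.
by rewrite ler_pdivrMr// lt0r n_neq0.
Qed.

Lemma cauchy_schwarz f g : L2 f -> L2 g ->
  normc (ip f g) ^+ 2 <= nrm2 f * nrm2 g.
Proof.
move=> Lf Lg; apply: almost_orthogonal => // c.
by rewrite subrr nrm2_ge0.
Qed.

(** Closed linear subspaces, with closedness expressed through squared distances. Since [f] ranges
    over functions, such a set also contains every L^2 function almost everywhere equal to one of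
    its elements. *)
Definition l2closed (M : set (T -> C)) : Prop :=
  [/\ M `<=` L2 (R:=R), M 0,
      forall c f g, M f -> M g -> M (c *: f + g) &
      forall f, L2 f ->
        (forall e, 0 < e -> exists2 g, M g & nrm2 (f - g) <= e) -> M f].

Lemma L2_complete (u : nat -> T -> C) : (forall n, L2 (u n)) ->
  (forall n k, (n <= k)%N -> nrm2 (u n - u k) <= 8 ^- n) ->
  exists2 f, L2 f & forall n, nrm2 (u n - f) <= 2 * 8 ^- n.
Proof.
move=> Lu cu.
have Lr n : rL2 m (fun z => re (u n z)) by case/L2P : (Lu n).
have Li n : rL2 m (fun z => im (u n z)) by case/L2P : (Lu n).
have cr n k : (n <= k)%N -> \int[m]_z ((re (u n z) - re (u k z)) ^+ 2) <= 8 ^- n.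
  move=> nk; apply: le_trans (cu n k nk); rewrite nrm2E; last exact: L2B.
  rewrite -[leLHS]addr0 lerD//; last by apply: Rintegral_ge0 => z _; exact: sqr_ge0.
  by under [leRHS]eq_Rintegral do rewrite reD raddfN.
have ci n k : (n <= k)%N -> \int[m]_z ((im (u n z) - im (u k z)) ^+ 2) <= 8 ^- n.
  move=> nk; apply: le_trans (cu n k nk); rewrite nrm2E; last exact: L2B.
  rewrite -[leLHS]add0r lerD//; first by apply: Rintegral_ge0 => z _; exact: sqr_ge0.
  by under [leRHS]eq_Rintegral do rewrite imD raddfN.
have [a La ua] := riesz_fischer Lr cr; have [b Lb ub] := riesz_fischer Li ci.
have Lf : L2 (fun z => a z +i* b z) by apply/L2P.
exists (fun z => a z +i* b z) => // n; rewrite nrm2E; last exact: L2B.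
rewrite mulr_natl mulr2n; apply: lerD.
  apply: le_trans (ua n); rewrite le_eqVlt; apply/orP; left; apply/eqP.
  by apply: eq_Rintegral => z _; rewrite reD raddfN.
apply: le_trans (ub n); rewrite le_eqVlt; apply/orP; left; apply/eqP.
by apply: eq_Rintegral => z _; rewrite imD raddfN.
Qed.

Lemma eq0_of_le_geometric (x K : R) : 0 <= x ->
  (forall n, x <= K * 8 ^- n) -> x = 0.
Proof.
move=> x0 xK; apply/eqP; rewrite eq_le x0 andbT leNgt; apply/negP => xgt0.
pose n := Num.bound (K / x).
have K0 : 0 <= K by have := xK 0%N; rewrite expr0 invr1 mulr1; lra.
have h1 : K / x < n%:R by apply: archi_boundP; rewrite divr_ge0.
have h2 : (n%:R : R) <= 8 ^+ n.
  by rewrite -natrX ler_nat ltnW// ltn_expl.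
have := xK n; rewrite ler_pdivlMr ?exprn_gt0//.
rewrite ltr_pdivrMr// in h1; nra.
Qed.

(** The parallelogram law makes a minimizing sequence Cauchy. Orthogonality is obtained from the
    nearly minimal terms by [almost_orthogonal] and passed to the limit, so the distance is never
    computed at the limit. *)
Lemma projection (M : set (T -> C)) g : l2closed M -> L2 g ->
  exists2 p, M p & forall h, M h -> ip (g - p) h = 0.
Proof.
move=> [ML M0 Mlin Mcl] Lg.
pose D := [set nrm2 (g - u) | u in M]; pose d := inf D.
have D0 : D !=set0 by exists (nrm2 (g - 0)), 0.
have Dlb : has_lbound D by exists 0 => _ [u _ <-]; exact: nrm2_ge0.
have dle u : M u -> d <= nrm2 (g - u) by move=> Mu; apply: ge_inf => //; exists u.
(* The parallelogram law bounds |u_n - u_k|^2 by 2 eps_n + 2 eps_k, hence by 4 eps_n = 8^-n, the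
   rate required by [L2_complete]. *)
pose eps n : R := 8 ^- n / 4.
have eps0 n : 0 < eps n by rewrite divr_gt0// invr_gt0 exprn_gt0.
have /choice[u uP] n : exists u, M u /\ nrm2 (g - u) < d + eps n.
  have [_ [u Mu <-] ud] := inf_adherent (eps0 n) (conj D0 Dlb).
  by exists u.
have Mu n := (uP n).1; have Lu n := ML _ (Mu n).
have epsle n k : (n <= k)%N -> eps k <= eps n.
  move=> nk; rewrite ler_pM2r// lef_pV2 ?posrE ?exprn_gt0//.
  by apply: ler_weXn2l => //; rewrite ler1n.
have cu n k : (n <= k)%N -> nrm2 (u n - u k) <= 8 ^- n.
  move=> nk.
  have := parallelogram (L2B Lg (Lu k)) (L2B Lg (Lu n)).
  have -> : g - u k - (g - u n) = u n - u k by apply/funext => z; rewrite !fctE; ring.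
  have -> : g - u k + (g - u n) = 2 *: (g - (2^-1 *: u k + 2^-1 *: u n)).
    apply/funext => z; rewrite -[LHS]/(g z - u k z + (g z - u n z)).
    by rewrite -[RHS]/(2 * (g z - (2^-1 * u k z + 2^-1 * u n z))); field.
  have Mmid : M (2^-1 *: u k + 2^-1 *: u n).
    apply: (Mlin _ _ _ (Mu k)); rewrite -[X in M X]addr0.
    exact: (Mlin _ _ _ (Mu n) M0).
  rewrite nrm2Z; last exact: (L2B Lg (ML _ Mmid)).
  rewrite normc_sqr/= addr0 expr0n/= addr0.
  have := dle _ Mmid; have := (uP n).2; have := (uP k).2; have := epsle n k nk.
  by rewrite /eps; lra.
have [p Lp up] := L2_complete Lu cu.
have Mp : M p.
  apply: Mcl => // e e0; exists (u (Num.bound (2 / e))) => //.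
  rewrite -opprB -scaleN1r nrm2Z; last exact: L2B.
  rewrite normc_sqr/= oppr0 expr0n/= addr0 sqrrN expr1n mul1r.
  apply: le_trans (up _) _; set n := Num.bound _.
  have h1 : 2 / e < n%:R by apply: archi_boundP; rewrite divr_ge0// ltW.
  have h2 : (n%:R : R) <= 8 ^+ n by rewrite -natrX ler_nat ltnW// ltn_expl.
  rewrite ler_pdivrMr ?exprn_gt0//.
  rewrite ltr_pdivrMr// in h1; nra.
exists p => // h Mh; have Lh := ML _ Mh.
apply: eq0_normc; apply/eqP; rewrite -sqrf_eq0; apply/eqP.
(* By |a + b|^2 <= 2 |a|^2 + 2 |b|^2 the factor is 2 / 4 from [eps n] plus 2 * 2 from the distance
   to the limit, at most 5. *)
apply: (@eq0_of_le_geometric _ (5 * nrm2 h)); first exact: sqr_ge0.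
move=> n.
have -> : g - p = (g - u n) + (u n - p) by rewrite addrA subrK.
rewrite ipDl//; try exact: L2B.
have h1 : normc (ip (g - u n) h) ^+ 2 <= eps n * nrm2 h.
  apply: almost_orthogonal => //; first exact: L2B.
  move=> c; have : M (c *: h + u n) by exact: Mlin.
  move=> /dle; rewrite opprD [- _ - _]addrC addrA => h2.
  by have := (uP n).2; lra.
have h2 := cauchy_schwarz (L2B (Lu n) Lp) Lh.
have h3 : nrm2 (u n - p) * nrm2 h <= 2 * 8 ^- n * nrm2 h.
  by apply: ler_wpM2r => //; exact: nrm2_ge0.
have h4 := le_normcD (ip (g - u n) h) (ip (u n - p) h).
have h5 : normc (ip (g - u n) h + ip (u n - p) h) ^+ 2 <=
   2 * normc (ip (g - u n) h) ^+ 2 + 2 * normc (ip (u n - p) h) ^+ 2.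
  have := normc_nonneg (ip (g - u n) h + ip (u n - p) h).
  move: h4; set a := normc _; set b := normc _; set c := normc _ => h4 a0.
  by have := sqr_ge0 (b - c); nra.
apply: le_trans h5 _; have := nrm2_ge0 h; move: h1 h3; rewrite /eps.
have : 0 <= (8 ^- n : R) by rewrite invr_ge0 exprn_ge0.
move: h2; set e := 8 ^- n; move=> *.
nra.
Qed.

Definition orth (S : set (T -> C)) : set (T -> C) :=
  [set f | L2 f /\ forall g, S g -> ip f g = 0].

Lemma l2closed_orth (S : set (T -> C)) : S `<=` L2 (R:=R) -> l2closed (orth S).
Proof.
move=> SL; split.
- by move=> f [].
- by split; [exact: L2_0|move=> g _; exact: ip0l].
- move=> c f g [Lf fS] [Lg gS]; split; first exact: L2_lin.
  by move=> h Sh; rewrite ip_lin ?fS ?gS ?mulr0 ?addr0//; exact: SL.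
- move=> f Lf H; split => // g Sg; have Lg := SL _ Sg.
  apply: eq0_normc; apply/eqP; rewrite -sqrf_eq0; apply/eqP.
  apply: (@eq0_of_le_geometric _ (nrm2 g)); first exact: sqr_ge0.
  move=> n; have [|u [Lu uS] fu] := H (8 ^- n); first by rewrite invr_gt0 exprn_gt0.
  have -> : ip f g = ip (f - u) g by rewrite ipBl// uS// subr0.
  apply: le_trans (cauchy_schwarz (L2B Lf Lu) Lg) _; rewrite mulrC.
  by apply: ler_wpM2l => //; exact: nrm2_ge0.
Qed.

End Hilbert.

(** * Uniqueness of Fourier coefficients *)

Section StepApproximation.
Variable R : realType.
Implicit Types (x : R) (n : nat).

Lemma bernoulli_ineq x n : -1 <= x -> 1 + n%:R * x <= (1 + x) ^+ n.
Proof.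
move=> x1; elim: n => [|n IH]; first by rewrite mul0r addr0 expr0.
rewrite exprS; apply: (@le_trans _ _ ((1 + x) * (1 + n%:R * x))).
  have : 0 <= n%:R * x ^+ 2 by rewrite mulr_ge0// sqr_ge0.
  by rewrite -natr1; nra.
by apply: ler_wpM2l => //; lra.
Qed.

(** With z = (1 + x) / 2 one has x <= z^2, since z^2 - x = (1 - x)^2 / 4. Bernoulli's inequality for
    1/z bounds n z^n, and the second factor z^n tends to 0. *)
Lemma cvg_natrM_expr x : 0 <= x < 1 -> n%:R * x ^+ n @[n --> \oo] --> (0 : R).
Proof.
move=> /andP[x0 x1]; pose z := (1 + x) / 2.
have z0 : 0 < z by rewrite /z; lra.
have z1 : z < 1 by rewrite /z; lra.
have xz : x <= z * z by rewrite /z; have := sqr_ge0 (1 - x); lra.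
have zn n : n%:R * z ^+ n <= (z^-1 - 1)^-1.
  have d0 : 0 < z^-1 - 1 by rewrite subr_gt0 invf_gt1.
  have zn0 : 0 < z ^+ n by exact: exprn_gt0.
  have h : 1 + n%:R * (z^-1 - 1) <= z^-1 ^+ n.
    rewrite [in leRHS](_ : z^-1 = 1 + (z^-1 - 1)); last by ring.
    by apply: bernoulli_ineq; lra.
  rewrite -(ler_pM2r d0) mulVf ?gt_eqF//.
  have e : z ^+ n * z^-1 ^+ n = 1 by rewrite -exprMn mulfV ?expr1n// gt_eqF.
  nra.
apply: (@squeeze_cvgr _ _ _ _ (fun=> 0) (fun n => (z^-1 - 1)^-1 * z ^+ n)).
- apply: nearW => n; rewrite mulr_ge0 ?exprn_ge0//=.
  apply: (@le_trans _ _ (n%:R * (z * z) ^+ n)).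
    by apply: ler_wpM2l => //; apply: lerXn2r; rewrite ?nnegrE//; nra.
  rewrite exprMn mulrA; apply: ler_wpM2r; first by apply: exprn_ge0; lra.
  exact: zn.
- exact: cvg_cst.
- rewrite -[X in _ --> X](mulr0 (z^-1 - 1)^-1); apply: cvgM; first exact: cvg_cst.
  by apply: cvg_expr; rewrite ger0_norm//; lra.
Qed.

(** Bernoulli gives (1 + 1/N)^N >= 2, and (1 - 1/N)(1 + 1/N) <= 1. *)
Lemma half_bound (N : nat) : (0 < N)%N -> (1 - N%:R^-1) ^+ N <= (2^-1 : R).
Proof.
move=> N0; have N1 : (0 : R) < N%:R by rewrite ltr0n.
have iN0 : 0 < (N%:R^-1 : R) by rewrite invr_gt0.
have iN1 : (N%:R^-1 : R) <= 1 by rewrite invf_le1// ler1n.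
have h1 : 2 <= (1 + N%:R^-1 : R) ^+ N.
  apply: le_trans (bernoulli_ineq _ _); last by lra.
  by rewrite mulfV ?gt_eqF//; lra.
have h2 : (1 - N%:R^-1 : R) ^+ N * (1 + N%:R^-1) ^+ N <= 1.
  rewrite -exprMn; apply: exprn_ile1; nra.
have h3 : 0 <= (1 - N%:R^-1 : R) ^+ N by apply: exprn_ge0; lra.
nra.
Qed.

(* These polynomials come from Brosowski and Deutsch's elementary proof of the
   Stone-Weierstrass theorem. *)
Lemma cvg_step x : 0 <= x <= 1 ->
  ((1 - x ^+ n) ^+ (n * 2 ^ n) : R) @[n --> \oo] --> (((x < 2^-1)%R)%:R : R).
Proof.
move=> /andP[x0 x1].
have xn n : 0 <= x ^+ n <= 1 by rewrite exprn_ge0// exprn_ile1.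
have b1 n : (1 - x ^+ n) ^+ (n * 2 ^ n) <= 1.
  by have /andP[h1 h2] := xn n; apply: exprn_ile1; lra.
have b0 n : 0 <= (1 - x ^+ n) ^+ (n * 2 ^ n).
  by have /andP[h1 h2] := xn n; apply: exprn_ge0; lra.
have [xh|xh] := ltP x 2^-1.
  (* Below 1/2, Bernoulli bounds the polynomial from below by 1 - n 2^n x^n, and 2x < 1. *)
  apply: (@squeeze_cvgr _ _ _ _ (fun n => 1 - n%:R * (2 * x) ^+ n) (fun=> 1)).
  - apply: nearW => n; rewrite b1 andbT.
    apply: le_trans (bernoulli_ineq _ _).
      by rewrite natrM natrX mulrN exprMn mulrA.
    by have /andP[h1 h2] := xn n; lra.
  - rewrite -[X in _ --> X]subr0; apply: cvgB; first exact: cvg_cst.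
    by apply: cvg_natrM_expr; lra.
  - exact: cvg_cst.
(* From 1/2 on, x^n >= 2^-n, so the power 2^n of 1 - x^n is at most 1/2 by [half_bound] with N =
   2^n; the remaining exponent n makes it tend to 0. *)
apply: (@squeeze_cvgr _ _ _ _ (fun=> 0) (fun n => 2^-1 ^+ n)).
- apply: nearW => n; rewrite b0/=.
  rewrite mulnC exprM; apply: lerXn2r; rewrite ?nnegrE ?invr_ge0//.
    by have /andP[h1 h2] := xn n; apply: exprn_ge0; lra.
  have := @half_bound (2 ^ n) _; rewrite expn_gt0 => /(_ isT); apply: le_trans.
  have h : 2^-1 ^+ n <= x ^+ n by apply: lerXn2r; rewrite ?nnegrE ?invr_ge0.
  apply: lerXn2r; rewrite ?nnegrE.
  + by have /andP[] := xn n; lra.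
  + by rewrite subr_ge0 invf_le1// ler1n ?expn_gt0.
  + by rewrite natrX -exprVn; lra.
- exact: cvg_cst.
- by apply: cvg_expr; rewrite ger0_norm// invf_lt1// ltr1n.
Qed.

End StepApproximation.

(** * Functionals on bounded functions that vanish on all monomials *)

Section FourierUniqueness.
Variable R : realType.
Local Notation T := (circle R).
Local Notation C := R[i].
Local Notation m := (@circle_measure R).
Local Notation re := (@complex.Re R).
Local Notation im := (@complex.Im R).
Implicit Types (f g h p q : T -> C) (c : C) (r s : T -> R).

Definition rfun r : T -> C := fun z => (r z)%:C.

Lemma bmeas_rfun r (B : R) : measurable_fun [set: T] r ->
  (forall z, `|r z| <= B) -> bmeas (rfun r).
Proof.
move=> mr rB; split; first exact: cmeasurable_real.
exists B => z; apply: le_trans (rB z).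
by rewrite /rfun /= expr0n addr0 sqrtr_sqr.
Qed.

Lemma rfun_measurable r : bmeas (rfun r) -> measurable_fun [set: T] r.
Proof. by case=> -[]. Qed.

Definition bounded_cvg (r : nat -> T -> R) s :=
  [/\ forall n, measurable_fun [set: T] (r n),
      forall n z, 0 <= r n z <= 1 &
      forall z, r n z @[n --> \oo] --> s z].

Lemma bounded_cvg_lim (r : nat -> T -> R) s : bounded_cvg r s ->
  measurable_fun [set: T] s /\ forall z, 0 <= s z <= 1.
Proof.
move=> [mr r01 rs]; split; first exact: (measurable_fun_cvg mr).
move=> z; apply/andP; split.
  rewrite -(cvg_lim (@Rhausdorff R) (rs z)); apply: limr_ge.
    by apply/cvg_ex; exists (s z).
  by apply: nearW => n; case/andP : (r01 n z).
rewrite -(cvg_lim (@Rhausdorff R) (rs z)); apply: limr_le.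
  by apply/cvg_ex; exists (s z).
by apply: nearW => n; case/andP : (r01 n z).
Qed.

Lemma le01_norm (x : R) : 0 <= x <= 1 -> `|x| <= 1.
Proof. by move=> /andP[x0 x1]; rewrite ger0_norm. Qed.

Lemma Rintegral_bounded_cvg (a : T -> R) (r : nat -> T -> R) s : rint m a ->
  bounded_cvg r s ->
  \int[m]_z (r n z * a z) @[n --> \oo] --> \int[m]_z (s z * a z).
Proof.
move=> ia rs; have [ms s01] := bounded_cvg_lim rs; case: rs => mr r01 rs.
have ma := rint_meas ia.
have irn n : rint m (fun z => r n z * a z).
  under eq_fun do rewrite mulrC; apply: (@rint_bounded_mul _ _ _ _ _ _ 1) => // z.
  exact: le01_norm.
have [] := @dominated_convergence _ _ _ m _ measurableT
  (fun n z => (r n z * a z)%:E) (fun z => (s z * a z)%:E) (fun z => `|a z|%:E).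
- by move=> n; apply/measurable_EFinP; exact: rint_meas (irn n).
- by apply/measurable_EFinP; exact: measurable_funM.
- apply: aeW => z _; apply: cvg_EFin; first exact: nearW.
  by apply: cvgM; [exact: rs|exact: cvg_cst].
- exact: integrable_norm.
- apply: aeW => z n _; rewrite /= lee_fin normrM -[leRHS]mul1r.
  by apply: ler_wpM2r => //; exact: le01_norm.
- by move=> is_ _; rewrite Rintegral_EFin// => /fine_cvg.
Qed.

Lemma cintegral_bounded_cvg g (r : nat -> T -> R) s : cint g ->
  bounded_cvg r s ->
  re (cintegral (rfun (r n) * g)) @[n --> \oo] --> re (cintegral (rfun s * g)) /\
  im (cintegral (rfun (r n) * g)) @[n --> \oo] --> im (cintegral (rfun s * g)).
Proof.
move=> [rg ig] rs.
have E1 r' : re (cintegral (rfun r' * g)) = \int[m]_z (r' z * re (g z)).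
  by apply: eq_Rintegral => z _; rewrite reM/= mul0r subr0.
have E2 r' : im (cintegral (rfun r' * g)) = \int[m]_z (r' z * im (g z)).
  by apply: eq_Rintegral => z _; rewrite imM/= mul0r addr0.
split; under eq_fun do rewrite ?E1 ?E2; rewrite ?E1 ?E2;
  exact: Rintegral_bounded_cvg.
Qed.

(* Functionals on bounded measurable functions covering both [f |-> \int f g]
   and the difference of two finite measures. *)
Definition bfunc (L : (T -> C) -> C) : Prop :=
  (forall c p q, bmeas p -> bmeas q -> L (c *: p + q) = c * L p + L q) /\
  (forall (r : nat -> T -> R) s q, bmeas q -> bounded_cvg r s ->
     (forall n, L (rfun (r n) * q) = 0) -> L (rfun s * q) = 0).

Lemma bfunc_cintegral f : cint f -> bfunc (fun p => cintegral (f * p)).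
Proof.
move=> cf; split=> [c p q bp bq|r s q bq rs H].
  rewrite mulrDr scalefE mulrCA -scalefE cintegralD ?cintegralZ//;
    try exact: cint_bmeasM.
  by apply: cintZ; exact: cint_bmeasM.
have [h1 h2] := cintegral_bounded_cvg (cint_bmeasM cf bq) rs.
rewrite mulrCA.
have E n : cintegral (rfun (r n) * (f * q)) = 0 by rewrite mulrCA.
move: h1 h2; under eq_fun do rewrite E.
under [X in _ -> X @ _ --> _ -> _]eq_fun do rewrite E.
move=> h1 h2; apply: complex_ext.
  by apply: (cvg_unique (@Rhausdorff R) h1); exact: cvg_cst.
by apply: (cvg_unique (@Rhausdorff R) h2); exact: cvg_cst.
Qed.

Lemma bfuncM L p : bfunc L -> bmeas p -> bfunc (fun q => L (p * q)).
Proof.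
move=> [lin lim] bp; split=> [c q q' bq bq'|r s q bq rs H].
  by rewrite mulrDr scalefE mulrCA -scalefE lin//; exact: bmeasM.
rewrite mulrCA; apply: lim rs _; first exact: bmeasM.
by move=> n; rewrite mulrCA.
Qed.

(* Quantifying over all [L] makes this set an algebra; it is also stable under
   bounded pointwise limits, so the indicators in it form a sigma-algebra. *)
Definition fourier_determined : set (T -> C) :=
  [set p | bmeas p /\ forall L, bfunc L -> (forall n : int, L (zpow n) = 0) ->
             forall n : int, L (p * zpow n) = 0].
Local Notation Q := fourier_determined.

Lemma fdet_zpow n : Q (zpow n).
Proof.
by split; [exact: bmeas_zpow|move=> L bL L0 k; rewrite -zpowD].
Qed.

Lemma fdetM p q : Q p -> Q q -> Q (p * q).
Proof.
move=> [bp Qp] [bq Qq]; split; first exact: bmeasM.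
move=> L bL L0 n; rewrite -mulrA.
by apply: (Qq (fun q => L (p * q))); [exact: bfuncM|exact: Qp].
Qed.

Lemma fdet_lin c p q : Q p -> Q q -> Q (c *: p + q).
Proof.
move=> [bp Qp] [bq Qq]; split; first by apply: bmeasD => //; exact: bmeasZ.
move=> L bL L0 n; rewrite mulrDl scalefE -mulrA -scalefE (proj1 bL).
- by rewrite Qp// Qq// mulr0 addr0.
- by apply: bmeasM => //; exact: bmeas_zpow.
- by apply: bmeasM => //; exact: bmeas_zpow.
Qed.

Lemma fdet_cst c : Q (cst c).
Proof.
have -> : cst c = c *: zpow 0 + (0 *: zpow 0 + 0 *: zpow 0).
  by apply/funext => z; rewrite zpow0 !fctE !scale0r !addr0 -[RHS]/(c * 1) mulr1.
have Q0 : Q (0 *: zpow 0 + 0 *: zpow 0).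
  rewrite !scale0r addr0; split; first exact: (@bmeas_cst _ 0).
  move=> L bL L0 n; rewrite mul0r.
  have := proj1 bL (-1) _ _ (bmeas_zpow R 0) (bmeas_zpow R 0).
  by rewrite scaleN1r addNr L0 mulr0 addr0.
by apply: fdet_lin => //; exact: fdet_zpow.
Qed.

Lemma fdet_lim (r : nat -> T -> R) s : (forall n, Q (rfun (r n))) ->
  (forall n z, 0 <= r n z <= 1) -> (forall z, r n z @[n --> \oo] --> s z) ->
  Q (rfun s).
Proof.
move=> Qr r01 rs.
have bc : bounded_cvg r s.
  by split => // n; apply: rfun_measurable; case: (Qr n).
have [ms s01] := bounded_cvg_lim bc; split.
  by apply: (@bmeas_rfun _ 1) => // z; exact: le01_norm.
move=> L bL L0 n; apply: (proj2 bL _ _ _ (bmeas_zpow _ _) bc) => k.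
by case: (Qr k) => _; apply.
Qed.

Lemma fdetX p n : Q p -> Q (p ^+ n).
Proof.
move=> Qp; elim: n => [|n IH]; first by rewrite expr0; exact: (fdet_cst 1).
by rewrite exprS; exact: fdetM.
Qed.

Lemma fdetB1 p : Q p -> Q (cst 1 - p).
Proof. by move=> Qp; rewrite addrC -scaleN1r; apply: fdet_lin => //; exact: fdet_cst. Qed.

Lemma rfun_affine r (a b : R) : Q (rfun r) -> Q (rfun (fun z => a * r z + b)).
Proof.
move=> Qr; have -> : rfun (fun z => a * r z + b) = a%:C *: rfun r + cst (b%:C).
  by apply/funext => z; apply: complex_ext => /=; ring.
by apply: fdet_lin => //; exact: fdet_cst.
Qed.

Definition fdet_set : set (set T) := [set A | Q (rfun (\1_A))].

(** The step polynomials applied to [r] stay in the algebra and converge pointwise to the indicator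
    of the set. *)
Lemma fdet_set_half r : Q (rfun r) -> (forall z, 0 <= r z <= 1) ->
  fdet_set [set z | r z < 2^-1].
Proof.
move=> Qr r01.
apply: (@fdet_lim (fun n z => (1 - r z ^+ n) ^+ (n * 2 ^ n))).
- move=> n; rewrite (_ : rfun _ = (cst 1 - rfun r ^+ n) ^+ (n * 2 ^ n)).
    by apply/fdetX/fdetB1/fdetX.
  apply/funext => z.
  have X k g : (g ^+ k) z = g z ^+ k.
    by elim: k => // k IH; rewrite !exprS -IH.
  rewrite X -[(_ - _) z]/(1 - (rfun r ^+ n) z) X /rfun.
  by rewrite -[1 in RHS]/(1%:C) -rmorphXn/= -rmorphB/= -rmorphXn.
- move=> n z; have /andP[h1 h2] := r01 z.
  have h3 : 0 <= r z ^+ n <= 1 by rewrite exprn_ge0// exprn_ile1.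
  by rewrite exprn_ge0 ?exprn_ile1//; lra.
- move=> z; have := cvg_step (r01 z); rewrite indicE.
  by rewrite (_ : (z \in _) = (r z < 2^-1)) //; apply/idP/idP; rewrite inE.
Qed.

Lemma fdet_set_lt r (c : R) : Q (rfun r) -> (forall z, `|r z| <= 1) ->
  fdet_set [set z | r z < c].
Proof.
(* Dividing by k = 2 (1 + |c|) maps r - c into [-1/2, 1/2]; adding 1/2 gives values in [0, 1] and
   moves the threshold c to 1/2. *)
move=> Qr r1; pose k := 2 * (1 + `|c|).
have k0 : 0 < k by rewrite /k; have := normr_ge0 c; lra.
rewrite (_ : [set _ | _] = [set z | k^-1 * r z + (2^-1 - k^-1 * c) < 2^-1]).
  apply: (@fdet_set_half (fun z => k^-1 * r z + (2^-1 - k^-1 * c))).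
    exact: rfun_affine.
  move=> z; rewrite addrCA -mulrBr.
  have : `|r z - c| <= 1 + `|c|.
    by apply: le_trans (ler_normB _ _) _; rewrite lerD2r.
  rewrite ler_norml => /andP[h1 h2].
  have e : k^-1 * (1 + `|c|) = 2^-1 by rewrite /k; field; have := normr_ge0 c; lra.
  have ik : 0 < k^-1 by rewrite invr_gt0.
  by apply/andP; split; nra.
apply/seteqP; split => z /=; have ik : 0 < k^-1 by rewrite invr_gt0.
  by rewrite -(ltr_pM2l ik); lra.
by rewrite -(ltr_pM2l ik (r z)); lra.
Qed.

Lemma fdet_setC A : fdet_set A -> fdet_set (~` A).
Proof.
rewrite /fdet_set /= => QA; have := rfun_affine (-1) 1 QA; congr Q.
apply/funext => z; congr (_%:C); rewrite !indicE in_setC.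
by case: (z \in A) => /=; ring.
Qed.

Lemma fdet_setI A B : fdet_set A -> fdet_set B -> fdet_set (A `&` B).
Proof.
move=> QA QB; have := fdetM QA QB; congr Q.
apply/funext => z; rewrite /rfun -[LHS]/(_%:C * _%:C) -rmorphM/=; congr (_%:C).
by rewrite !indicE in_setI; case: (z \in A); case: (z \in B); rewrite /= ?mulr0 ?mulr1.
Qed.

Lemma fdet_setU A B : fdet_set A -> fdet_set B -> fdet_set (A `|` B).
Proof.
move=> QA QB; rewrite -[_ `|` _]setCK setCU; apply/fdet_setC/fdet_setI;
  exact: fdet_setC.
Qed.

Lemma fdet_set0 : fdet_set set0.
Proof. by rewrite /fdet_set /=; have := fdet_cst 0; congr Q; apply/funext => z; rewrite /rfun indic0. Qed.

Lemma fdet_setT : fdet_set setT.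
Proof. by rewrite -setC0; exact: fdet_setC fdet_set0. Qed.

Lemma fdet_bigcup (A : (set T)^nat) : (forall i, fdet_set (A i)) ->
  fdet_set (\bigcup_i A i).
Proof.
move=> QA; pose F n := \big[setU/set0]_(i < n) A i.
have QF n : fdet_set (F n).
  by rewrite /F; elim/big_ind : _ => //; [exact: fdet_set0|exact: fdet_setU].
apply: (@fdet_lim (fun n => \1_(F n))) => [//|n z|z].
  by rewrite indicE; case: (_ \in _); rewrite /= ?ler01 ?lexx.
have [[i _ Aiz]|nA] := pselect ((\bigcup_i A i) z).
  apply: cvg_near_cst; near=> n; rewrite !indicE !mem_set//; first by exists i.
  rewrite /F -bigcup_mkord; exists i => //=.
  by near: n; exists i.+1.
rewrite (_ : (fun n => _) = fun=> \1_(\bigcup_i A i) z); first exact: cvg_cst.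
apply/funext => n; rewrite !indicE !memNset// /F -bigcup_mkord => -[i _ Aiz].
by apply: nA; exists i.
Unshelve. all: by end_near. Qed.

(** The inverse of [cexp] on [0, 1[, that is, the angle in turns: [acos] covers the upper half
    circle and its reflection the lower one. *)
Definition circle_arg (z : T) : R :=
  if 0 <= im z then acos (re z) / (2 * pi) else 1 - acos (re z) / (2 * pi).

Lemma circle_re_bound (z : T) : -1 <= re z <= 1.
Proof.
by rewrite -ler_norml; apply: le_trans (re_le_normc _) _; rewrite (eqP (circle_valP z)).
Qed.

Lemma circle_im_bound (z : T) : `|im z| <= 1.
Proof. by apply: le_trans (im_le_normc _) _; rewrite (eqP (circle_valP z)). Qed.

Lemma circle_re2im2 (z : T) : re z ^+ 2 + im z ^+ 2 = 1.
Proof. by rewrite -normc_sqr (eqP (circle_valP z)) expr1n. Qed.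

Lemma circle_argK (z : T) : cexp (circle_arg z) = z.
Proof.
apply: val_inj => /=.
have pi2 : 2 * pi != 0 :> R by rewrite mulf_neq0// gt_eqF// pi_gt0.
have sq : Num.sqrt (1 - re z ^+ 2) = `|im z|.
  by rewrite -sqrtr_sqr -(circle_re2im2 z); congr (Num.sqrt _); ring.
apply: complex_ext => /=; rewrite /circle_arg; case: ifPn => h.
- by rewrite mulrC divfK// acosK// in_itv/= circle_re_bound.
- rewrite mulrBr mulr1 mulrCA mulfV// mulr1 cosB.
  have -> : 2 * pi = pi *+ 2 :> R by rewrite mulr_natl.
  by rewrite cos2pi sin2pi mul1r mul0r addr0 acosK// in_itv/= circle_re_bound.
- by rewrite mulrC divfK// sin_acos ?circle_re_bound// sq ger0_norm.
- rewrite mulrBr mulr1 mulrCA mulfV// mulr1 sinB.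
  have -> : 2 * pi = pi *+ 2 :> R by rewrite mulr_natl.
  rewrite cos2pi sin2pi mul0r mul1r add0r sin_acos ?circle_re_bound// sq.
  by rewrite ltr0_norm ?opprK// ltNge.
Qed.

Lemma fdet_rfun_re : Q (rfun (fun z : T => re z)).
Proof.
have -> : rfun (fun z : T => re z) = 2^-1 *: zpow 1 + (2^-1 *: zpow (-1) + cst 0).
  rewrite -conj_zpow addr0; apply/funext => z; apply/eqP; rewrite eq_complex.
  rewrite -[(_ + _) z]/(2^-1 * zpow 1 z + 2^-1 * (zpow 1 z)^*) /zpow expr1z -mulrDr.
  by rewrite addcJ mulrA mulVf ?mul1r ?eqxx// pnatr_eq0.
by apply: fdet_lin; [exact: fdet_zpow|apply: fdet_lin; [exact: fdet_zpow|exact: fdet_cst]].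
Qed.

Lemma fdet_rfun_im : Q (rfun (fun z : T => im z)).
Proof.
have -> : rfun (fun z : T => im z) =
    (0 -i* 2^-1) *: zpow 1 + ((0 +i* 2^-1) *: zpow (-1) + cst 0).
  rewrite -conj_zpow addr0; apply/funext => z.
  rewrite -[RHS]/((0 -i* 2^-1) * zpow 1 z + (0 +i* 2^-1) * (zpow 1 z)^*) /zpow expr1z.
  by rewrite /rfun; case: z => -[a b] ?; apply: complex_ext => /=; field.
by apply: fdet_lin; [exact: fdet_zpow|apply: fdet_lin; [exact: fdet_zpow|exact: fdet_cst]].
Qed.

Lemma fdet_rfunN r : Q (rfun r) -> Q (rfun (fun z => - r z)).
Proof.
by move=> /(rfun_affine (-1) 0); congr Q; apply/funext => z; congr (_%:C); ring.
Qed.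

Lemma acos_lt_cos (z : T) (s : R) : 0 <= s -> s <= pi ->
  (acos (re z) < s) = (cos s < re z).
Proof.
move=> s0 spi; have zb := circle_re_bound z.
rewrite -[in RHS](acosK (_ : re z \in `[-1, 1])) ?in_itv//.
by rewrite ltr_cos// in_itv/= ?s0 ?spi// acos_ge0 ?acos_lepi.
Qed.

Lemma acos_gt_cos (z : T) (s : R) : 0 <= s -> s <= pi ->
  (s < acos (re z)) = (re z < cos s).
Proof.
move=> s0 spi; have zb := circle_re_bound z.
rewrite -[in RHS](acosK (_ : re z \in `[-1, 1])) ?in_itv//.
by rewrite ltr_cos// in_itv/= ?s0 ?spi// acos_ge0 ?acos_lepi.
Qed.

Lemma fdet_acos_lt (s : R) : fdet_set [set z : T | acos (re z) < s].
Proof.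
have [s0|s0] := ltP s 0.
  rewrite (_ : [set _ | _] = set0); first exact: fdet_set0.
  apply/seteqP; split => z //=; have := acos_ge0 (circle_re_bound z); lra.
have [spi|spi] := ltP pi s.
  rewrite (_ : [set _ | _] = setT); first exact: fdet_setT.
  apply/seteqP; split => z //= _; have := acos_lepi (circle_re_bound z); lra.
rewrite (_ : [set _ | _] = [set z : T | - re z < - cos s]).
  apply: (@fdet_set_lt (fun z => - re z)); first exact: fdet_rfunN fdet_rfun_re.
  by move=> z; rewrite normrN ler_norml circle_re_bound.
by apply/seteqP; split => z /=; rewrite ltrN2 acos_lt_cos.
Qed.

Lemma fdet_acos_gt (s : R) : fdet_set [set z : T | s < acos (re z)].
Proof.
have [s0|s0] := ltP s 0.
  rewrite (_ : [set _ | _] = setT); first exact: fdet_setT.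
  apply/seteqP; split => z //= _; have := acos_ge0 (circle_re_bound z); lra.
have [spi|spi] := ltP pi s.
  rewrite (_ : [set _ | _] = set0); first exact: fdet_set0.
  apply/seteqP; split => z //=; have := acos_lepi (circle_re_bound z); lra.
rewrite (_ : [set _ | _] = [set z : T | re z < cos s]).
  apply: (@fdet_set_lt (fun z => re z)); first exact: fdet_rfun_re.
  by move=> z; rewrite ler_norml circle_re_bound.
by apply/seteqP; split => z /=; rewrite acos_gt_cos.
Qed.

(** On either half of the circle the inequality bounds [acos (re z)] from one side, hence also
    [re z], since the cosine decreases on [0, pi]. *)
Lemma fdet_arg_lt (s : R) : fdet_set [set z : T | circle_arg z < s].
Proof.
have pi2 : 0 < 2 * pi :> R by rewrite mulr_gt0// pi_gt0.
have imlt : fdet_set [set z : T | im z < 0].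
  by apply: (@fdet_set_lt (fun z => im z)); [exact: fdet_rfun_im|exact: circle_im_bound].
rewrite (_ : [set _ | _] =
  ((~` [set z : T | im z < 0]) `&` [set z : T | acos (re z) < s * (2 * pi)]) `|`
  ([set z : T | im z < 0] `&` [set z : T | (1 - s) * (2 * pi) < acos (re z)])).
  apply: fdet_setU; apply: fdet_setI => //.
  - exact: fdet_setC.
  - exact: fdet_acos_lt.
  - exact: fdet_acos_gt.
apply/seteqP; split => z /=; rewrite /circle_arg.
  case: ifPn => h.
    by rewrite ltr_pdivrMr// => h2; left; split => //; apply/negP; rewrite -leNgt.
  rewrite ltrBlDl -ltrBlDr ltr_pdivlMr// => h2; right; split => //.
  by rewrite ltNge.
case=> -[h h2].
  by rewrite ifT ?ltr_pdivrMr// leNgt; apply/negP.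
by rewrite ifN -?ltNge// ltrBlDl -ltrBlDr ltr_pdivlMr.
Qed.

(** As [circle_arg] is a section of [cexp], the set [B] is the preimage under [circle_arg] of its
    preimage in the line, so it suffices to treat the half-lines that generate the Borel sets. *)
Lemma measurable_fdet (B : set T) : measurable B -> fdet_set B.
Proof.
move=> mB.
suff H (Y : set R) : measurable Y -> fdet_set (circle_arg @^-1` Y).
  have := H _ (mB : measurable (cexp (R:=R) @^-1` B)); congr fdet_set.
  by apply/seteqP; split => z /=; rewrite circle_argK.
move=> mY; have {}mY : (@RGenInftyO.G R).-sigma.-measurable Y.
  by rewrite -RGenInftyO.measurableE.
suff sub : <<s (@RGenInftyO.G R) >> `<=` [set Y | fdet_set (circle_arg @^-1` Y)].
  exact: sub.
apply: smallest_sub.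
  split.
  - by rewrite /= preimage_set0; exact: fdet_set0.
  - by move=> A QA; rewrite /= setTD preimage_setC; exact: fdet_setC.
  - by move=> A QA; rewrite /= preimage_bigcup; exact: fdet_bigcup.
move=> _ [x ->] /=; rewrite (_ : _ @^-1` _ = [set z : T | circle_arg z < x]).
  exact: fdet_arg_lt.
by apply/seteqP; split => z /=; rewrite in_itv.
Qed.

Lemma bfunc_indic_eq0 L (B : set T) : bfunc L ->
  (forall n : int, L (zpow n) = 0) -> measurable B -> L (rfun (\1_B)) = 0.
Proof.
move=> bL L0 mB; have [_ /(_ L bL L0 0)] := measurable_fdet mB.
by rewrite zpow0 mulr1.
Qed.

(** Indicators of Borel sets are determined by the monomials, so the real and imaginary parts of [f]
    integrate to 0 over every Borel set. *)
Lemma cintegral_unique f : cint f ->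
  (forall n : int, cintegral (f * zpow n) = 0) -> f = 0 %[ae m].
Proof.
move=> cf f0; have [rf jf] := cf.
have H B : measurable B -> cintegral (f * rfun (\1_B)) = 0.
  by move=> mB; apply: (@bfunc_indic_eq0 (fun p => cintegral (f * p))) => //;
     exact: bfunc_cintegral.
have K (a : T -> R) : rint m a ->
    (forall B, measurable B -> \int[m]_z (a z * \1_B z) = 0) -> {ae m, forall z, a z = 0}.
  move=> ia a0.
  have : ae_eq m [set: T] (EFin \o a) (cst 0%E).
    apply: integral_ae_eq => //.
    move=> E _ mE; rewrite integral_cst// mul0e integral_mkcond.
    have -> : ((EFin \o a) \_ E) = (fun z => (a z * \1_E z)%:E).
      apply/funext => z; rewrite patchE indicE; case: (z \in E) => /=.
        by rewrite mulr1.
      by rewrite mulr0.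
    rewrite Rintegral_EFin ?a0//; apply: (@rint_bounded_mul _ _ _ _ _ _ 1) => //.
    by move=> z; rewrite indicE; case: (_ \in _); rewrite ?normr1 ?normr0.
  by apply: filterS => z /(_ I)/= [].
have h1 : {ae m, forall z, re (f z) = 0}.
  apply: K => // B mB; have := congr1 re (H B mB).
  rewrite /= => e; rewrite -[RHS]e; apply: eq_Rintegral => z _.
  by rewrite -[(f * _) z]/(f z * _) reM/= mulr0 subr0.
have h2 : {ae m, forall z, im (f z) = 0}.
  apply: K => // B mB; have := congr1 im (H B mB).
  rewrite /= => e; rewrite -[RHS]e; apply: eq_Rintegral => z _.
  by rewrite -[(f * _) z]/(f z * _) imM/= mulr0 add0r.
by apply/ae_pointwise; apply: filterS2 h1 h2 => z h1 h2; exact: complex_ext.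
Qed.

End FourierUniqueness.

(** * The power map on the circle *)

Section Circle.
Variable R : realType.
Local Notation T := (circle R).
Local Notation C := R[i].
Local Notation m := (@circle_measure R).
Local Notation re := (@complex.Re R).
Local Notation im := (@complex.Im R).
Implicit Types (f g h p q : T -> C) (c : C) (r s : T -> R).

Lemma circle_expn_cexp (k : nat) (t : R) :
  circle_expn (cexp t) k = cexp (k%:R * t).
Proof.
apply: val_inj => /=; elim: k => [|k IH].
  by rewrite expr0 mul0r mulr0 cos0 sin0.
rewrite exprS IH (_ : 2 * pi * (k.+1%:R * t) = 2 * pi * t + 2 * pi * (k%:R * t)).
  2: by rewrite -natr1; ring.
by apply: complex_ext; rewrite /= ?cosD ?sinD; ring.
Qed.

Lemma measurable_circle_expn (k : nat) :
  measurable_fun [set: T] (fun z : T => circle_expn z k).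
Proof.
move=> _ B mB; rewrite setTI.
have mk : measurable_fun [set: R] (fun t : R => k%:R * t).
  by apply: measurable_funM => //; exact: measurable_cst.
have := mk measurableT _ (mB : measurable (cexp (R:=R) @^-1` B)); rewrite setTI.
by congr (measurable _); apply/seteqP; split => t /=; rewrite circle_expn_cexp.
Qed.

Lemma slant_adj_zpow (k : nat) (n : int) :
  slant_adj k (zpow n) = zpow (k%:Z * n) :> (T -> C).
Proof. by apply/funext => z; rewrite /slant_adj /zpow -exprz_exp. Qed.

Lemma is_derive_mulr (w x : R) : is_derive x 1 (fun t : R => w * t) w.
Proof.
have := @is_deriveZ R _ _ (@id R) w x 1 1 (is_derive_id x 1).
by rewrite /GRing.scale/= mulr1.
Qed.

Lemma is_derive_sinM (w x : R) : w != 0 ->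
  is_derive x 1 (fun t => w^-1 * sin (w * t)) (cos (w * x)).
Proof.
move=> w0.
have h2 : is_derive x 1 (fun t : R => sin (w * t)) (cos (w * x) * w).
  exact: (is_derive1_comp (is_derive_sin (w * x)) (is_derive_mulr w x)).
have := @is_deriveZ R _ _ _ w^-1 x 1 _ h2.
by rewrite /GRing.scale/= mulrCA mulVf// mulr1.
Qed.

Lemma is_derive_cosM (w x : R) : w != 0 ->
  is_derive x 1 (fun t => - w^-1 * cos (w * t)) (sin (w * x)).
Proof.
move=> w0.
have h2 : is_derive x 1 (fun t : R => cos (w * t)) (- sin (w * x) * w).
  exact: (is_derive1_comp (is_derive_cos (w * x)) (is_derive_mulr w x)).
have := @is_deriveZ R _ _ _ (- w^-1) x 1 _ h2.
rewrite (_ : - w^-1 *: (- sin (w * x) * w) = sin (w * x))//.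
by rewrite /GRing.scale/=; field.
Qed.

Lemma Rintegral_derive_eq0 (F G : R -> R) : continuous G ->
  (forall x : R, is_derive x 1 F (G x)) -> F 0 = F 1 ->
  \int[lebesgue_measure]_(t in `[0, 1]) G t = 0.
Proof.
move=> cG dF F01; rewrite /Rintegral (@continuous_FTC2 R G F)//.
- by rewrite F01 subee.
- exact: continuous_subspaceT.
- have cF : continuous F.
    by move=> x; apply/differentiable_continuous/derivable1_diffP; case: (dF x).
  split.
  + by move=> x _; case: (dF x).
  + exact/cvg_at_right_filter/cF.
  + exact/cvg_at_left_filter/cF.
- by move=> t _; rewrite derive1E; apply: derive_val; exact: dF.
Qed.

Lemma integral_circle (a : T -> R) (B : R) : measurable_fun [set: T] a ->
  (forall z, `|a z| <= B) ->
  (\int[m]_z (a z)%:E = \int[lebesgue_measure]_(t in @arc01 R) (a (cexp t))%:E)%E.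
Proof.
move=> ma aB.
have bnd : [bounded (a \o @cexp R) t | t in [set: R]].
  exists B; split; first exact: num_real.
  by move=> y By t _; exact: le_trans (aB _) (ltW By).
have mac : measurable_fun [set: R] (a \o @cexp R) by exact: measurableT_comp.
have fin : (mrestr lebesgue_measure (@measurable_arc01 R) setT < +oo)%E.
  by rewrite /mrestr setTI lebesgue_measure_itv/= lte_fin ltr01 oppr0 adde0 ltry.
rewrite [LHS]integral_pushforward//.
- rewrite preimage_setT; etransitivity.
    apply: (@negligible_integral _ (g_sigma_algebraType R.-ocitv.-measurable)
      _ _ setT (~` @arc01 R)) => //.
    + by apply: measurableC; exact: measurable_arc01.
    + exact: measurable_bounded_integrable.
    + by rewrite /= /mrestr setICl measure0.
  rewrite setTD setCK; apply: eq_measure_integral => A mA sA.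
  by rewrite /= /mrestr setIidl.
- exact: measurable_cexp.
- exact/measurable_EFinP.
- by rewrite preimage_setT; exact: measurable_bounded_integrable.
Qed.

Lemma Rintegral_circle (a : T -> R) (B : R) : measurable_fun [set: T] a ->
  (forall z, `|a z| <= B) ->
  \int[m]_z a z = \int[lebesgue_measure]_(t in `[0, 1]) a (cexp t).
Proof.
move=> ma aB; congr fine; rewrite (integral_circle ma aB).
rewrite /arc01 integral_itv_bndo_bndc//; apply/measurable_EFinP.
apply: measurable_funS (measurableT_comp ma (@measurable_cexp R)) => //.
Qed.

Lemma zpow_cexp (n : nat) (t : R) :
  zpow n%:Z (cexp t) = cos (2 * pi * n%:R * t) +i* sin (2 * pi * n%:R * t).
Proof.
by have := circle_expn_cexp n t => /(congr1 val)/=; rewrite /zpow -exprnP/= mulrA.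
Qed.

Lemma cintegral_zpow_gt0 (n : nat) : (0 < n)%N ->
  cintegral (zpow n%:Z : T -> C) = 0.
Proof.
move=> n0; pose w : R := 2 * pi * n%:R.
have w0 : w != 0 by rewrite !mulf_neq0// ?gt_eqF ?pi_gt0// ltr0n.
have wE : w = 0 + (pi *+ 2) *+ n by rewrite /w add0r mulr_natr (mulr_natl pi 2).
have sw : sin w = 0 by rewrite wE (periodicn (@sinD2pi R)) sin0.
have cw : cos w = 1 by rewrite wE (periodicn (@cosD2pi R)) cos0.
have [mz1 mz2] := cmeasurable_zpow R n%:Z.
have b1 z : `|re (zpow n%:Z z)| <= 1.
  by apply: le_trans (re_le_normc _) _; rewrite normc_zpow.
have b2 z : `|im (zpow n%:Z z)| <= 1.
  by apply: le_trans (im_le_normc _) _; rewrite normc_zpow.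
apply: complex_ext => /=.
  rewrite (Rintegral_circle mz1 b1).
  under eq_Rintegral do rewrite zpow_cexp/=.
  apply: (@Rintegral_derive_eq0 (fun t => w^-1 * sin (w * t))).
  - move=> t; apply: continuous_comp; last exact: continuous_cos.
    by apply: cvgM; [exact: cvg_cst|exact: cvg_id].
  - by move=> x; exact: is_derive_sinM.
  - by rewrite mulr0 mulr1 sin0 sw.
rewrite (Rintegral_circle mz2 b2).
under eq_Rintegral do rewrite zpow_cexp/=.
apply: (@Rintegral_derive_eq0 (fun t => - w^-1 * cos (w * t))).
- move=> t; apply: continuous_comp; last exact: continuous_sin.
  by apply: cvgM; [exact: cvg_cst|exact: cvg_id].
- by move=> x; exact: is_derive_cosM.
- by rewrite mulr0 mulr1 cos0 cw.
Qed.

Lemma cintegral_zpow (n : int) : cintegral (zpow n : T -> C) = (n == 0)%:R.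
Proof.
case: n => [[|n]|n].
- rewrite zpow0 eqxx; apply: complex_ext => /=.
    by rewrite Rintegral_cst// mul1r (_ : _ [set: T] = 1%E) //; exact: circle_measure_setT.
  by rewrite Rintegral_cst// mul0r.
- by rewrite cintegral_zpow_gt0.
- rewrite NegzE -conj_zpow cintegral_conj; last exact/cint_bmeas/bmeas_zpow.
  by rewrite cintegral_zpow_gt0// conjc0.
Qed.


Lemma cmeasurable_slant (k : nat) f : cmeasurable f ->
  cmeasurable (slant_adj k f).
Proof.
move=> [rf jf]; split.
  exact: (measurableT_comp rf (measurable_circle_expn k)).
exact: (measurableT_comp jf (measurable_circle_expn k)).
Qed.

Lemma bmeas_slant (k : nat) f : bmeas f -> bmeas (slant_adj k f).
Proof.
move=> [mf [B fB]]; split; first exact: cmeasurable_slant.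
by exists B => z; exact: fB.
Qed.

Lemma slantM (k : nat) f g :
  slant_adj k (f * g) = slant_adj k f * slant_adj k g.
Proof. by []. Qed.

Lemma slant_lin (k : nat) c f g :
  slant_adj k (c *: f + g) = c *: slant_adj k f + slant_adj k g.
Proof. by []. Qed.

Lemma slant_conj (k : nat) f : slant_adj k (conjf f) = conjf (slant_adj k f).
Proof. by []. Qed.

(** This functional is the difference between the image of [m] under z |-> z^k and [m] itself.
    Fourier uniqueness for it shows that the power map preserves the measure. *)
Lemma bfunc_slant (k : nat) :
  bfunc (fun p : T -> C => cintegral (slant_adj k p) - cintegral p).
Proof.
split=> [c p q bp bq|r s q bq rs H].
  rewrite slant_lin !cintegralD ?cintegralZ//; first ring;
    by do ?apply: cintZ; do ?apply: cint_bmeas; do ?apply: bmeas_slant.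
have brs : bounded_cvg (fun n => r n \o (fun z : T => circle_expn z k))
    (s \o (fun z : T => circle_expn z k)).
  case: rs => mr r01 rs; split=> [n|n z|z]; [|exact: r01|exact: (rs (circle_expn z k))].
  by apply: measurableT_comp => //; exact: measurable_circle_expn.
have [h1 h2] := cintegral_bounded_cvg (cint_bmeas (bmeas_slant k bq)) brs.
have [h3 h4] := cintegral_bounded_cvg (cint_bmeas bq) rs.
have E n : cintegral (rfun (r n \o (fun z : T => circle_expn z k)) * slant_adj k q)
    = cintegral (rfun (r n) * q).
  by apply/eqP; rewrite -subr_eq0; apply/eqP; exact: H.
apply/eqP; rewrite subr_eq0; apply/eqP.
move: h1 h2; under eq_fun do rewrite E.
under [X in _ -> X @ _ --> _ -> _]eq_fun do rewrite E.
move=> h1 h2; apply: complex_ext.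
  exact: (cvg_unique (@Rhausdorff R) h1 h3).
exact: (cvg_unique (@Rhausdorff R) h2 h4).
Qed.

(** The integrals of z^(kn) and z^n agree for every integer n, because k n = 0 only for n = 0; two
    finite measures with equal integrals of monomials agree on Borel sets. *)
Lemma circle_measure_expn (k : nat) (B : set T) : (0 < k)%N -> measurable B ->
  m ((fun z : T => circle_expn z k) @^-1` B) = m B.
Proof.
move=> k0 mB.
have mV : measurable ((fun z : T => circle_expn z k) @^-1` B).
  by rewrite -[_ @^-1` _]setTI; exact: measurable_circle_expn.
have := @bfunc_indic_eq0 R _ B (bfunc_slant k) _ mB.
have H n : cintegral (slant_adj k (zpow n)) - cintegral (zpow n) = 0 :> C.
  rewrite slant_adj_zpow !cintegral_zpow mulf_eq0.
  by rewrite (gtn_eqF k0 : (k%:Z == 0) = false) subrr.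
move=> /(_ H)/eqP; rewrite subr_eq0 => /eqP/(congr1 re)/=.
have F A : measurable A -> \int[m]_z (\1_A z) = fine (m A).
  by move=> mA; rewrite /Rintegral integral_indic// setIT.
rewrite -[in RHS]/(\int[m]_z (\1_B z)) F//.
rewrite -[in LHS]/(\int[m]_z (\1_((fun z : T => circle_expn z k) @^-1` B) z)) F//.
move=> e; rewrite -[LHS]fineK ?fin_num_measure// -[RHS]fineK ?fin_num_measure//.
by rewrite e.
Qed.

Lemma ge0_integral_slant (k : nat) (a : T -> \bar R) : (0 < k)%N ->
  measurable_fun [set: T] a -> (forall z, 0 <= a z)%E ->
  (\int[m]_z a (circle_expn z k) = \int[m]_z a z)%E.
Proof.
move=> k0 ma a0; have mV := measurable_circle_expn k.
transitivity (\int[pushforward m (fun z : T => circle_expn z k)]_z a z)%E.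
  symmetry; apply: (ge0_integral_pushforward mV m measurableT ma).
  by move=> y _; exact: a0.
by apply: eq_measure_integral => A mA _; exact: circle_measure_expn.
Qed.

Lemma L2_slant (k : nat) f : (0 < k)%N -> L2 f -> L2 (slant_adj k f).
Proof.
move=> k0 [mf /integrableP[mn fn]]; split; first exact: cmeasurable_slant.
have mV := measurable_circle_expn k.
apply/integrableP; split; first exact: (measurableT_comp mn mV).
rewrite (ge0_integral_slant k0 (a := fun z => `|(normc (f z) ^+ 2)%:E|%E))//.
by apply: measurableT_comp.
Qed.

Lemma nrm2_slant (k : nat) f : (0 < k)%N -> L2 f ->
  nrm2 (slant_adj k f) = nrm2 f.
Proof.
move=> k0 [mf /integrableP[mn fn]]; congr fine.
by apply: (ge0_integral_slant k0 (a := fun z => (normc (f z) ^+ 2)%:E)) => // z;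
  rewrite lee_fin sqr_ge0.
Qed.

Lemma slant_ae (k : nat) (P : T -> Prop) : (0 < k)%N ->
  {ae m, forall z, P z} -> {ae m, forall z, P (circle_expn z k)}.
Proof.
move=> k0 [N [mN N0 sN]].
exists ((fun z : T => circle_expn z k) @^-1` N); split.
- by rewrite -[_ @^-1` _]setTI; exact: measurable_circle_expn.
- by rewrite circle_measure_expn.
- by move=> z /= Pz; exact: sN.
Qed.

End Circle.

(** * Hardy and model spaces *)

Section Hardy.
Variable R : realType.
Local Notation T := (circle R).
Local Notation C := R[i].
Local Notation m := (@circle_measure R).
Local Notation re := (@complex.Re R).
Local Notation im := (@complex.Im R).
Local Notation ip := (@inner_prod R).
Implicit Types (f g h p q a b y : T -> C) (c : C) (n j : int).

Lemma ipMl a f g : ip (a * f) g = ip f (conjf a * g).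
Proof. by rewrite /inner_prod conjfM conjfK mulrCA mulrA. Qed.

Lemma fourierE f n : fourier f n = cintegral (f * zpow (- n)).
Proof. by rewrite /fourier /inner_prod conj_zpow. Qed.

Lemma fourier_zpowM j f n : fourier (zpow j * f) n = fourier f (n - j).
Proof. by rewrite !fourierE opprB zpowD mulrA [f * _]mulrC mulrAC mulrC mulrA. Qed.

Lemma fourier_zpow j n : fourier (zpow j : T -> C) n = (j == n)%:R.
Proof. by rewrite fourierE -zpowD cintegral_zpow subr_eq0. Qed.

Lemma ip_zpow j n : ip (zpow j) (zpow n) = (j == n)%:R.
Proof. exact: fourier_zpow. Qed.

Lemma fourierB f g n : L2 f -> L2 g ->
  fourier (f - g) n = fourier f n - fourier g n.
Proof. by move=> Lf Lg; rewrite /fourier ipBl//; exact: L2_zpow. Qed.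

Lemma fourierD f g n : L2 f -> L2 g ->
  fourier (f + g) n = fourier f n + fourier g n.
Proof. by move=> Lf Lg; rewrite /fourier ipDl//; exact: L2_zpow. Qed.

Lemma fourier_conj f n : L2 f -> fourier (conjf f) n = (fourier f (- n))^*.
Proof.
move=> Lf; rewrite !fourierE opprK -cintegral_conj; last first.
  by apply: cint_L2M => //; exact: L2_zpow.
by rewrite conjfM conj_zpow.
Qed.

Lemma L2_unique f : L2 f -> (forall n, fourier f n = 0) -> f = 0 %[ae m].
Proof.
move=> Lf f0; apply: cintegral_unique; first exact: L2_cint.
by move=> n; rewrite -[n]opprK -fourierE.
Qed.

Lemma L2_eq_ae f g : L2 f -> L2 g -> (forall n, fourier f n = fourier g n) ->
  f = g %[ae m].
Proof.
move=> Lf Lg fg; have /ae_pointwise : f - g = 0 %[ae m].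
  by apply: L2_unique; [exact: L2B|move=> n; rewrite fourierB// fg subrr].
move=> h; apply/ae_pointwise; apply: filterS h => z /eqP.
by rewrite -[(f - g) z]/(f z - g z) subr_eq0 => /eqP.
Qed.

Lemma nrm2_ae0 f : cmeasurable f -> f = 0 %[ae m] -> nrm2 f = 0.
Proof.
move=> mf f0; have Lf : L2 f.
  apply: (L2_ae (L2_0 R)) => //.
  by move/ae_pointwise : f0 => f0; apply/ae_pointwise; apply: filterS f0 => z ->.
by apply: complexI; rewrite -ip_nrm2// (ip_ael Lf (L2_0 R) Lf f0) ip0l.
Qed.

Lemma l2closed_ae M f g : l2closed M -> M f -> L2 g -> f = g %[ae m] -> M g.
Proof.
move=> [ML M0 Mlin Mcl] Mf Lg /ae_pointwise fg; apply: Mcl => // e e0.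
exists f => //; rewrite nrm2_ae0 ?ltW//.
  by apply: L2_cmeasurable; apply: L2B => //; exact: ML.
apply/ae_pointwise; apply: filterS fg => z e1.
by rewrite -[LHS]/(g z - f z) e1 subrr.
Qed.

(** Density of the trigonometric polynomials: [f] minus its projection onto [M] is orthogonal to
    every monomial, hence null. *)
Lemma l2closed_total M f : l2closed M -> (forall n, M (zpow n)) -> L2 f -> M f.
Proof.
move=> cM Mz Lf; have [p Mp fp] := projection cM Lf.
have ML : M `<=` L2 (R:=R) by case: cM.
have Lp := ML _ Mp; apply: (l2closed_ae cM Mp) => //.
apply: L2_eq_ae => // n; apply/esym/eqP; rewrite -subr_eq0 -fourierB//.
by apply/eqP; exact: fp.
Qed.

Lemma l2closed_L2 : l2closed (L2 (R:=R)).
Proof. by split => //; [exact: L2_0|move=> *; exact: L2_lin]. Qed.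

(** With density of a family in [M], this extends an identity between bounded functionals from that
    family to all of [M]. *)
Lemma l2closed_ker M (L : (T -> C) -> C) (B : R) : l2closed M ->
  (forall c f g, M f -> M g -> L (c *: f + g) = c * L f + L g) ->
  (forall f, M f -> normc (L f) ^+ 2 <= B * nrm2 f) ->
  l2closed [set f | M f /\ L f = 0].
Proof.
move=> [ML M0 Mlin Mcl] lin bnd; split.
- by move=> f [/ML].
- split; first exact: M0.
  have := lin (-1) _ _ M0 M0.
  by rewrite scaler0 addr0 mulN1r addNr.
- move=> c f g [Mf f0] [Mg g0]; split; first exact: Mlin.
  by rewrite lin// f0 g0 mulr0 addr0.
- move=> f Lf H.
  have Mf : M f by apply: Mcl => // e e0; have [u [Mu _] fu] := H e e0; exists u.
  split => //.
  apply: eq0_normc; apply/eqP; rewrite -sqrf_eq0; apply/eqP.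
  apply: (@eq0_of_le_geometric _ _ `|B|); first exact: sqr_ge0.
  move=> n; have [|u [Mu u0] fu] := H (8 ^- n); first by rewrite invr_gt0 exprn_gt0.
  have -> : L f = L (-1 *: u + f) by rewrite lin// u0 mulr0 add0r.
  have Md : M (-1 *: u + f) by exact: Mlin.
  apply: le_trans (bnd _ Md) _; rewrite scaleN1r addrC.
  apply: (@le_trans _ _ (`|B| * nrm2 (f - u))).
    by apply: ler_wpM2r; [exact: nrm2_ge0|exact: ler_norm].
  by apply: ler_wpM2l.
Qed.

Lemma oprojP M f : l2closed M -> L2 f ->
  M (oproj M f) /\ forall h, M h -> ip (f - oproj M f) h = 0.
Proof.
move=> cM Lf; have [p Mp fp] := projection cM Lf.
by rewrite /oproj; apply: (@xgetPex _ 0 [set g | M g /\ forall h, M h -> ip (f - g) h = 0]); exists p.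
Qed.

Let neg_zpow : set (T -> C) := [set zpow n | n in [set n : int | n < 0]].

Lemma H2_orth : H2 (R:=R) = orth neg_zpow.
Proof.
apply/seteqP; split => f [Lf H]; split => //.
  by move=> _ [n n0 <-]; exact: H.
by move=> n n0; apply: H; exists n.
Qed.

Lemma neg_zpow_L2 : neg_zpow `<=` L2 (R:=R).
Proof. by move=> _ [n _ <-]; exact: L2_zpow. Qed.

Lemma l2closed_H2 : l2closed (H2 (R:=R)).
Proof. by rewrite H2_orth; exact: l2closed_orth neg_zpow_L2. Qed.

Lemma H2_L2 f : H2 f -> L2 f.
Proof. by case. Qed.

Lemma H2_zpow n : 0 <= n -> H2 (zpow n : T -> C).
Proof.
move=> n0; split; first exact: L2_zpow.
by move=> j j0; rewrite fourier_zpow gt_eqF// (lt_le_trans j0).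
Qed.

Lemma H2_lin c f g : H2 f -> H2 g -> H2 (c *: f + g).
Proof. by case: l2closed_H2 => _ _ h _; exact: h. Qed.

Lemma H2B f g : H2 f -> H2 g -> H2 (f - g).
Proof. by move=> Hf Hg; rewrite addrC -scaleN1r; exact: H2_lin. Qed.

Lemma H2D f g : H2 f -> H2 g -> H2 (f + g).
Proof. by move=> Hf Hg; rewrite -[f]scale1r; exact: H2_lin. Qed.

Lemma H2Z c f : H2 f -> H2 (c *: f).
Proof.
move=> Hf; rewrite -[c *: f]addr0; apply: H2_lin => //.
by case: l2closed_H2.
Qed.

Lemma H2_ae f g : H2 f -> L2 g -> f = g %[ae m] -> H2 g.
Proof. by move=> Hf Lg; exact: (l2closed_ae l2closed_H2). Qed.

(* The elements of H^2 orthogonal to [a] form a closed subspace containing the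
   monomials. *)
Lemma ip_antianalytic a b : L2 a -> (forall n, 0 <= n -> fourier a n = 0) ->
  H2 b -> ip a b = 0.
Proof.
move=> La a0 Hb; have Lb := H2_L2 Hb.
pose S : set (T -> C) := neg_zpow `|` [set a].
have SL : S `<=` L2 (R:=R) by move=> f [/neg_zpow_L2//|->].
have cM := l2closed_orth SL.
have MH p : orth S p -> H2 p.
  by move=> [Lp pS]; rewrite H2_orth; split => // g Sg; apply: pS; left.
have [p Mp bp] := projection cM Lb; have Hp := MH _ Mp.
have Lp := H2_L2 Hp.
have bpE : b = p %[ae m].
  apply: L2_eq_ae => // n; apply/eqP; rewrite -subr_eq0 -fourierB//; apply/eqP.
  have [n0|n0] := ltP n 0; first by case: (H2B Hb Hp) => _; apply.
  apply: bp; split; first exact: L2_zpow.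
  move=> g [gS|->].
    by have := H2_zpow n0; rewrite H2_orth => -[_]; apply.
  by rewrite ipC//; [rewrite -/(fourier _ _) a0// conjc0|exact: L2_zpow].
have h : ip p a = 0 by case: Mp => _; apply; right.
by rewrite (ip_aer Lb Lp La bpE) ipC// h conjc0.
Qed.

Lemma Linf_conj f : Linf f -> Linf (conjf f).
Proof.
move=> [mf [B fB]]; split; first exact: cmeasurable_conj.
by exists B; apply: filterS fB => z; rewrite normc_conj.
Qed.

Lemma LinfM f g : Linf f -> Linf g -> Linf (f * g).
Proof.
move=> [mf [A fA]] [mg [B gB]]; split; first exact: cmeasurableM.
exists (A * B); apply: filterS2 fA gB => z fA gB.
by rewrite normcM; apply: ler_pM => //; exact: normc_nonneg.
Qed.

Lemma Linf_L2 f : Linf f -> L2 f.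
Proof.
move=> Lf; rewrite -[f]mul1r; apply: L2_LinfM => //.
by apply: L2_bmeas; exact: bmeas_cst.
Qed.

Lemma bmeas_Linf f : bmeas f -> Linf f.
Proof. by move=> [mf [B fB]]; split => //; exists B; exact: aeW. Qed.

Lemma L2_LinfMl p f : Linf p -> L2 f -> L2 (p * f).
Proof. by move=> *; rewrite mulrC; exact: L2_LinfM. Qed.

Lemma L2_zpowM n f : L2 f -> L2 (zpow n * f).
Proof. by move=> Lf; rewrite mulrC; apply: L2_bmeasM => //; exact: bmeas_zpow. Qed.

Lemma H2_zpowM n f : 0 <= n -> H2 f -> H2 (zpow n * f).
Proof.
move=> n0 [Lf Hf]; split; first exact: L2_zpowM.
by move=> j j0; rewrite fourier_zpowM Hf// subr_lt0 (lt_le_trans j0).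
Qed.

(** Since <a f, z^n> = <a, conj(f) z^n>, and for n < 0 the function conj(f) z^n has negative
    frequencies only, the coefficient vanishes without any convolution of series. *)
Lemma H2_HinfM a f : Hinf a -> H2 f -> H2 (a * f).
Proof.
move=> [Ha La] Hf; have Lf := H2_L2 Hf; split; first exact: L2_LinfMl.
move=> n n0; rewrite /fourier mulrC ipMl ipC; last 2 first.
- by rewrite mulrC; apply: L2_zpowM; exact: L2_conj.
- exact: H2_L2.
rewrite mulrC ip_antianalytic ?conjc0//.
  by apply: L2_zpowM; exact: L2_conj.
move=> j j0; rewrite fourier_zpowM fourier_conj// opprB.
have [_ ->] := Hf; first by rewrite conjc0.
by rewrite subr_lt0 (lt_le_trans n0).
Qed.

Lemma HinfM f g : Hinf f -> Hinf g -> Hinf (f * g).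
Proof.
move=> hf hg; split; first by apply: H2_HinfM => //; case: hg.
by apply: LinfM; [case: hf|case: hg].
Qed.

Lemma inner_Linf a : inner_fun a -> Linf a.
Proof. by case=> -[]. Qed.

Lemma inner_Hinf a : inner_fun a -> Hinf a.
Proof. by case. Qed.

Lemma inner_unit a : inner_fun a -> {ae m, forall z, a z * (a z)^* = 1}.
Proof.
by move=> [_]; apply: filterS => z az; rewrite mulcJ az expr1n.
Qed.

Lemma innerM a b : inner_fun a -> inner_fun b -> inner_fun (a * b).
Proof.
move=> [ha a1] [hb b1]; split; first exact: HinfM.
by apply: filterS2 a1 b1 => z az bz; rewrite normcM az bz mulr1.
Qed.

Lemma L2_innerM a f : inner_fun a -> L2 f -> L2 (a * f).
Proof. by move=> ia; apply: L2_LinfMl; exact: inner_Linf. Qed.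

Lemma L2_innerJM a f : inner_fun a -> L2 f -> L2 (conjf a * f).
Proof. by move=> ia; apply: L2_LinfMl; apply: Linf_conj; exact: inner_Linf. Qed.

Lemma H2_innerM a f : inner_fun a -> H2 f -> H2 (a * f).
Proof. by move=> ia; apply: H2_HinfM; exact: inner_Hinf. Qed.

Lemma inner_mulKJ a f : inner_fun a -> conjf a * (a * f) = f %[ae m].
Proof.
move=> ia; apply/ae_pointwise; apply: filterS (inner_unit ia) => z az.
rewrite -[LHS]/((a z)^* * (a z * f z)) mulrA [X in X * _]mulrC az.
by rewrite mul1r.
Qed.

Lemma ip_innerM a f g : inner_fun a -> L2 f -> L2 g ->
  ip (a * f) (a * g) = ip f g.
Proof.
move=> ia Lf Lg; rewrite ipMl; apply: ip_aer => //.
  by apply: L2_innerJM => //; exact: L2_innerM.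
exact: inner_mulKJ.
Qed.

Lemma model_orth a : model a = orth (neg_zpow `|` [set a * h | h in H2 (R:=R)]).
Proof.
apply/seteqP; split => f.
  move=> [Hf fa]; split; first exact: H2_L2.
  move=> g [gS|[h Hh <-]]; last exact: fa.
  by move: Hf; rewrite H2_orth => -[_]; apply.
move=> [Lf H]; split; first by rewrite H2_orth; split => // g gS; apply: H; left.
by move=> h Hh; apply: H; right; exists h.
Qed.

Lemma l2closed_model a : inner_fun a -> l2closed (model a).
Proof.
move=> ia; rewrite model_orth; apply: l2closed_orth => f [/neg_zpow_L2//|].
by move=> [h Hh <-]; apply: L2_innerM => //; exact: H2_L2.
Qed.

Lemma model_H2 a f : model a f -> H2 f.
Proof. by case. Qed.

Lemma model_L2 a f : model a f -> L2 f.
Proof. by move=> /model_H2/H2_L2. Qed.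

Lemma H2_proj g : L2 g -> exists2 h, H2 h &
  forall n, 0 <= n -> fourier h n = fourier g n.
Proof.
move=> Lg; have [h Hh gh] := projection l2closed_H2 Lg; exists h => // n n0.
apply/esym/eqP; rewrite -subr_eq0 -fourierB//; last exact: H2_L2.
by apply/eqP; apply: gh; exact: H2_zpow.
Qed.

(** Together with its converse below, this describes K_a as the set of f in H^2 for which conj(a) f
    has negative frequencies only, the form used in all later computations. *)
Lemma model_antianalytic a f n : inner_fun a -> model a f -> 0 <= n ->
  fourier (conjf a * f) n = 0.
Proof.
move=> ia [Hf fa] n0; rewrite /fourier ipMl conjfK; apply: fa.
exact: H2_zpow.
Qed.

Lemma model_of_antianalytic a f : inner_fun a -> H2 f ->
  (forall n, 0 <= n -> fourier (conjf a * f) n = 0) -> model a f.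
Proof.
move=> ia Hf H; split => // h Hh; rewrite -[a]conjfK -ipMl.
by apply: ip_antianalytic => //; apply: L2_innerJM => //; exact: H2_L2.
Qed.

Definition trigpoly (n : nat) (c : nat -> C) : T -> C :=
  \sum_(i < n) c i *: zpow i%:Z.

Lemma bmeas_trigpoly (n : nat) (c : nat -> C) : bmeas (trigpoly n c).
Proof.
rewrite /trigpoly; elim/big_ind : _; first exact: (@bmeas_cst _ 0).
  by move=> *; exact: bmeasD.
by move=> i _; apply: bmeasZ; exact: bmeas_zpow.
Qed.

Lemma H2_trigpoly (n : nat) (c : nat -> C) : H2 (trigpoly n c).
Proof.
rewrite /trigpoly; elim/big_ind : _; first by case: l2closed_H2.
  by move=> *; exact: H2D.
by move=> i _; apply: H2Z; exact: H2_zpow.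
Qed.

Lemma fourier_trigpoly (n : nat) (c : nat -> C) (j : nat) :
  fourier (trigpoly n c) j%:Z = if (j < n)%N then c j else 0.
Proof.
rewrite /fourier ip_suml; [|by move=> i; apply: L2Z; exact: L2_zpow|exact: L2_zpow].
rewrite (eq_bigr (fun i : 'I_n => c i * (i == j :> nat)%:R)); last first.
  by move=> i _; rewrite ipZl; [rewrite ip_zpow|exact: L2_zpow|exact: L2_zpow].
case: ltnP => jn.
  rewrite (bigD1 (Ordinal jn))//= eqxx mulr1 big1 ?addr0//.
  by move=> i; rewrite -val_eqE/= => /negbTE ->; rewrite mulr0.
by rewrite big1// => i _; rewrite ltn_eqF ?mulr0// (leq_trans (ltn_ord i)).
Qed.

Lemma H2_trigpoly_ae y (n : nat) : H2 y ->
  (forall j : nat, (n <= j)%N -> fourier y j%:Z = 0) ->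
  y = trigpoly n (fun i => fourier y i%:Z) %[ae m].
Proof.
move=> Hy y0; apply: L2_eq_ae; [exact: H2_L2|exact/L2_bmeas/bmeas_trigpoly|].
case=> j; last by case: Hy => _ ->//; case: (H2_trigpoly n (fun i => fourier y i%:Z)) => _ ->.
by rewrite fourier_trigpoly; case: ltnP => // /y0.
Qed.

Lemma Linf_ae f g : Linf f -> cmeasurable g -> f = g %[ae m] -> Linf g.
Proof.
move=> [mf [B fB]] mg /ae_pointwise fg; split => //; exists B.
by apply: filterS2 fB fg => z + <-.
Qed.

Lemma H2_finite_Hinf y (n : nat) : H2 y ->
  (forall j : nat, (n <= j)%N -> fourier y j%:Z = 0) -> Hinf y.
Proof.
move=> Hy y0; split => //; have := H2_trigpoly_ae Hy y0 => e.
apply: (Linf_ae (bmeas_Linf (bmeas_trigpoly n (fun i => fourier y i%:Z)))).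
  exact/L2_cmeasurable/H2_L2.
by move/ae_pointwise : e => e; apply/ae_pointwise; apply: filterS e.
Qed.

(* [p] is the projection of [z ^ n]; the quotient [y] is a polynomial. *)
Lemma model_inf_zpow a (n : nat) : inner_fun a ->
  exists p y, [/\ model_inf a p, H2 y & zpow n%:Z = p + a * y].
Proof.
move=> ia; pose y := trigpoly n.+1 (fun i => fourier (conjf a * zpow n%:Z) i%:Z).
have by_ : bmeas y by exact: bmeas_trigpoly.
have Hy : H2 y by exact: H2_trigpoly.
have Lu : L2 (conjf a * zpow n%:Z) by apply: L2_innerJM => //; exact: L2_zpow.
have La : L2 a by exact/Linf_L2/inner_Linf.
(* Truncation at degree n loses nothing of the analytic part: for j > n, the coefficient of conj(a)
   z^n at j is the conjugate of that of [a] at n - j < 0. *)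
have yE (j : nat) : fourier y j%:Z = fourier (conjf a * zpow n%:Z) j%:Z.
  rewrite fourier_trigpoly ltnS; case: leqP => // nj.
  rewrite mulrC fourier_zpowM fourier_conj//.
  have [_ ->] := (inner_Hinf ia).1; first by rewrite conjc0.
  by rewrite oppr_lt0 subr_gt0 ltz_nat.
exists (zpow n%:Z - a * y), y; split => //; last by rewrite subrK.
have Hay := H2_innerM ia Hy.
have Hp : H2 (zpow n%:Z - a * y) by apply: H2B => //; exact: H2_zpow.
split; last split => //.
  apply: model_of_antianalytic => // -[j|//] _.
  have Laay : L2 (conjf a * (a * y)) by apply: L2_innerJM => //; exact: H2_L2.
  rewrite mulrBr fourierB//.
  have -> : fourier (conjf a * (a * y)) j = fourier y j.
    by apply: ip_ael => //; [exact: H2_L2|exact: L2_zpow|exact: inner_mulKJ].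
  by rewrite yE subrr.
split; first by case: Hp => -[].
have [_ [B1 yB]] := by_.
exists (1 + B1); apply: filterS (ia.2) => z az.
apply: le_trans (le_normcD _ _) _.
rewrite normc_zpow lerD2l (@normcN _ ((a * y) z)) normcM az mul1r; exact: yB.
Qed.

(** The splitting H^2 = K_a + a H^2, with [h] the analytic part of conj(a) g. *)
Lemma model_decomp a g : inner_fun a -> H2 g ->
  exists2 h, H2 h & model a (g - a * h).
Proof.
move=> ia Hg; have Lg := H2_L2 Hg.
have Lag : L2 (conjf a * g) by exact: L2_innerJM.
have [y Hy yE] := H2_proj Lag; exists y => //.
have Ly := H2_L2 Hy; have Lay := L2_innerM ia Ly.
apply: model_of_antianalytic => //; first by apply: H2B => //; exact: H2_innerM.
move=> n n0; rewrite mulrBr fourierB//; last exact: L2_innerJM.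
have -> : fourier (conjf a * (a * y)) n = fourier y n.
  by apply: ip_ael => //; [exact: L2_innerJM|exact: L2_zpow|exact: inner_mulKJ].
by rewrite yE// subrr.
Qed.

(** This is the density of K_a^infty in K_a. The component g - a y of [g] in K_a is tested against
    z^n = p + a w: it is orthogonal to a w as an element of K_a, and to the bounded [p] because both
    [g] and a y are. *)
Lemma H2_orth_model_inf a g : inner_fun a -> H2 g ->
  (forall f, model_inf a f -> ip g f = 0) ->
  exists2 h, H2 h & g = a * h %[ae m].
Proof.
move=> ia Hg gf; have Lg := H2_L2 Hg.
have [y Hy mo] := model_decomp ia Hg; exists y => //.
have Lay := L2_innerM ia (H2_L2 Hy).
apply: L2_eq_ae => // n; apply/eqP; rewrite -subr_eq0 -fourierB//; apply/eqP.
case: n => [n|n]; last by case: mo => -[_ h _]; exact: h.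
have [p [w [mp Hw e]]] := model_inf_zpow n ia.
have Lp := model_L2 mp.1; have Law : L2 (a * w) by exact/H2_L2/H2_innerM.
rewrite /fourier e ipDr//; last exact: L2B.
rewrite [X in _ + X](mo.2 _ Hw) addr0 ipBl// gf// sub0r.
by rewrite ipC// (mp.1.2 _ Hy) conjc0 oppr0.
Qed.

Lemma L2norm_sqr f : L2norm f ^+ 2 = nrm2 f.
Proof. by rewrite sqr_sqrtr//; exact: nrm2_ge0. Qed.

Lemma bounded_nrm2 M N (A : (T -> C) -> (T -> C)) : bounded_linear_op M N A ->
  exists B : R, forall f, M f -> nrm2 (A f) <= B * nrm2 f.
Proof.
move=> [_ _ [B AB]]; exists (B ^+ 2) => f Mf; rewrite -!L2norm_sqr -exprMn.
by apply: lerXn2r; rewrite ?nnegrE ?sqrtr_ge0// ?(le_trans _ (AB _ Mf)) ?sqrtr_ge0 ?AB.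
Qed.

(** [W] is given on monomials only. Both sides are continuous in each argument, so the identity
    extends first in [u], for [g] a monomial, and then in [g]; continuity in [g] on the right uses
    that g |-> g(z^k) is isometric. *)
Lemma slant_op_adj (k : nat) W u g : (0 < k)%N -> slant_op k W -> L2 u -> L2 g ->
  ip (W u) g = ip u (slant_adj k g).
Proof.
move=> k0 [bW WE] Lu Lg.
have [WL Wlin _] := bW; have [B WB] := bounded_nrm2 bW.
have H1 n f : L2 f -> ip (W f) (zpow n) - ip f (zpow (k%:Z * n)) = 0.
  move=> Lf.
  have cM : l2closed [set f | L2 f /\ ip (W f) (zpow n) - ip f (zpow (k%:Z * n)) = 0].
    apply: (@l2closed_ker _ _ (2 * B + 2) l2closed_L2) => [c f' g' Lf' Lg'|f' Lf'].
      rewrite (ip_ael _ _ _ (Wlin c _ _ Lf' Lg')); last 3 first.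
      - by apply: WL; exact: L2_lin.
      - by apply: L2_lin; exact: WL.
      - exact: L2_zpow.
      by rewrite !ip_lin//; [ring|exact: L2_zpow|exact: WL|exact: WL|exact: L2_zpow].
    have n1 j : nrm2 (zpow j : T -> C) = 1.
      by apply: complexI; rewrite -ip_nrm2 -?/(fourier _ _) ?fourier_zpow ?eqxx//; exact: L2_zpow.
    have h1 := cauchy_schwarz (WL _ Lf') (L2_zpow R n).
    have h2 := cauchy_schwarz Lf' (L2_zpow R (k%:Z * n)).
    move: h1 h2; rewrite !n1 !mulr1 => h1 h2.
    have h3 := le_normcD (ip (W f') (zpow n)) (- ip f' (zpow (k%:Z * n))).
    rewrite normcN in h3; have h4 := WB _ Lf'.
    have h5 := normc_nonneg (ip (W f') (zpow n) - ip f' (zpow (k%:Z * n))).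
    move: h1 h2 h3 h5; set x := normc _; set y := normc _; set w := normc _ => h1 h2 h3 h5.
    have := sqr_ge0 (x - y); nra.
  suff [] : [set f | L2 f /\ ip (W f) (zpow n) - ip f (zpow (k%:Z * n)) = 0] f by [].
  apply: l2closed_total => // j; split; first exact: L2_zpow.
  rewrite -/(fourier (zpow j) (k%:Z * n)) fourier_zpow.
  have Wj := WE j; have LWj := WL _ (L2_zpow R j).
  case: ifPn Wj => [kj|kj] Wj.
    rewrite (ip_ael LWj (L2_zpow _ _) (L2_zpow _ _) Wj) -/(fourier _ _) fourier_zpow.
    have k0' : k%:Z != 0 by rewrite (gtn_eqF k0 : (k%:Z == 0) = false).
    rewrite -[in (j == _)](divzK kj) mulrC (inj_eq (mulfI k0')).
    by rewrite subrr.
  rewrite (ip_ael LWj (L2_0 R) (L2_zpow _ _) Wj) ip0l.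
  rewrite (_ : (j == _) = false) ?subrr//; apply/negbTE; apply: contra kj => /eqP ->.
  by rewrite dvdz_mulr.
pose K : set (T -> C) := [set g | L2 g /\ ip g (W u) - ip (slant_adj k g) u = 0].
have LW := WL _ Lu.
have cK : l2closed K.
  apply: (@l2closed_ker _ _ (2 * nrm2 (W u) + 2 * nrm2 u) l2closed_L2) => [c f' g' Lf' Lg'|f' Lf'].
    rewrite slant_lin !ip_lin//; [ring|exact: L2_slant|exact: L2_slant].
  have h1 := cauchy_schwarz Lf' LW.
  have h2 := cauchy_schwarz (L2_slant k0 Lf') Lu.
  rewrite nrm2_slant// in h2.
  have h3 := le_normcD (ip f' (W u)) (- ip (slant_adj k f') u).
  rewrite normcN in h3.
  have h5 := normc_nonneg (ip f' (W u) - ip (slant_adj k f') u).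
  move: h1 h2 h3 h5; set x := normc _; set y := normc _; set w := normc _ => h1 h2 h3 h5.
  have := sqr_ge0 (x - y); nra.
have [_] : K g.
  apply: l2closed_total => // n; split; first exact: L2_zpow.
  have Lzk := L2_zpow R (k%:Z * n).
  rewrite slant_adj_zpow ipC//; last exact: L2_zpow.
  rewrite [ip (zpow _) u]ipC//.
  by have /eqP := H1 n u Lu; rewrite subr_eq0 => /eqP ->; rewrite subrr.
move=> /eqP; rewrite subr_eq0 => /eqP e.
by rewrite ipC// e -ipC//; exact: L2_slant.
Qed.

End Hardy.

(** * Beurling's theorem and divisibility *)

Section Divisibility.
Variable R : realType.
Local Notation T := (circle R).
Local Notation C := R[i].
Local Notation m := (@circle_measure R).
Local Notation ip := (@inner_prod R).
Implicit Types (f g h p q a b u : T -> C) (c : C) (n j : int).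

Lemma ae_ex (P : T -> Prop) : {ae m, forall z, P z} -> exists z, P z.
Proof.
move=> [N [mN N0 sN]]; apply: contrapT => nP.
have NT : N = setT.
  by apply/seteqP; split => // z _; apply: sN => /= Pz; apply: nP; exists z.
by move: N0; rewrite NT => /eqP; rewrite (circle_measure_setT R) onee_eq0.
Qed.

Lemma inner_neq0 a : inner_fun a -> ~ a = 0 %[ae m].
Proof.
move=> [_ a1] /ae_pointwise a0.
have [z [h1 h2]] : exists z, normc (a z) = 1 /\ a z = 0.
  by apply: ae_ex; apply: filterS2 a1 a0 => z.
by move: h1; rewrite h2 normc0 => /esym/eqP; rewrite oner_eq0.
Qed.

Lemma fourier_cst c n : fourier (cst c : T -> C) n = c * (n == 0)%:R.
Proof.
rewrite (_ : cst c = c *: zpow 0 :> (T -> C)); last first.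
  by apply/funext => z; rewrite zpow0 -[RHS]/(c * 1) mulr1.
by rewrite /fourier ipZl ?ip_zpow 1?eq_sym//; exact: L2_zpow.
Qed.

Lemma L2_cst c : L2 (cst c : T -> C).
Proof. exact/L2_bmeas/bmeas_cst. Qed.

Lemma inner_of_unimodular f : H2 f -> {ae m, forall z, normc (f z) = 1} ->
  inner_fun f.
Proof.
move=> Hf f1; split => //; split => //; split; first exact/L2_cmeasurable/H2_L2.
by exists 1; apply: filterS f1 => z ->.
Qed.

Lemma nrm2_unimodular w f : cmeasurable w ->
  {ae m, forall z, normc (w z) = 1} -> L2 f -> nrm2 (w * f) = nrm2 f.
Proof.
move=> mw w1 [mf _]; apply: Rintegral_ae.
- have [h1 h2] := cmeasurableM mw mf.
  under eq_fun do rewrite normc_sqr.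
  by apply: measurable_funD; exact: measurable_funX.
- have [h1 h2] := mf; under eq_fun do rewrite normc_sqr.
  by apply: measurable_funD; exact: measurable_funX.
- by apply: filterS w1 => z wz _; rewrite normcM wz mul1r.
Qed.

(** The inverse [x] equals conj(d) almost everywhere, so [d] is both analytic and antianalytic, and
    only its mean remains. *)
Lemma inner_unit_cst d x : inner_fun d -> inner_fun x ->
  d * x = cst 1 %[ae m] -> exists2 c, c * c^* = 1 & d = cst c %[ae m].
Proof.
move=> id ix /ae_pointwise dx; have [Hd _] := inner_Hinf id.
have [Hx _] := inner_Hinf ix; have Ld := H2_L2 Hd; have Lx := H2_L2 Hx.
have xd : x = conjf d %[ae m].
  apply/ae_pointwise; apply: filterS2 dx (inner_unit id) => z h1 h2.
  by rewrite -[x z]mul1r -h2 mulrAC -[d z * x z]/((d * x) z) h1 mul1r.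
have dc : d = cst (fourier d 0) %[ae m].
  apply: L2_eq_ae => // [|n]; first exact: L2_cst.
  rewrite fourier_cst; have [->|n0] := eqVneq n 0; first by rewrite mulr1.
  rewrite mulr0; have [nn|np] := ltP n 0; first by case: Hd => _; apply.
  have : fourier x (- n) = 0.
    by case: Hx => _; apply; rewrite oppr_lt0 lt_def n0.
  rewrite /fourier (ip_ael Lx (L2_conj Ld) (L2_zpow _ _) xd) -/(fourier _ _).
  by rewrite fourier_conj// opprK => /eqP; rewrite conjc_eq0 => /eqP.
exists (fourier d 0) => //; move/ae_pointwise : dc => dc.
have [z [h1 h2]] : exists z, d z = fourier d 0 /\ d z * (d z)^* = 1.
  by apply: ae_ex; apply: filterS2 dc (inner_unit id) => z.
by rewrite -h1.
Qed.

(** The product d e divides both [a] and [b], hence divides [d] by maximality; cancelling [d] leaves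
    [e] with an inner inverse. *)
Lemma gcd_cofactors_coprime d a b a' b' : inner_gcd d a b ->
  inner_fun a' -> inner_fun b' -> a = d * a' %[ae m] -> b = d * b' %[ae m] ->
  forall e, inner_fun e -> inner_dvd e a' -> inner_dvd e b' ->
    exists2 c, c * c^* = 1 & e = cst c %[ae m].
Proof.
move=> [id _ _ dmax] ia' ib' /ae_pointwise ad /ae_pointwise bd e ie.
move=> [x ix /ae_pointwise ax] [y iy /ae_pointwise by_].
have [|||w iw /ae_pointwise dw] := dmax (d * e).
- exact: innerM.
- exists x => //; apply/ae_pointwise; apply: filterS2 ad ax => z h1 h2.
  by rewrite h1 -[(d * a') z]/(d z * a' z) h2 mulrA.
- exists y => //; apply/ae_pointwise; apply: filterS2 bd by_ => z h1 h2.
  by rewrite h1 -[(d * b') z]/(d z * b' z) h2 mulrA.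
apply: (@inner_unit_cst _ w) => //.
apply/ae_pointwise; apply: filterS2 dw (inner_unit id) => z h1 h2.
have d0 : d z != 0.
  by apply/eqP => d0; move: h2; rewrite d0 mul0r => /esym/eqP; rewrite oner_eq0.
apply: (mulfI d0); rewrite -[RHS]/(d z * 1) mulr1 [RHS]h1.
by rewrite -[RHS]/(d z * e z * w z) mulrA.
Qed.

(* The generator [t] is the normalized projection onto [I] of the monomial of
   least degree occurring in [I]. *)
Lemma beurling (I : set (T -> C)) a : l2closed I -> I `<=` H2 (R:=R) ->
  (forall u, I u -> I (zpow 1 * u)) -> inner_fun a -> I a ->
  exists t, [/\ inner_fun t, I t & forall u, I u -> H2 (conjf t * u)].
Proof.
move=> cI IH Iz1 ia Iaa; have IL u : I u -> L2 u by move=> /IH/H2_L2.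
have Iz (n : nat) u : I u -> I (zpow n%:Z * u).
  elim: n => [|n IHn] Iu; first by rewrite zpow0 mul1r.
  by rewrite -addn1 PoszD addrC zpowD -mulrA; apply: Iz1; exact: IHn.
pose P (n : nat) := `[< exists2 u, I u & fourier u n%:Z != 0 >].
have exP : exists n : nat, P n.
  apply: contrapT => nP; apply: (inner_neq0 ia); apply: L2_unique; first exact: IL.
  case=> n; last by case: (IH _ Iaa) => _; apply.
  apply: contrapT => /eqP an; apply: nP; exists n; apply/asboolP.
  by exists a.
pose N := ex_minn exP.
have [/asboolP[v Iv vN] minN] : P N /\ forall n : nat, P n -> (N <= n)%N.
  by rewrite /N; case: ex_minnP.
have low u n : I u -> n < N%:Z -> fourier u n = 0.
  move=> Iu; case: n => n; last by case: (IH _ Iu) => _ h _; exact: h.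
  rewrite ltz_nat => nN; apply: contrapT => /eqP un.
  by have := minN n; rewrite leqNgt nN => h; have : false by apply: h; apply/asboolP; exists u.
have [s Is Ns] := projection cI (L2_zpow R N%:Z); have Ls := IL _ Is.
have sN u : I u -> ip u s = fourier u N%:Z.
  move=> Iu; have Lu := IL _ Iu; have LN := L2_zpow R N%:Z.
  have /eqP := Ns _ Iu; rewrite ipBl// subr_eq0 => /eqP e.
  by rewrite ipC// -e -ipC.
(* Pairing with [s] reads the coefficient of index [N], and z^n u has none there when n > 0: [s] is
   a wandering vector for multiplication by z on [I]. *)
have wander u n : I u -> 0 < n -> ip (zpow n * u) s = 0.
  case: n => // n Iu n0; rewrite sN ?fourier_zpowM; last exact: Iz.
  by apply: low => //; rewrite ltrBlDl ltrDr.
pose r := nrm2 s.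
have r0 : 0 < r.
  rewrite lt0r nrm2_ge0 andbT; apply/eqP => s0; move/negP : vN; apply; apply/eqP.
  rewrite -sN// (ip_aer Ls (L2_0 R) (IL _ Iv) (nrm2_eq0 Ls s0)).
  exact: ip0r.
have css : cint (s * conjf s) by apply: cint_L2M => //; exact: L2_conj.
(* Wandering with u = s kills the coefficients of |s|^2 at all nonzero indices, one sign directly
   and the other by conjugation; hence |s|^2 is the constant [r]. *)
have mod_s : {ae m, forall z, s z * (s z)^* = r%:C}.
  have crc : cint (cst (- r%:C) : T -> C) by exact/cint_bmeas/bmeas_cst.
  suff : s * conjf s + cst (- r%:C) = 0 %[ae m].
    move/ae_pointwise; apply: filterS => z /eqP.
    by rewrite -[(s * _ + _) z]/(s z * (s z)^* - r%:C) subr_eq0 => /eqP.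
  apply: cintegral_unique; first exact: cintD.
  move=> n; rewrite mulrDl cintegralD; last 2 first.
  - by apply: cint_bmeasM => //; exact: bmeas_zpow.
  - by apply: cint_bmeasM => //; exact: bmeas_zpow.
  rewrite -(scalefE (- r%:C) (zpow n)) cintegralZ; last exact/cint_bmeas/bmeas_zpow.
  rewrite cintegral_zpow.
  have E : forall n, cintegral (s * conjf s * zpow n) = ip (zpow n * s) s.
    by move=> k; rewrite /inner_prod mulrC mulrA.
  rewrite E; have [->|n0] := eqVneq n 0.
    by rewrite zpow0 mul1r ip_nrm2// mulr1 subrr.
  rewrite mulr0 addr0; have [np|nn] := ltP 0 n; first exact: wander.
  rewrite -E (_ : _ * _ = conjf (s * conjf s * zpow (- n))); last first.
    by rewrite !conjfM conjfK conj_zpow opprK [conjf s * s]mulrC.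
  rewrite cintegral_conj; last by apply: cint_bmeasM => //; exact: bmeas_zpow.
  by rewrite E wander ?conjc0// oppr_gt0 lt_neqAle n0.
pose k : C := (Num.sqrt r)^-1%:C.
have It : I (k *: s).
  case: cI => _ I0 Il _; rewrite -[k *: s]addr0; exact: Il.
have it : inner_fun (k *: s).
  apply: inner_of_unimodular; first exact: IH.
  apply: filterS mod_s => z sz.
  have szn : normc (s z) ^+ 2 = r by move: sz; rewrite mulcJ => /complexI.
  have : normc ((k *: s) z) ^+ 2 = 1.
    rewrite -[(k *: s) z]/(k * s z) normcM exprMn szn normc_sqr /= expr0n addr0.
    by rewrite exprVn sqr_sqrtr ?mulVf ?gt_eqF// ltW.
  by move=> /eqP; rewrite sqrf_eq1 => /orP[/eqP//|/eqP]; have := normc_nonneg ((k *: s) z); lra.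
have Lt := inner_Linf it.
exists (k *: s); split; [exact: it|exact: It|] => u Iu.
split; first by apply: L2_LinfMl; [exact: Linf_conj|exact: IL].
move=> n n0; rewrite fourierE.
(* The coefficient of conj(t) u at n is <z^-n u, t>, which wandering kills for n < 0. *)
rewrite (_ : cintegral _ = ip (zpow (- n) * u) (k *: s)); last first.
  by rewrite /inner_prod mulrC mulrA mulrAC mulrC mulrA mulrAC [conjf _ * _]mulrC.
rewrite ipZr//; last by apply: L2_zpowM; exact: IL.
by rewrite wander ?mulr0// oppr_gt0.
Qed.

(** With w = conj(a) b, the condition that b u lie in a H^2 says that w u is in H^2. Both [a] and
    [h] satisfy it. If [t] generates the resulting subspace, then e = conj(t) a is inner and divides
    a = e t as well as b = e (w t). Coprimality makes [e] constant, so [a] generates the subspace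
    too and divides [h]. *)
Lemma coprime_divides a b h y : inner_fun a -> inner_fun b -> H2 h -> H2 y ->
  b * h = a * y %[ae m] ->
  (forall e, inner_fun e -> inner_dvd e a -> inner_dvd e b ->
    exists2 c, c * c^* = 1 & e = cst c %[ae m]) ->
  exists2 g, H2 g & h = a * g %[ae m].
Proof.
move=> ia ib Hh Hy bh cop.
pose w := conjf a * b.
have Lw : Linf w by apply: LinfM; [apply: Linf_conj|]; exact: inner_Linf.
pose I : set (T -> C) := [set u | H2 u /\ H2 (w * u)].
have cI : l2closed I.
  have [HL H0 Hl Hc] := l2closed_H2 R.
  split.
  - by move=> u [/H2_L2].
  - by split; rewrite ?mulr0.
  - move=> c f g [Hf Hwf] [Hg Hwg]; split; first exact: H2_lin.
    by rewrite mulrDr scalefE mulrCA -scalefE; exact: H2_lin.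
  (* Multiplication by the unimodular [w] is isometric, which makes the condition on w u closed. *)
  - have Bw f : L2 f -> nrm2 (w * f) = nrm2 f.
      apply: nrm2_unimodular; first by case: Lw.
      by apply: filterS2 ia.2 ib.2 => z az bz; rewrite normcM normc_conj az bz mulr1.
    move=> f Lf H; split.
      by apply: Hc => // e e0; have [u [Hu _] fu] := H e e0; exists u.
    apply: Hc => //; first exact: L2_LinfMl.
    move=> e e0; have [u [Hu Hwu] fu] := H e e0.
    by exists (w * u) => //; rewrite -mulrBr Bw//; apply: L2B => //; exact: H2_L2.
have [] := @beurling I a cI _ _ ia _.
- by move=> u [].
- move=> u [Hu Hwu]; split; first exact: H2_zpowM.
  by rewrite mulrCA; exact: H2_zpowM.
- have [Ha _] := inner_Hinf ia; have [Hb _] := inner_Hinf ib; split => //.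
  apply: (H2_ae Hb); first by apply: L2_LinfMl => //; exact: H2_L2.
  apply/ae_pointwise; apply: filterS (inner_unit ia) => z az.
  by rewrite -[RHS]/((a z)^* * b z * a z) mulrAC [_^* * _]mulrC az mul1r.
move=> t [it [Ht Hwt] tI].
have Ih : I h.
  split => //; apply: (H2_ae Hy); first by apply: L2_LinfMl => //; exact: H2_L2.
  move/ae_pointwise : bh => bh.
  apply/ae_pointwise; apply: filterS2 bh (inner_unit ia) => z bz az.
  rewrite -[RHS]/((a z)^* * b z * h z) -mulrA -[b z * h z]/((b * h) z) bz.
  by rewrite -[RHS]/((a z)^* * (a z * y z)) mulrA [_^* * _]mulrC az mul1r.
have Iaa : I a.
  have [Ha _] := inner_Hinf ia; have [Hb _] := inner_Hinf ib; split => //.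
  apply: (H2_ae Hb); first by apply: L2_LinfMl => //; exact: H2_L2.
  apply/ae_pointwise; apply: filterS (inner_unit ia) => z az.
  by rewrite -[RHS]/((a z)^* * b z * a z) mulrAC [_^* * _]mulrC az mul1r.
have ie : inner_fun (conjf t * a).
  apply: inner_of_unimodular; first exact: tI.
  by apply: filterS2 it.2 ia.2 => z tz az; rewrite normcM normc_conj tz az mulr1.
have iwt : inner_fun (w * t).
  apply: inner_of_unimodular => //; have h1 := it.2; have h2 := ia.2.
  apply: filterS3 h1 h2 ib.2 => z tz az bz.
  by rewrite !normcM normc_conj tz az bz !mulr1.
have [||c cc /ae_pointwise ec] := cop _ ie.
- exists t => //; apply/ae_pointwise; apply: filterS (inner_unit it) => z tz.
  by rewrite -[RHS]/((t z)^* * a z * t z) mulrAC [_^* * _]mulrC tz mul1r.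
- exists (w * t) => //; apply/ae_pointwise.
  apply: filterS2 (inner_unit it) (inner_unit ia) => z tz az.
  rewrite -[RHS]/((t z)^* * a z * ((a z)^* * b z * t z)).
  rewrite (_ : _ * _ = (t z * (t z)^*) * (a z * (a z)^*) * b z); last by ring.
  by rewrite tz az !mul1r.
exists (c^* *: (conjf t * h)); first by apply: H2Z; exact: tI.
apply/ae_pointwise; apply: filterS2 ec (inner_unit it) => z ez tz.
rewrite -[RHS]/(a z * (c^* * ((t z)^* * h z))).
have -> : a z = c * t z.
  rewrite -[c]/(cst c z) -ez -[(conjf t * a) z]/((t z)^* * a z).
  by rewrite mulrAC [_^* * _]mulrC tz mul1r.
rewrite (_ : c * t z * _ = (c * c^*) * (t z * (t z)^*) * h z); last by ring.
by rewrite cc tz !mul1r.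
Qed.

End Divisibility.

(** * Intertwining the compressed shifts *)

Section Shift.
Variable R : realType.
Local Notation T := (circle R).
Local Notation C := R[i].
Local Notation m := (@circle_measure R).
Local Notation ip := (@inner_prod R).
Implicit Types (f g h p q a b u v : T -> C) (c : C) (n j s : int).

Lemma ip_separated u v s : L2 u -> L2 v ->
  (forall n, s <= n -> fourier u n = 0) -> (forall n, n < s -> fourier v n = 0) ->
  ip u v = 0.
Proof.
move=> Lu Lv u0 v0.
have -> : ip u v = ip (zpow (- s) * u) (zpow (- s) * v).
  rewrite ipMl conj_zpow opprK mulrA -zpowD subrr zpow0.
  by congr (ip u _); rewrite mul1r.
apply: ip_antianalytic; first exact: L2_zpowM.
  by move=> n n0; rewrite fourier_zpowM opprK u0// lerDr.
split; first exact: L2_zpowM.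
by move=> n n0; rewrite fourier_zpowM opprK v0// gtrDr.
Qed.

(** Read off from the values of [W] on monomials through the adjoint relation. *)
Lemma fourier_slant (k : nat) (W : (T -> C) -> (T -> C)) g n : (0 < k)%N -> slant_op k W -> L2 g ->
  fourier (slant_adj k g) n = if (k %| n)%Z then fourier g (n %/ k)%Z else 0.
Proof.
move=> k0 sW Lg; have LV := L2_slant k0 Lg; have Lz := L2_zpow R n.
rewrite /fourier ipC// -(slant_op_adj k0 sW)//.
have [[WL _ _] WE] := sW.
have := WE n; case: ifP => _ e.
  by rewrite (ip_ael (WL _ Lz) (L2_zpow _ _) Lg e) -ipC//; exact: L2_zpow.
by rewrite (ip_ael (WL _ Lz) (L2_0 R) Lg e) ip0l conjc0.
Qed.

Lemma compressed_shiftP a f : inner_fun a -> model a f ->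
  model a (compressed_shift a f) /\
  exists2 y, H2 y & zpow 1 * f = compressed_shift a f + a * y %[ae m].
Proof.
move=> ia mf; have Hzf : H2 (zpow 1 * f) by apply: H2_zpowM (model_H2 mf).
have [mS oS] := oprojP (l2closed_model ia) (H2_L2 Hzf).
have [y Hy /ae_pointwise e] :=
  H2_orth_model_inf ia (H2B Hzf (model_H2 mS)) (fun g mg => oS g mg.1).
split; first exact: mS.
exists y => //; apply/ae_pointwise; apply: filterS e => z.
by rewrite !fctE => <-; rewrite /compressed_shift; ring.
Qed.

(** Multiplying the decomposition by conj(a) gives conj(a) z^n f = conj(a) S^n f + y, whose first
    term has negative frequencies only; so [y] is the analytic part of the left side, which is the
    last clause. *)
Lemma iter_shiftP a f (n : nat) : inner_fun a -> model a f ->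
  exists y, [/\ model a (iter n (compressed_shift a) f), H2 y,
    zpow n%:Z * f = iter n (compressed_shift a) f + a * y %[ae m] &
    forall j, 0 <= j -> fourier y j = fourier (conjf a * f) (j - n%:Z)].
Proof.
move=> ia mf.
have [y [mS Hy e]] : exists y, [/\ model a (iter n (compressed_shift a) f), H2 y &
    zpow n%:Z * f = iter n (compressed_shift a) f + a * y %[ae m]].
  elim: n => [|n [y [mS Hy /ae_pointwise e]]].
    exists 0; split => //; first by case: (l2closed_H2 R).
    by apply/ae_pointwise; apply: aeW => z; rewrite !fctE zpow0 mulr0 addr0 mul1r.
  have [mS' [w Hw /ae_pointwise e']] := compressed_shiftP ia mS.
  exists (w + zpow 1 * y); split => //.
    by apply: H2D => //; exact: H2_zpowM.
  apply/ae_pointwise; apply: filterS2 e e' => z; rewrite -addn1 PoszD zpowD.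
  rewrite addn1 iterS !fctE => h1 h2.
  rewrite -mulrA [zpow 1 z * f z]mulrC mulrA h1 mulrDl.
  rewrite [_ * zpow 1 z]mulrC h2; ring.
exists y; split => // j j0.
have Lf := model_L2 mf; have LS := model_L2 mS; have Ly := H2_L2 Hy.
have Lay := L2_innerM ia Ly.
have e1 : conjf a * (zpow n%:Z * f) = conjf a * iter n (compressed_shift a) f + y %[ae m].
  move/ae_pointwise : e => e.
  apply/ae_pointwise; apply: filterS2 e (inner_unit ia) => z h1 h2.
  rewrite !fctE in h1 *.
  by rewrite h1 -[y z in RHS]mul1r -(h2 : a z * conjf a z = 1); ring.
have LaS : L2 (conjf a * iter n (compressed_shift a) f) by exact: L2_innerJM.
have : fourier (conjf a * (zpow n%:Z * f)) j =
       fourier (conjf a * iter n (compressed_shift a) f + y) j.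
  apply: ip_ael e1; [|exact: L2D|exact: L2_zpow].
  by apply: L2_innerJM => //; exact: L2_zpowM.
rewrite fourierD// (model_antianalytic ia mS j0) add0r => <-.
by rewrite mulrCA fourier_zpowM.
Qed.

Lemma iter_shift_ip a f h (n : nat) : inner_fun a -> model a f -> model a h ->
  ip (iter n (compressed_shift a) f) h = ip (zpow n%:Z * f) h.
Proof.
move=> ia mf mh; have [y [mS Hy e _]] := iter_shiftP n ia mf.
have Lay := H2_L2 (H2_innerM ia Hy); have LS := model_L2 mS; have Lh := model_L2 mh.
rewrite (ip_ael (L2_zpowM n (model_L2 mf)) (L2D LS Lay) Lh e) ipDl//.
by rewrite [ip (a * y) h]ipC// (mh.2 _ Hy) conjc0 addr0.
Qed.

Lemma model_eq_ae a f g : inner_fun a -> model a f -> model a g ->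
  (forall h, model a h -> ip f h = ip g h) -> f = g %[ae m].
Proof.
move=> ia mf mg fg; have Lf := model_L2 mf; have Lg := model_L2 mg.
have md : model a (f - g).
  have [_ _ ml _] := l2closed_model ia; rewrite addrC -scaleN1r; exact: ml.
have d0 : f - g = 0 %[ae m].
  apply: nrm2_eq0; first exact: L2B.
  apply: complexI; rewrite -ip_nrm2; last exact: L2B.
  by rewrite ipBl ?fg ?subrr//; exact: L2B.
move/ae_pointwise : d0 => d0; apply/ae_pointwise; apply: filterS d0 => z /eqP.
by rewrite !fctE subr_eq0 => /eqP.
Qed.

(** S^n f is the projection of z^n f, so |S^n f|^2 = <z^n f, S^n f>, and Cauchy-Schwarz applies. *)
Lemma nrm2_iter_shift a f (n : nat) : inner_fun a -> model a f ->
  nrm2 (iter n (compressed_shift a) f) <= nrm2 f.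
Proof.
move=> ia mf; have [y [mS Hy _ _]] := iter_shiftP n ia mf.
have LS := model_L2 mS; have Lf := model_L2 mf; have LSn := L2_zpowM n%:Z Lf.
have h1 : ip (iter n (compressed_shift a) f) (iter n (compressed_shift a) f) =
  ip (zpow n%:Z * f) (iter n (compressed_shift a) f) by exact: iter_shift_ip.
have h2 := cauchy_schwarz LSn LS.
have h3 : nrm2 (zpow n%:Z * f) = nrm2 f.
  apply: nrm2_unimodular => //; first exact: cmeasurable_zpow.
  by apply: aeW => z; exact: normc_zpow.
move: h2; rewrite h3 -h1 ip_nrm2// normc_sqr/= expr0n addr0 expr2.
have := nrm2_ge0 (iter n (compressed_shift a) f).
rewrite le_eqVlt => /orP[/eqP <- _|S0]; first exact: nrm2_ge0.
by rewrite ler_pM2r.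
Qed.

Lemma iter_shift_lin a c f g (n : nat) : inner_fun a -> model a f -> model a g ->
  iter n (compressed_shift a) (c *: f + g) =
  c *: iter n (compressed_shift a) f + iter n (compressed_shift a) g %[ae m].
Proof.
move=> ia mf mg; have [_ _ ml _] := l2closed_model ia.
have mfg := ml c _ _ mf mg.
have mS h : model a h -> model a (iter n (compressed_shift a) h).
  by move=> mh; have [y []] := iter_shiftP n ia mh.
have Lf := model_L2 mf; have Lg := model_L2 mg.
apply: (model_eq_ae ia); [exact: mS|by apply: ml; exact: mS|move=> h mh].
have Lh := model_L2 mh.
rewrite ip_lin//; [|exact/model_L2/mS|exact/model_L2/mS].
rewrite !iter_shift_ip// -ip_lin//; try exact: L2_zpowM.
by congr (ip _ h); rewrite mulrDr scalefE mulrCA -scalefE.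
Qed.

(** As conj(a) f has negative frequencies only, [y] is a polynomial of degree less than [n]. It is
    therefore bounded, and so is S^n f = z^n f - a y; this lets an operator given by its symbol on
    bounded functions be evaluated at S^n f. *)
Lemma iter_shift_inf a f (n : nat) : inner_fun a -> model_inf a f ->
  exists y, [/\ model_inf a (iter n (compressed_shift a) f), Hinf y,
    zpow n%:Z * f = iter n (compressed_shift a) f + a * y %[ae m],
    forall j, 0 <= j -> fourier y j = fourier (conjf a * f) (j - n%:Z) &
    forall j, n%:Z <= j -> fourier y j = 0].
Proof.
move=> ia [mf [_ Bf]]; have [y [mS Hy e yE]] := iter_shiftP n ia mf.
have y0 j : n%:Z <= j -> fourier y j = 0.
  move=> nj; rewrite yE ?(le_trans _ nj)//; apply: model_antianalytic => //.
  by rewrite subr_ge0.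
have By : Hinf y by apply: (H2_finite_Hinf (n := n)) => // j nj; exact: y0.
exists y; split => //; split => //; split; first exact: model_H2 mS.
apply: (@Linf_ae _ (zpow n%:Z * f + (cst (-1)) * (a * y))).
- have h1 : Linf (zpow n%:Z * f) by apply: LinfM => //; exact/bmeas_Linf/bmeas_zpow.
  have h2 : Linf (cst (-1) * (a * y)).
    apply: LinfM; first exact/bmeas_Linf/bmeas_cst.
    by apply: LinfM; [exact: inner_Linf|case: By].
  case: h1 => m1 [B1 b1]; case: h2 => m2 [B2 b2]; split; first exact: cmeasurableD.
  exists (B1 + B2); apply: filterS2 b1 b2 => z h1 h2.
  by apply: le_trans (le_normcD _ _) _; exact: lerD.
- exact: L2_cmeasurable (model_L2 mS).
- move/ae_pointwise : e => e; apply/ae_pointwise; apply: filterS e => z.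
  rewrite !fctE => ->; ring.
Qed.

(** The natural conjugation g |-> a conj(z g) of K_a. Multiplied by conj(a), its value is conj(z g),
    so prescribing coefficients of [g] prescribes the polynomial [y] attached to its image by
    [iter_shift_inf]. *)
Lemma model_conj a g : inner_fun a -> model_inf a g ->
  model_inf a (a * (zpow (-1) * conjf g)).
Proof.
move=> ia [mg [Hg Bg]]; have Lg := H2_L2 Hg; have Lcg := L2_conj Lg.
have Lz : L2 (zpow (-1) * conjf g) by exact: L2_zpowM.
have La : L2 (a * (zpow (-1) * conjf g)) by exact: L2_innerM.
have Hf : H2 (a * (zpow (-1) * conjf g)).
  split => // n n0.
  rewrite (_ : a * _ = conjf (zpow 1 * (conjf a * g))); last first.
    by rewrite !conjfM conjfK conj_zpow mulrCA.
  rewrite fourier_conj; last by apply: L2_zpowM; exact: L2_innerJM.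
  rewrite fourier_zpowM model_antianalytic ?conjc0//.
  by rewrite subr_ge0 lerNr -ltzD1 addNr.
split; last first.
  split => //; apply: LinfM; first exact: inner_Linf.
  by apply: LinfM; [exact/bmeas_Linf/bmeas_zpow|exact: Linf_conj].
apply: model_of_antianalytic => // n n0.
have Laa : L2 (conjf a * (a * (zpow (-1) * conjf g))) by exact: L2_innerJM.
rewrite /fourier (ip_ael Laa Lz (L2_zpow R n) (inner_mulKJ _ ia)) -/(fourier _ _).
rewrite fourier_zpowM fourier_conj//; have [_ ->] := Hg; first by rewrite conjc0.
by rewrite oppr_lt0 opprK ltr_wpDl.
Qed.

End Shift.

(** * The intertwining relation as an identity of pairings *)

Section Intertwining.
Variable R : realType.
Local Notation T := (circle R).
Local Notation C := R[i].
Local Notation m := (@circle_measure R).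
Local Notation ip := (@inner_prod R).
Implicit Types (f g h p q a b u v y : T -> C) (c : C) (n j s : int).

Variables (k : nat) (W U : (T -> C) -> (T -> C)) (alpha beta phi : T -> C).
Hypotheses (k0 : (0 < k)%N) (sW : slant_op k W).
Hypotheses (ia : inner_fun alpha) (ib : inner_fun beta) (Lphi : L2 phi).
Hypothesis bU : bounded_extension W alpha beta phi U.
Local Notation V := (slant_adj k).
Local Notation Sa := (compressed_shift alpha).
Local Notation Sb := (compressed_shift beta).

(** The backward shift (g - g(0)) / z, adjoint to S_beta on K_beta. It is orthogonal to beta H^2
    because z beta h is orthogonal both to [g] and to the constants. *)
Lemma model_bshift g : model beta g ->
  model beta (zpow (-1) * (g - cst (fourier g 0))).
Proof.
move=> mg; have Hg := model_H2 mg; have Lg := H2_L2 Hg.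
have Lc := L2_cst (fourier g 0); have Ld := L2B Lg Lc.
have Hb : H2 (zpow (-1) * (g - cst (fourier g 0))).
  split; first exact: L2_zpowM.
  move=> n n0; rewrite fourier_zpowM fourierB// fourier_cst opprK.
  have [->|n1] := eqVneq n (-1); first by rewrite addNr mulr1 subrr.
  have n2 : n + 1 < 0 by rewrite -ltrBrDr sub0r lt_neqAle n1/= -ltzD1 addNr.
  by rewrite (Hg.2 _ n2) lt_eqF// mulr0 subrr.
split; first exact: Hb.
move=> h Hh; have Lbh := L2_innerM ib (H2_L2 Hh).
rewrite ipMl conj_zpow opprK mulrC ipC; [|by rewrite mulrC; exact: L2_zpowM|exact: Ld].
rewrite ipBr//; last by rewrite mulrC; exact: L2_zpowM.
have e : beta * h * zpow 1 = beta * (zpow 1 * h) by ring.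
have Hzh : H2 (zpow 1 * h) by exact: H2_zpowM.
rewrite e [ip _ g]ipC//; last by exact/H2_L2/H2_innerM.
rewrite (mg.2 _ Hzh) conjc0 sub0r.
have -> : ip (beta * (zpow 1 * h)) (cst (fourier g 0)) = 0.
  rewrite (_ : cst (fourier g 0) = fourier g 0 *: zpow 0); last first.
    by apply/funext => z; rewrite zpow0 -[RHS]/(_ * 1) mulr1.
  rewrite ipZr; [|exact: L2_zpow|exact/H2_L2/H2_innerM].
  rewrite -/(fourier _ _) mulrCA fourier_zpowM.
  by rewrite (proj2 (H2_innerM ib Hh))// mulr0.
by rewrite oppr0 conjc0.
Qed.

(** Otherwise the constant 1 is orthogonal to K_beta^infty, so 1 = beta h with h inner, and beta is
    constant. *)
Lemma model_const_coef : nonconstant beta ->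
  exists2 g, model_inf beta g & fourier g 0 != 0.
Proof.
move=> nb; apply: contrapT => H; apply: nb.
have H1 : H2 (cst 1 : T -> C) by rewrite -zpow0; exact: H2_zpow.
have [g mg|h Hh e] := H2_orth_model_inf ib H1.
  have Lg := model_L2 mg.1; apply: contrapT => /eqP g0; apply: H; exists g => //.
  rewrite -zpow0 ipC ?conjc_eq0// in g0; exact: L2_zpow.
have ih : inner_fun h.
  apply: inner_of_unimodular => //; move/ae_pointwise : e => e.
  apply: filterS2 e ib.2 => z; rewrite !fctE => h1 h2.
  by have := congr1 (@normc R) h1; rewrite normcM h2 mul1r normc1.
have e' : beta * h = cst 1 %[ae m].
  by move/ae_pointwise : e => e; apply/ae_pointwise; apply: filterS e.
have [c _ bc] := inner_unit_cst ib ih e'.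
by exists c.
Qed.

(** Moving S_beta to the other side leaves z^-1 g = g(0) z^-1 + g1 with [g1] in K_beta. The analytic
    U f is orthogonal to z^-1, but W (phi f), which may replace U f only against [g1], need not be;
    writing g1 = z^-1 g - g(0) z^-1 produces the correction term, as z^-1 becomes z^-k under the
    adjoint of [W]. *)
Lemma slant_shift_pairing f g : model_inf alpha f -> model beta g ->
  ip (Sb (U f)) g =
  ip (zpow k%:Z * (phi * f)) (V g) - (fourier g 0)^* * fourier (phi * f) (- k%:Z).
Proof.
move=> mf mg; have [[UM _ _] UE] := bU.
have mUf := UM _ mf.1; have LUf := model_L2 mUf; have Lg := model_L2 mg.
have Lpf : L2 (phi * f) by apply: L2_LinfM => //; case: mf => _ [].
have LW : L2 (W (phi * f)) by case: sW => -[WL _ _] _; exact: WL.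
have [mS oS] := oprojP (l2closed_model ib) (L2_zpowM 1 LUf).
have [mP oP] := oprojP (l2closed_model ib) LW.
have LP := model_L2 mP; have LS := model_L2 mS.
have e1 : ip (Sb (U f)) g = ip (U f) (zpow (-1) * g).
  have := oS _ mg; rewrite ipBl//; last exact: L2_zpowM.
  by move=> /eqP; rewrite subr_eq0 ipMl conj_zpow => /eqP.
have mg1 := model_bshift mg; set g1 := zpow (-1) * (g - _) in mg1.
have Lg1 := model_L2 mg1.
have Lz1 : L2 (fourier g 0 *: zpow (-1) : T -> C) by apply: L2Z; exact: L2_zpow.
have eg : zpow (-1) * g = fourier g 0 *: zpow (-1) + g1.
  by rewrite /g1 scalefE; ring.
have LVg := L2_slant k0 Lg.
have Lzg : L2 (zpow (-1) * g) by exact: L2_zpowM.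
have VM : V (zpow (-1) * g) = zpow (- k%:Z) * V g.
  by rewrite slantM slant_adj_zpow mulrN1.
rewrite e1 eg ipDr// ipZr//; last exact: L2_zpow.
rewrite -/(fourier (U f) (-1)) (proj2 (model_H2 mUf))// mulr0 add0r.
have -> : ip (U f) g1 = ip (W (phi * f)) g1.
  rewrite (ip_ael LUf LP Lg1 (UE _ mf)).
  have := oP _ mg1; rewrite ipBl// => /eqP; rewrite subr_eq0 => /eqP ->.
  by [].
have -> : g1 = zpow (-1) * g - fourier g 0 *: zpow (-1) by rewrite eg addrC addKr.
rewrite ipBr// ipZr//; last exact: L2_zpow.
rewrite !(slant_op_adj k0 sW)//; last exact: L2_zpow.
rewrite VM slant_adj_zpow mulrN1 -/(fourier _ _); congr (_ - _).
by rewrite [RHS]ipMl conj_zpow.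
Qed.

Lemma slant_iter_pairing f g y : model_inf alpha f -> model beta g -> Hinf y ->
  model_inf alpha (iter k Sa f) ->
  zpow k%:Z * f = iter k Sa f + alpha * y %[ae m] ->
  ip (U (iter k Sa f)) g =
  ip (zpow k%:Z * (phi * f)) (V g) - ip (phi * alpha * y) (V g).
Proof.
move=> mf mg Hy mS e; have [[UM _ _] UE] := bU.
have Lg := model_L2 mg; have LVg := L2_slant k0 Lg.
have LpS : L2 (phi * iter k Sa f) by apply: L2_LinfM => //; case: mS => _ [].
have Lpf : L2 (phi * f) by apply: L2_LinfM => //; case: mf => _ [].
have LW : L2 (W (phi * iter k Sa f)) by case: sW => -[WL _ _] _; exact: WL.
have [mP oP] := oprojP (l2closed_model ib) LW.
have Lpay : L2 (phi * alpha * y).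
  by apply: L2_LinfM; [apply: L2_LinfM => //; exact: inner_Linf|case: Hy].
have LUS := model_L2 (UM _ mS.1).
rewrite (ip_ael LUS (model_L2 mP) Lg (UE _ mS)).
have := oP _ mg; rewrite ipBl//; last exact: model_L2 mP.
move=> /eqP; rewrite subr_eq0 => /eqP <-.
have Lz := L2_zpowM k%:Z Lpf.
rewrite (slant_op_adj k0 sW)// -ipBl//.
apply: ip_ael => //; first exact: L2B.
move/ae_pointwise : e => e; apply/ae_pointwise; apply: filterS e => z.
rewrite !fctE => h.
rewrite (_ : zpow k z * _ = phi z * (zpow k z * f z)); last by ring.
by rewrite h; ring.
Qed.

(* In operator terms: P_beta W (phi alpha y) = <phi f, z^-k> P_beta 1, where
   alpha y = z^k f - S_alpha^k f. Pairing with [g] in K_beta moves W to V g. *)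
Definition intertwining_symbol : Prop :=
  forall f g y, model_inf alpha f -> model beta g -> Hinf y ->
    (forall j, 0 <= j -> fourier y j = fourier (conjf alpha * f) (j - k%:Z)) ->
    zpow k%:Z * f = iter k Sa f + alpha * y %[ae m] ->
    ip (phi * alpha * y) (V g) = (fourier g 0)^* * fourier (phi * f) (- k%:Z).

Lemma Sb_model f : model beta f -> model beta (Sb f).
Proof. by move=> mf; case: (compressed_shiftP ib mf). Qed.

Lemma intertwining_of_eq :
  (forall f, model alpha f -> Sb (U f) = U (iter k Sa f) %[ae m]) ->
  intertwining_symbol.
Proof.
move=> H f g y mf mg Hy yE e.
have [[UM _ _] UE] := bU.
have [w [mS _ _ _ _]] := iter_shift_inf k ia mf.
have h1 := slant_shift_pairing mf mg.
have h2 := slant_iter_pairing mf mg Hy mS e.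
have LSU := model_L2 (Sb_model (UM _ mf.1)).
have LUS := model_L2 (UM _ mS.1).
have h3 := ip_ael LSU LUS (model_L2 mg) (H _ mf.1).
move: h3; rewrite h1 h2 => /eqP; rewrite (inj_eq (addrI _)) => /eqP/oppr_inj.
by move=> ->.
Qed.

(** For fixed [g] the difference of the two pairings is a bounded functional of [f], so its kernel
    is closed. The kernel contains K_alpha^infty; the component of [f] orthogonal to it thus lies in
    both alpha H^2 and K_alpha, and vanishes. *)
Lemma eq_of_intertwining : intertwining_symbol ->
  forall f, model alpha f -> Sb (U f) = U (iter k Sa f) %[ae m].
Proof.
move=> H f mf; have [[UM Ulin _] UE] := bU; have [B UB] := bounded_nrm2 bU.1.
have cM := l2closed_model ia; have [_ M0 Mlin _] := cM.
have mS h : model alpha h -> model alpha (iter k Sa h).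
  by move=> mh; have [y []] := iter_shiftP k ia mh.
(* [U] acts on functions, not on classes; that it respects almost everywhere equality comes from its
   linearity and its bound on the difference. *)
have Uae u v : model alpha u -> model alpha v -> u = v %[ae m] ->
    U u = U v %[ae m].
  move=> mu mv uv; have md : model alpha (-1 *: u + v) by exact: Mlin.
  have LUu := model_L2 (UM _ mu); have LUv := model_L2 (UM _ mv).
  have LUd := model_L2 (UM _ md).
  have d0 : nrm2 (-1 *: u + v) = 0.
    apply: nrm2_ae0; first exact: L2_cmeasurable (model_L2 md).
    move/ae_pointwise : uv => uv; apply/ae_pointwise; apply: filterS uv => z.
    by rewrite !fctE => ->; rewrite scaleN1r addNr.
  have n0 : nrm2 (U (-1 *: u + v)) = 0.
    by apply/eqP; rewrite eq_le nrm2_ge0 andbT -(mulr0 B) -d0; exact: UB.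
  have := nrm2_eq0 LUd n0; move=> /ae_pointwise h1.
  have := Ulin (-1) _ _ mu mv; move=> /ae_pointwise h2.
  apply/ae_pointwise; apply: filterS2 h1 h2 => z -> /esym.
  by rewrite !fctE scaleN1r addrC => /eqP; rewrite subr_eq0 => /eqP.
apply: (model_eq_ae ib); [exact/Sb_model/UM|exact/UM/mS|move=> g mg].
have Lg := model_L2 mg; have Lzg : L2 (zpow (-1) * g) by exact: L2_zpowM.
have SbE u : model alpha u -> ip (Sb (U u)) g = ip (U u) (zpow (-1) * g).
  move=> mu; have LUu := model_L2 (UM _ mu).
  have [mS' oS'] := oprojP (l2closed_model ib) (L2_zpowM 1 LUu).
  have := oS' _ mg; rewrite ipBl//; [|exact: L2_zpowM|exact: model_L2 mS'].
  by move=> /eqP; rewrite subr_eq0 ipMl conj_zpow => /eqP.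
(* Writing the first pairing with z^-1 g instead of S_beta leaves only [U] and the iterates of
   S_alpha to be shown linear and bounded. *)
pose L u := ip (U u) (zpow (-1) * g) - ip (U (iter k Sa u)) g.
have Llin c u v : model alpha u -> model alpha v -> L (c *: u + v) = c * L u + L v.
  move=> mu mv; have muv := Mlin c _ _ mu mv; rewrite /L.
  have LUu := model_L2 (UM _ mu); have LUv := model_L2 (UM _ mv).
  have LUSu := model_L2 (UM _ (mS _ mu)); have LUSv := model_L2 (UM _ (mS _ mv)).
  have mSS : model alpha (c *: iter k Sa u + iter k Sa v) by apply: Mlin; exact: mS.
  rewrite (ip_ael (model_L2 (UM _ muv)) (L2_lin c LUu LUv) Lzg (Ulin c _ _ mu mv)).
  rewrite (ip_ael (model_L2 (UM _ (mS _ muv))) (model_L2 (UM _ mSS)) Lg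
    (Uae _ _ (mS _ muv) mSS (iter_shift_lin c k ia mu mv))).
  rewrite (ip_ael (model_L2 (UM _ mSS)) (L2_lin c LUSu LUSv) Lg
    (Ulin c _ _ (mS _ mu) (mS _ mv))).
  by rewrite !ip_lin//; ring.
have Lbnd u : model alpha u ->
    normc (L u) ^+ 2 <= (4 * `|B| * nrm2 g) * nrm2 u.
  move=> mu; have LUu := model_L2 (UM _ mu); have LUSu := model_L2 (UM _ (mS _ mu)).
  have h1 := cauchy_schwarz LUu Lzg.
  have h2 := cauchy_schwarz LUSu Lg.
  have e1 : nrm2 (zpow (-1) * g) = nrm2 g.
    apply: nrm2_unimodular => //; first exact: cmeasurable_zpow.
    by apply: aeW => z; exact: normc_zpow.
  have nB w : model alpha w -> nrm2 (U w) <= `|B| * nrm2 w.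
    move=> mw; apply: le_trans (UB _ mw) _.
    by apply: ler_wpM2r; [exact: nrm2_ge0|exact: ler_norm].
  have h3 := nB _ mu; have h4 := nB _ (mS _ mu); have h5 := nrm2_iter_shift k ia mu.
  have g0 := nrm2_ge0 g; rewrite e1 in h1.
  have h6 : nrm2 (U (iter k Sa u)) <= `|B| * nrm2 u.
    by apply: le_trans h4 _; exact: ler_wpM2l.
  have h7 := ler_wpM2r g0 h3; have h8 := ler_wpM2r g0 h6.
  have := le_normcD (ip (U u) (zpow (-1) * g)) (- ip (U (iter k Sa u)) g).
  rewrite normcN -/(L u).
  move: (normc_nonneg (L u)) h1 h2 h7 h8.
  set l := normc (L u); set x := normc _; set x' := normc _.
  set P := _ * nrm2 u * nrm2 g => l0 h1 h2 h7 h8 hl.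
  rewrite (_ : _ * nrm2 u = 4 * P); last by rewrite /P; ring.
  have := sqr_ge0 (x - x'); nra.
have cK := l2closed_ker cM Llin Lbnd.
have LU u : model alpha u -> L u = ip (Sb (U u)) g - ip (U (iter k Sa u)) g.
  by move=> mu; rewrite /L SbE.
have Kinf u : model_inf alpha u -> L u = 0.
  move=> mu; have [y [mSu Hy e yE _]] := iter_shift_inf k ia mu.
  rewrite LU; last by case: mu.
  rewrite (slant_shift_pairing mu mg) (slant_iter_pairing mu mg Hy mSu e).
  by rewrite (H _ _ _ mu mg Hy yE e); ring.
suff [_] : [set u | model alpha u /\ L u = 0] f.
  by rewrite LU// => /eqP; rewrite subr_eq0 => /eqP.
have Lf := model_L2 mf; have [p Kp fp] := projection cK Lf.
have Lp := model_L2 Kp.1.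
have mfp : model alpha (f - p) by rewrite addrC -scaleN1r; exact: (Mlin _ _ _ Kp.1 mf).
have Hfp := model_H2 mfp.
have [u mu|h Hh e] := H2_orth_model_inf ia Hfp.
  by apply: fp; split; [case: mu|exact: Kinf].
apply: (l2closed_ae cK Kp Lf).
have Lah := H2_L2 (H2_innerM ia Hh).
have d0 : f - p = 0 %[ae m].
  apply: nrm2_eq0; first exact: L2B.
  apply: complexI; rewrite -ip_nrm2; last exact: L2B.
  by rewrite (ip_aer (L2B Lf Lp) Lah (L2B Lf Lp) e) (mfp.2 _ Hh).
move/ae_pointwise : d0 => d0; apply/ae_pointwise; apply: filterS d0 => z /eqP.
by rewrite !fctE subr_eq0 => /eqP ->.
Qed.

End Intertwining.

(** * Prescribing the first k Fourier coefficients in a model space *)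

Section Interpolation.
Variable R : realType.
Local Notation T := (circle R).
Local Notation C := R[i].
Local Notation m := (@circle_measure R).
Local Notation ip := (@inner_prod R).
Implicit Types (f g h p q a b u v y : T -> C) (c : C) (n j s : int).

Lemma model_inf_lin a c f g : inner_fun a -> model_inf a f -> model_inf a g ->
  model_inf a (c *: f + g).
Proof.
move=> ia [mf [Hf [m1 [B1 b1]]]] [mg [Hg [m2 [B2 b2]]]].
have [_ _ ml _] := l2closed_model ia.
split; [exact: ml|split; [exact: H2_lin|split]].
  by apply: cmeasurableD => //; exact: cmeasurableZ.
exists (normc c * B1 + B2); apply: filterS2 b1 b2 => z h1 h2.
apply: le_trans (le_normcD _ _) _; apply: lerD => //.
by rewrite -[(c *: f) z]/(c * f z) normcM; apply: ler_wpM2l => //; exact: normc_nonneg.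
Qed.

Lemma model_inf_sum a I (r : seq I) (c : I -> C) (F : I -> T -> C) :
  inner_fun a -> (forall i, model_inf a (F i)) ->
  model_inf a (\sum_(i <- r) c i *: F i).
Proof.
move=> ia aF; elim: r => [|i r IH]; last by rewrite big_cons; exact: model_inf_lin.
rewrite big_nil; have [_ M0 _ _] := l2closed_model ia.
split => //; split; first by case: (l2closed_H2 R).
exact/bmeas_Linf/(@bmeas_cst _ 0).
Qed.

Lemma model_sum a I (r : seq I) (c : I -> C) (F : I -> T -> C) :
  inner_fun a -> (forall i, model a (F i)) ->
  model a (\sum_(i <- r) c i *: F i).
Proof.
move=> ia aF; have [_ M0 ml _] := l2closed_model ia.
elim: r => [|i r IH]; first by rewrite big_nil.
rewrite big_cons; exact: (ml _ _ _ (aF i) IH).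
Qed.

Lemma fourier_sum I (r : seq I) (c : I -> C) (F : I -> T -> C) n :
  (forall i, L2 (F i)) ->
  fourier (\sum_(i <- r) c i *: F i) n = \sum_(i <- r) c i * fourier (F i) n.
Proof.
move=> LF; rewrite /fourier ip_suml; [|by move=> i; exact: L2Z|exact: L2_zpow].
by apply: eq_bigr => i _; rewrite ipZl//; exact: L2_zpow.
Qed.

(* A polynomial [q] of degree [d] in [a H^2] makes the Fourier coefficients of
   the elements of the model space satisfy a linear recurrence of order [d]. *)
Lemma model_dim_poly a (k : nat) (v : 'rV[C]_k) : inner_fun a ->
  dim_ge (model a) k -> v != 0 ->
  (forall f (n : nat), model a f ->
     ip f (zpow n%:Z * \sum_(i < k) v 0 i *: zpow i%:Z) = 0) -> False.
Proof.
move=> ia [w [mw windep]] /rV0Pn[i0 vi0] H.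
case: (@arg_maxnP _ i0 (fun i => v 0 i != 0) (fun i => i : nat) vi0) => d vd dmax.
(* The degree [d] is less than k, so some nontrivial combination of the k independent functions has
   its first d coefficients equal to 0; the recurrence then annihilates all the others. *)
pose M : 'M[C]_(k, d) := \matrix_(i < k, l < d) fourier (w i) (l : nat)%:Z.
have : kermx M != 0.
  rewrite kermx_eq0 /row_free; apply/negP => /eqP rk.
  by have := rank_leq_col M; rewrite rk leqNgt ltn_ord.
move=> /rowV0Pn[c /sub_kermxP cM /rV0Pn[i1 ci1]].
pose f := \sum_(i < k) c 0 i *: w i.
have mf : model a f by exact: model_sum.
have Lw i : L2 (w i) by exact: model_L2 (mw i).
have fE n : fourier f n = \sum_(i < k) c 0 i * fourier (w i) n by exact: fourier_sum.
have f0 (n : nat) : fourier f n%:Z = 0.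
  elim/ltn_ind: n => n IH; have [nd|dn] := ltnP n d.
    rewrite fE; have := congr1 (fun A : 'rV[C]_d => A 0 (Ordinal nd)) cM.
    rewrite !mxE => e; rewrite -[RHS]e; apply: eq_bigr => i _.
    by rewrite mxE.
  have := H f (n - d)%N mf.
  rewrite mulr_sumr ip_sumr; [|by move=> i; rewrite scalefE mulrCA -scalefE;
      apply: L2Z; apply: L2_zpowM; exact: L2_zpow|exact: model_L2 mf].
  have E (i : 'I_k) : ip f (zpow (n - d)%N%:Z * (v 0 i *: zpow i%:Z)) =
      (v 0 i)^* * fourier f (n - d + i)%N%:Z.
    rewrite scalefE mulrCA -zpowD -PoszD -scalefE ipZr//; first exact: L2_zpow.
    exact: model_L2 mf.
  rewrite (eq_bigr _ (fun i _ => E i)) (bigD1 d)//= big1 ?addr0.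
    rewrite subnK// => /eqP; rewrite mulf_eq0 conjc_eq0 (negbTE vd)/=.
    by move=> /eqP.
  move=> i id; have [ltid|ledi] := ltnP i d.
    rewrite IH ?mulr0//; rewrite -{2}(subnK dn) ltn_add2l//.
  have vi : v 0 i = 0.
    apply: contrapT => /eqP vi; have : (i <= d)%N := dmax i vi; rewrite leq_eqVlt ltnNge ledi orbF.
    by move=> e; move: id; rewrite -val_eqE/= (eqP e) eqxx.
  by apply/eqP; rewrite mulf_eq0 conjc_eq0 vi eqxx.
have : f = 0 %[ae m].
  apply: L2_unique; first exact: model_L2 mf.
  by case=> n; [exact: f0|case: mf => -[_ h _]; exact: h].
by move=> /windep/(_ i1) /eqP; rewrite (negbTE ci1).
Qed.

(* The Gram matrix of the projections of [1, ..., z ^ (k - 1)] is invertible. *)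
Lemma model_interpolation a (k : nat) : inner_fun a -> dim_ge (model a) k ->
  forall j : 'I_k, exists2 g, model_inf a g &
    forall i : 'I_k, fourier g (i : nat)%:Z = (j == i)%:R.
Proof.
move=> ia dk.
have /choice[p /choice[y pP]] (n : nat) := model_inf_zpow n ia.
pose G : 'M[C]_k := \matrix_(i, l) fourier (p i) (l : nat)%:Z.
have Lp (n : nat) : L2 (p n) by case: (pP n) => -[/model_L2].
have mp (n : nat) : model_inf a (p n) by case: (pP n).
have Hy (n : nat) : H2 (y n) by case: (pP n).
have uG : G \in unitmx.
  rewrite -row_free_unit -kermx_eq0; apply: contrapT => /negP/rowV0Pn[v /sub_kermxP vG v0].
  apply: (model_dim_poly ia dk v0) => f n mf.
  (* [s] is the projection of q, the polynomial with coefficients [v]. The relation v G = 0 says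
     that <s, z^i> = 0 for i < k, hence <s, s> = 0 and q lies in a H^2, which [model_dim_poly]
     excludes. *)
  pose s := \sum_(i < k) v 0 i *: p i.
  have ms : model_inf a s by exact: model_inf_sum.
  have Ls := model_L2 ms.1.
  have s0 : s = 0 %[ae m].
    apply: nrm2_eq0 => //; apply: complexI; rewrite -ip_nrm2//.
    rewrite [in X in ip _ X]/s ip_sumr//; last by move=> i; exact: L2Z.
    apply: big1 => i _; rewrite ipZr//.
    have Lay : L2 (a * y i) by exact/H2_L2/H2_innerM.
    have -> : p i = zpow (i : nat)%:Z - a * y i by case: (pP i) => _ _ ->; rewrite addrK.
    rewrite ipBr//; last exact: L2_zpow.
    rewrite (ms.1.2 _ (Hy i)) subr0 -/(fourier _ _) /s fourier_sum//.
    have -> : \sum_(l < k) v 0 l * fourier (p l) (i : nat)%:Z = (v *m G) 0 i.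
      by rewrite [RHS]mxE; apply: eq_bigr => l _; rewrite mxE.
    by rewrite vG mxE mulr0.
  have e : zpow n%:Z * \sum_(i < k) v 0 i *: zpow i%:Z =
      zpow n%:Z * s + a * (zpow n%:Z * \sum_(i < k) v 0 i *: y i).
    rewrite mulrCA -mulrDr; congr (_ * _); rewrite mulr_sumr -big_split/=.
    apply: eq_bigr => i _; case: (pP i) => _ _ ->.
    by rewrite scalerDr !scalefE; congr (_ + _); rewrite mulrCA.
  have HY : H2 (\sum_(i < k) v 0 i *: y i).
    elim/big_ind : _; first by case: (l2closed_H2 R).
      by move=> *; exact: H2D.
    by move=> i _; exact: H2Z.
  have Hz : H2 (zpow n%:Z * \sum_(i < k) v 0 i *: y i) by exact: H2_zpowM.
  have Lf := model_L2 mf; have Lzs := L2_zpowM n%:Z Ls.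
  rewrite e ipDr//; last exact/H2_L2/H2_innerM.
  rewrite (mf.2 _ Hz) addr0 (ip_aer Lzs (L2_0 R) Lf) ?ip0r//.
  move/ae_pointwise : s0 => s0; apply/ae_pointwise; apply: filterS s0 => z.
  by rewrite !fctE => ->; rewrite mulr0.
move=> j; exists (\sum_(i < k) invmx G j i *: p i); first exact: model_inf_sum.
move=> i; rewrite fourier_sum//.
rewrite (_ : \sum_(l < k) _ = (invmx G *m G) j i); first by rewrite mulVmx// mxE.
by rewrite [RHS]mxE; apply: eq_bigr => l _; rewrite mxE.
Qed.

End Interpolation.

(** * Frequency supports and the form of the symbol *)

Section Symbol.
Variable R : realType.
Local Notation T := (circle R).
Local Notation C := R[i].
Local Notation m := (@circle_measure R).
Local Notation ip := (@inner_prod R).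
Implicit Types (f g h p q a b u v y : T -> C) (c : C) (n j s : int).

Variables (k : nat) (W : (T -> C) -> (T -> C)) (alpha beta : T -> C).
Hypotheses (k0 : (0 < k)%N) (sW : slant_op k W).
Hypotheses (ia : inner_fun alpha) (ib : inner_fun beta).
Local Notation V := (slant_adj k).
Local Notation Sa := (compressed_shift alpha).

Lemma Posz_predn : k%:Z = k.-1%:Z + 1.
Proof. by rewrite -PoszD addn1 prednK. Qed.

Lemma H2_slant h : H2 h -> H2 (V h).
Proof.
move=> Hh; split; first exact: L2_slant (H2_L2 Hh).
move=> n n0; rewrite (fourier_slant _ k0 sW (H2_L2 Hh)); case: ifPn => // kn.
case: Hh => _; apply; rewrite -(divzK kn) in n0.
by rewrite pmulr_llt0 in n0.
Qed.

Lemma slant_inner b : inner_fun b -> inner_fun (V b).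
Proof.
move=> ib'; apply: inner_of_unimodular; first by apply: H2_slant; case: (inner_Hinf ib').
exact: (slant_ae (P := fun z => normc (b z) = 1) k0 ib'.2).
Qed.

Let iB : inner_fun (V beta) := slant_inner ib.

(** Moving V beta to the right produces V (conj(beta) g). Since conj(beta) g has frequencies <= -1,
    this has frequencies <= -k, whereas z^(1-k) y h has frequencies >= 1 - k. *)
Lemma pairing_analytic h g y : H2 h -> model beta g -> Hinf y ->
  ip (zpow (- k.-1%:Z) * V beta * h * y) (V g) = 0.
Proof.
move=> Hh mg [Hy By]; have Lg := model_L2 mg; have Hyh := H2_HinfM (conj Hy By) Hh.
have Lbg : L2 (conjf beta * g) by exact: L2_innerJM.
rewrite (_ : _ * _ * _ * y = V beta * (zpow (- k.-1%:Z) * (y * h))); last by ring.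
rewrite ipMl -slant_conj -slantM.
have Lu : L2 (zpow (- k.-1%:Z) * (y * h)) by exact: L2_zpowM (H2_L2 Hyh).
have LV : L2 (V (conjf beta * g)) by exact: L2_slant.
rewrite ipC// (@ip_separated _ _ _ (- k.-1%:Z)) ?conjc0//.
  move=> n kn; rewrite (fourier_slant _ k0 sW Lbg); case: ifPn => // nk.
  apply: model_antianalytic => //; rewrite leNgt; apply/negP => q0.
  move: kn; rewrite -(divzK nk) leNgt => /negP; apply.
  have q1 : (n %/ k)%Z <= -1 by rewrite -ltzD1 addNr.
  have kpos : (0 : int) < k%:Z by [].
  have := Posz_predn; nia.
move=> n nk; rewrite fourier_zpowM opprK (proj2 Hyh)//.
by rewrite -ltrBrDr sub0r.
Qed.

(** The frequencies of conj(h) y are below k, and those of V g - g(0) are at least k, so only g(0)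
    contributes. In the remaining <y, h>, [y] may be replaced by conj(alpha) z^k f, because the
    difference conj(alpha) S_alpha^k f is orthogonal to [h]. *)
Lemma pairing_antianalytic h f g y : H2 h -> model_inf alpha f -> model beta g ->
  Hinf y -> (forall j, k%:Z <= j -> fourier y j = 0) ->
  zpow k%:Z * f = iter k Sa f + alpha * y %[ae m] ->
  ip (conjf h * y) (V g) =
  (fourier g 0)^* * fourier (conjf (alpha * h) * f) (- k%:Z).
Proof.
move=> Hh mf mg [Hy By] y0 e; have Lg := model_L2 mg; have Lh := H2_L2 Hh.
have Lu : L2 (conjf h * y) by apply: L2_LinfM => //; exact: L2_conj.
have Ly := H2_L2 Hy; have LVg := L2_slant k0 Lg.
have Lc := L2_cst (fourier g 0).
have u0 n : k%:Z <= n -> fourier (conjf h * y) n = 0.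
  move=> kn; rewrite /fourier ipMl conjfK.
  have Lhz : L2 (zpow n * h) by exact: L2_zpowM.
  rewrite mulrC (@ip_separated _ _ _ k%:Z)// => j jk.
  by rewrite fourier_zpowM (proj2 Hh)// subr_lt0 (lt_le_trans jk).
have -> : V g = cst (fourier g 0) + (V g - cst (fourier g 0)) by ring.
rewrite ipDr//; last exact: L2B.
rewrite [X in _ + X](@ip_separated _ _ _ k%:Z)//; last 2 first.
- exact: L2B.
- move=> n nk; rewrite fourierB// (fourier_slant _ k0 sW Lg) fourier_cst.
  have [->|n0] := eqVneq n 0; first by rewrite dvdz0 div0z mulr1 subrr.
  rewrite mulr0 subr0; case: ifPn => // kn; apply: (proj2 (model_H2 mg)).
  have kpos : (0 : int) < k%:Z by [].
  move: nk n0; rewrite -{1 2}(divzK kn) => nk n0.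
  have qn : (n %/ k)%Z != 0 by apply: contraNN n0 => /eqP ->; rewrite mul0r.
  have : (n %/ k)%Z < 1 by nia.
  lia.
rewrite addr0 (_ : cst _ = fourier g 0 *: zpow 0); last first.
  by apply/funext => z; rewrite zpow0 -[RHS]/(_ * 1) mulr1.
rewrite ipZr//; last exact: L2_zpow.
congr (_ * _); rewrite ipMl conjfK zpow0 mulr1.
have mf1 := mf.1.
have [w [mS _ _ _]] := iter_shiftP k ia mf1.
have LS := model_L2 mS; have Lf := model_L2 mf1.
have e1 : conjf alpha * (zpow k%:Z * f) = conjf alpha * iter k Sa f + y %[ae m].
  move/ae_pointwise : e => e.
  apply/ae_pointwise; apply: filterS2 e (inner_unit ia) => z h1 h2.
  rewrite !fctE in h1 *.
  by rewrite h1 -[y z in RHS]mul1r -(h2 : alpha z * conjf alpha z = 1); ring.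
have -> : fourier (conjf (alpha * h) * f) (- k%:Z) = ip (conjf alpha * (zpow k%:Z * f)) h.
  by rewrite fourierE opprK /inner_prod conjfM; congr cintegral; ring.
have LaS : L2 (conjf alpha * iter k Sa f) by exact: L2_innerJM.
rewrite (ip_ael _ _ Lh e1); last 2 first.
- by apply: L2_innerJM => //; exact: L2_zpowM.
- exact: L2D.
by rewrite ipDl// ipMl conjfK (mS.2 _ Hh) add0r.
Qed.

(** The frequencies of the product start at 1 - k, one above the index that is read. *)
Lemma fourier_analytic_edge q f : H2 q -> Hinf f ->
  fourier (zpow (- k.-1%:Z) * q * f) (- k%:Z) = 0.
Proof.
move=> Hq Hf; have Hfq := H2_HinfM Hf Hq.
rewrite -mulrA [q * f]mulrC fourier_zpowM (proj2 Hfq)//.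
by rewrite opprK Posz_predn opprD addrAC addNr add0r.
Qed.

(** The relation between [a'] and [b'] turns phi alpha into conj(h1) + z^(1-k) (V beta) a' g0. The
    analytic part contributes nothing to either side, by [pairing_analytic] and
    [fourier_analytic_edge]; the antianalytic part contributes equally to both. *)
Lemma intertwining_of_form phi a' b' h1 g0 : L2 phi -> Hinf a' -> Hinf b' ->
  H2 h1 -> H2 g0 ->
  phi = conjf (alpha * h1) + zpow (- k.-1%:Z) * (b' * g0) %[ae m] ->
  alpha * b' = V beta * a' %[ae m] ->
  intertwining_symbol k alpha beta phi.
Proof.
move=> Lphi Ha Hb Hh Hg /ae_pointwise pE /ae_pointwise ab f g y mf mg Hy yE e.
have Lg := model_L2 mg; have LVg := L2_slant k0 Lg.
have Hag := H2_HinfM Ha Hg; have Hbg := H2_HinfM Hb Hg.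
have y0 j : k%:Z <= j -> fourier y j = 0.
  move=> kj; rewrite yE ?(le_trans _ kj)//.
  by apply: model_antianalytic => //; [exact: mf.1|rewrite subr_ge0].
have Lhy : L2 (conjf h1 * y).
  by apply: L2_LinfM; [exact/L2_conj/H2_L2|exact: Hy.2].
have LBy : L2 (zpow (- k.-1%:Z) * V beta * (a' * g0) * y).
  rewrite -!mulrA; apply: L2_zpowM; apply: L2_innerM => //.
  by rewrite mulrA; apply: L2_LinfM; [exact: H2_L2|exact: Hy.2].
have Lpay : L2 (phi * alpha * y).
  by apply: L2_LinfM; [apply: L2_LinfM => //; exact: inner_Linf|exact: Hy.2].
rewrite (ip_ael Lpay (L2D Lhy LBy) LVg); last first.
  apply/ae_pointwise; have ua := inner_unit ia.
  apply: filterS3 pE ab ua => z; rewrite conjfM !fctE => -> h2 h3.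
  have h4 : alpha z * conjf alpha z = 1 := h3.
  rewrite (_ : _ * alpha z * y z = (alpha z * conjf alpha z) * (conjf h1 z * y z)
    + zpow (- k.-1%:Z) z * (alpha z * b' z) * g0 z * y z); last by ring.
  by rewrite h4 h2; ring.
rewrite ipDl// pairing_analytic// addr0 (pairing_antianalytic Hh mf mg Hy y0 e).
congr (_ * _).
have Lf := mf.2.2.
have Lp1 : L2 (conjf (alpha * h1) * f).
  by apply: L2_LinfM => //; apply: L2_conj; exact: L2_innerM (H2_L2 Hh).
have Lp2 : L2 (zpow (- k.-1%:Z) * (b' * g0) * f).
  by apply: L2_LinfM => //; exact: L2_zpowM (H2_L2 Hbg).
have Lpf : L2 (phi * f) by exact: L2_LinfM.
have e2 : phi * f = conjf (alpha * h1) * f + zpow (- k.-1%:Z) * (b' * g0) * f %[ae m].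
  apply/ae_pointwise; apply: filterS pE => z; rewrite !fctE => ->; ring.
rewrite [RHS](ip_ael Lpf (L2D Lp1 Lp2) (L2_zpow R (- k%:Z)) e2).
rewrite -/(fourier _ _) fourierD// fourier_analytic_edge ?addr0//; exact: mf.2.
Qed.

(** Interpolation gives g0 in K_alpha with coefficient 1 at k - 1 - j and 0 at the other indices
    below k. For its conjugate f = alpha conj(z g0), the coefficient of [y] at n is the conjugate of
    that of [g0] at k - 1 - n, so y = z^j. The constant is the coefficient of phi f at -k. *)
Lemma interpolating_coefs phi : L2 phi -> dim_ge (model alpha) k ->
  intertwining_symbol k alpha beta phi ->
  forall j : 'I_k, exists c, forall g, model beta g ->
    ip (phi * alpha * zpow (j : nat)%:Z) (V g) = (fourier g 0)^* * c.
Proof.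
move=> Lphi dk H j; have [g0 mg0 g0E] := model_interpolation ia dk (rev_ord j).
pose f := alpha * (zpow (-1) * conjf g0).
have mf : model_inf alpha f by exact: model_conj.
have [y [mS Hy e yE y0]] := iter_shift_inf k ia mf.
have Lg0 := model_L2 mg0.1; have Lcg := L2_conj Lg0.
have Lzg := L2_zpowM (-1) Lcg.
have yz : y = zpow (j : nat)%:Z %[ae m].
  apply: L2_eq_ae; [exact: H2_L2 Hy.1|exact: L2_zpow|].
  case=> n; last first.
    by rewrite (proj2 Hy.1)// (proj2 (H2_zpow _ _)).
  have [nk|kn] := ltnP n k; last first.
    by rewrite y0// fourier_zpow eqz_nat ltn_eqF// (leq_trans (ltn_ord j)).
  rewrite yE// /fourier (ip_ael _ Lzg (L2_zpow _ _) (inner_mulKJ _ ia)); last first.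
    by apply: L2_innerJM => //; exact: L2_innerM.
  rewrite -/(fourier _ _) fourier_zpowM fourier_conj//.
  have -> : - (n%:Z - k%:Z - -1) = (rev_ord (Ordinal nk) : nat)%:Z.
    by rewrite /=; lia.
  rewrite g0E (inj_eq rev_ord_inj) ip_zpow eqz_nat -val_eqE/=.
  by case: (_ == _); rewrite ?conjc1 ?conjc0.
exists (fourier (phi * f) (- k%:Z)) => g mg.
rewrite -(H _ _ _ mf mg Hy yE e).
have LVg := L2_slant k0 (model_L2 mg).
have Lpa : L2 (phi * alpha) by apply: L2_LinfM => //; exact: inner_Linf.
apply: ip_ael => //.
- by rewrite mulrC; exact: L2_zpowM.
- by apply: L2_LinfM => //; exact: Hy.2.
- move/ae_pointwise : yz => yz; apply/ae_pointwise; apply: filterS yz => z.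
  by rewrite !fctE => ->.
Qed.

(* The trigonometric polynomial [K] removes the constants [c j], after which
   the blocks of phi alpha - K along the residues mod k are orthogonal to
   K_beta. *)
Lemma symbol_decomposition phi : L2 phi -> dim_ge (model alpha) k ->
  intertwining_symbol k alpha beta phi ->
  exists h1 h, [/\ H2 h1, H2 h &
    phi * alpha = conjf h1 + zpow (- k.-1%:Z) * V beta * h].
Proof.
move=> Lphi dk H; have /choice[c cP] := interpolating_coefs Lphi dk H.
have Lpa : L2 (phi * alpha) by apply: L2_LinfM => //; exact: inner_Linf.
pose K : T -> C := \sum_(j < k) c j *: zpow (- (j : nat)%:Z).
have LK : L2 K by apply: L2_sum => j; apply: L2Z; exact: L2_zpow.
pose F := phi * alpha - K; have LF : L2 F by exact: L2B.
have Forth (i : 'I_k) g : model beta g ->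
    ip F (zpow (- (i : nat)%:Z) * V g) = 0.
  move=> mg; have Lg := model_L2 mg; have LVg := L2_slant k0 Lg.
  have LzV : L2 (zpow (- (i : nat)%:Z) * V g) by exact: L2_zpowM.
  rewrite ipBl//.
  have -> : ip (phi * alpha) (zpow (- (i : nat)%:Z) * V g) = (fourier g 0)^* * c i.
    by rewrite -(cP i g mg) [phi * alpha * _]mulrC [RHS]ipMl conj_zpow.
  rewrite ip_suml//; last by move=> j; apply: L2Z; exact: L2_zpow.
  rewrite (eq_bigr (fun j : 'I_k => (j == i)%:R * ((fourier g 0)^* * c i))).
    rewrite (bigD1 i)//= eqxx mul1r big1 ?addr0 ?subrr//.
    by move=> j /negbTE ->; rewrite mul0r.
  move=> j _; rewrite ipZl//; last exact: L2_zpow.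
  have -> : ip (zpow (- (j : nat)%:Z)) (zpow (- (i : nat)%:Z) * V g) =
      (fourier (V g) ((i : nat)%:Z - (j : nat)%:Z))^*.
    rewrite -[zpow (- (i : nat)%:Z)]conjfK -ipMl conj_zpow opprK -zpowD.
    by rewrite ipC//; exact: L2_zpow.
  rewrite (fourier_slant _ k0 sW Lg) -eqz_mod_dvd !modz_nat !modn_small//.
  rewrite eqz_nat; have [->|ji] := eqVneq j i.
    by rewrite eqxx subrr div0z mul1r mulrC.
  by rewrite eq_sym (negbTE (ji : (j : nat) != i)) conjc0 mulr0 mul0r.
have LzF : L2 (conjf (V beta) * (zpow k.-1%:Z * F)).
  by apply: L2_innerJM => //; exact: L2_zpowM.
(* [h] is the analytic part of conj(V beta) z^(k-1) F and [rho] is the rest, so F is the sum of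
   z^(1-k) (V beta) h and r = (V beta) z^(1-k) rho. *)
have [h Hh hE] := H2_proj LzF; have Lh := H2_L2 Hh.
pose rho := conjf (V beta) * (zpow k.-1%:Z * F) - h.
have Lrho : L2 rho by exact: L2B.
have rho0 n : 0 <= n -> fourier rho n = 0.
  by move=> n0; rewrite fourierB// hE// subrr.
pose A := zpow (- k.-1%:Z) * V beta * h.
have LA : L2 A by rewrite /A -mulrA; apply: L2_zpowM; exact: L2_innerM.
pose r := F - A; have Lr : L2 r by exact: L2B.
have rE : r = V beta * (zpow (- k.-1%:Z) * rho) %[ae m].
  apply/ae_pointwise; apply: filterS (inner_unit iB) => z h1.
  have h2 : V beta z * conjf (V beta) z = 1 := h1.
  have h3 : zpow (- k.-1%:Z) z * zpow k.-1%:Z z = 1.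
    by rewrite -[LHS]/((zpow (- k.-1%:Z) * zpow k.-1%:Z) z) -zpowD addNr zpow0.
  rewrite /r /A /rho !fctE.
  rewrite (_ : V beta z * _ = (V beta z * conjf (V beta) z) *
     (zpow (- k.-1%:Z) z * zpow k.-1%:Z z) * F z - zpow (- k.-1%:Z) z * V beta z * h z).
    by rewrite h2 h3 !mul1r.
  by ring.
have r0 (n : nat) : fourier r n.+1%:Z = 0.
  (* Write n + 1 = k q - j with 0 <= j < k, and z^q = p + beta w with p in K_beta. Then z^(n+1) =
     z^-j V p + (V beta) z^-j V w. The first term is orthogonal to F by [Forth] and to [A] by
     [pairing_analytic]; against the second, V beta cancels and [rho] meets the analytic z^(k-1-j) V
     w. *)
  pose j := (k.-1 - n %% k)%N; pose q := (n %/ k).+1.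
  have nk : (n %% k < k)%N by rewrite ltn_pmod.
  have jk : (j < k)%N by rewrite /j; lia.
  have nE : n.+1%:Z = - j%:Z + k%:Z * q%:Z.
    have := divn_eq n k; rewrite /q /j => e; nia.
  have [p [w [mp Hw e]]] := model_inf_zpow q ib.
  have Lp := model_L2 mp.1; have Lw := H2_L2 Hw.
  have LVp := L2_slant k0 Lp; have LVw := L2_slant k0 Lw.
  have L1 : L2 (zpow (- j%:Z) * V p) by exact: L2_zpowM.
  have L2' : L2 (V beta * (zpow (- j%:Z) * V w)) by apply: L2_innerM => //; exact: L2_zpowM.
  have zE : zpow n.+1%:Z = zpow (- j%:Z) * V p + V beta * (zpow (- j%:Z) * V w) :> (T -> C).
    rewrite nE zpowD -slant_adj_zpow e.
    rewrite (_ : V (p + beta * w) = V p + V beta * V w)//; ring.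
  rewrite /fourier zE ipDr//.
  have -> : ip r (zpow (- j%:Z) * V p) = 0.
    rewrite ipBl// (Forth (Ordinal jk) p mp.1) sub0r.
    rewrite -[zpow (- j%:Z)]conjfK -ipMl conj_zpow opprK mulrC.
    rewrite pairing_analytic ?oppr0//; first exact: mp.1.
    by split; [exact: H2_zpow|exact/bmeas_Linf/bmeas_zpow].
  rewrite add0r (ip_ael Lr _ _ rE)//; last first.
    by apply: L2_innerM => //; exact: L2_zpowM.
  rewrite ip_innerM//; [|exact: L2_zpowM|exact: L2_zpowM].
  rewrite ipMl conj_zpow opprK mulrA -zpowD.
  apply: ip_antianalytic => //; apply: H2_zpowM; last exact: H2_slant.
  by rewrite subr_ge0 lez_nat /j leq_subr.
(* [r] has no positive frequency by [r0], and [K] involves only the powers z^-j with j >= 0, so this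
   conjugate is analytic. *)
exists (conjf (r + K)), h; split => //; last first.
  by rewrite conjfK /r /F /A; ring.
have LrK : L2 (r + K) by exact: L2D.
split; first exact: L2_conj.
case=> // n _; rewrite fourier_conj// NegzE opprK fourierD// r0 add0r.
rewrite fourier_sum; last by move=> i; exact: L2_zpow.
rewrite big1 ?conjc0// => i _; rewrite fourier_zpow (_ : (_ == _) = false) ?mulr0//.
by apply/negbTE/eqP; lia.
Qed.

(** The relation is tested on F = alpha conj(z f). The part conj(alpha h1) of the symbol contributes
    equally to both sides, so after division by conj(g(0)) the coefficient at -k of z^(1-k) (V beta)
    h conj(z f) must vanish; that coefficient is <(V beta) h, f>. *)
Lemma remainder_orth phi h1 h g f : L2 phi ->
  intertwining_symbol k alpha beta phi -> H2 h1 -> H2 h ->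
  phi * alpha = conjf h1 + zpow (- k.-1%:Z) * V beta * h ->
  model_inf beta g -> fourier g 0 != 0 -> model_inf alpha f ->
  ip (V beta * h) f = 0.
Proof.
move=> Lphi H Hh1 Hh pE mg gn0 mf.
have Lh1 := H2_L2 Hh1; have Lh := H2_L2 Hh; have Lg := model_L2 mg.1.
have LBh := L2_innerM iB Lh; have LVg := L2_slant k0 Lg.
have mF := model_conj ia mf; set F := alpha * _ in mF.
have [y [mS Hy e yE y0]] := iter_shift_inf k ia mF.
have LF := mF.2.2.
have LJ : L2 (V beta * h * (zpow (-1) * conjf f)).
  apply: L2_LinfM => //; apply: LinfM; first exact/bmeas_Linf/bmeas_zpow.
  exact: Linf_conj mf.2.2.
have Lp1 : L2 (conjf (alpha * h1) * F).
  by apply: L2_LinfM => //; apply: L2_conj; exact: L2_innerM.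
have Lp2 : L2 (zpow (- k.-1%:Z) * (V beta * h * (zpow (-1) * conjf f))).
  exact: L2_zpowM.
have Lpf : L2 (phi * F) by exact: L2_LinfM.
have e2 : phi * F = conjf (alpha * h1) * F +
    zpow (- k.-1%:Z) * (V beta * h * (zpow (-1) * conjf f)) %[ae m].
  apply/ae_pointwise; apply: filterS (inner_unit ia) => z h2.
  have h3 : alpha z * conjf alpha z = 1 := h2.
  have := congr1 (fun G => G z) pE; rewrite /F conjfM !fctE => h4.
  rewrite [LHS]mulrA h4 -[X in _ = X + _]mul1r.
  rewrite (_ : 1 * _ = (alpha z * conjf alpha z) *
    (conjf h1 z * (zpow (-1) z * conjf f z))); last by ring.
  by rewrite h3; ring.
have Lhy : L2 (conjf h1 * y) by apply: L2_LinfM; [exact: L2_conj|exact: Hy.2].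
have LBy : L2 (zpow (- k.-1%:Z) * V beta * h * y).
  rewrite -!mulrA; apply: L2_zpowM; apply: L2_innerM => //.
  by apply: L2_LinfM => //; exact: Hy.2.
have := H _ _ _ mF mg.1 Hy yE e; rewrite pE mulrDl ipDl//.
rewrite (pairing_analytic Hh mg.1 Hy) addr0.
rewrite (pairing_antianalytic Hh1 mF mg.1 Hy y0 e).
have g0 : (fourier g 0)^* != 0 by rewrite conjc_eq0.
move=> /(mulfI g0).
have -> : fourier (phi * F) (- k%:Z) = fourier (conjf (alpha * h1) * F) (- k%:Z) +
    fourier (zpow (- k.-1%:Z) * (V beta * h * (zpow (-1) * conjf f))) (- k%:Z).
  rewrite -fourierD//; apply: ip_ael e2 => //; [exact: L2D|exact: L2_zpow].
move=> /eqP; rewrite -[X in X == _]addr0 (inj_eq (addrI _)) eq_sym => /eqP.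
rewrite fourier_zpowM opprK Posz_predn opprD addrAC addNr add0r => <-.
rewrite fourierE opprK /inner_prod; congr cintegral.
rewrite -[LHS]mulr1 (_ : 1 = zpow (-1) * zpow 1) ?mulrA; first by ring.
by rewrite -zpowD addNr zpow0.
Qed.

End Symbol.

Theorem theorem3p3 (R : realType) (k : nat)
    (W U : (circle R -> R[i]) -> (circle R -> R[i]))
    (alpha beta gamma phi : circle R -> R[i]) :
  (0 < k)%N ->
  slant_op k W ->
  inner_fun alpha -> nonconstant alpha ->
  inner_fun beta -> nonconstant beta ->
  dim_ge (model alpha) k ->
  inner_gcd gamma alpha (slant_adj k beta) ->
  L2 phi ->
  bounded_extension W alpha beta phi U ->
  (forall f, model alpha f ->
     compressed_shift beta (U f) = U (iter k (compressed_shift alpha) f)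
       %[ae (@circle_measure R)])
  <->
  exists h1 h2 h3 : circle R -> R[i],
    [/\ H2 h1, H2 h2, model gamma h3 &
        phi = conjf (alpha * h1)
              + conjf (zpow k.-1%:Z) * slant_adj k beta * h2
              + conjf (zpow k.-1%:Z)
                * (fun z => slant_adj k beta z / gamma z) * h3
          %[ae (@circle_measure R)]].
Proof.
move=> k0 sW ia _ ib nb dk gcd Lphi bU.
have [ig [a' ia' aE0] [b' ib' bE0] _] := gcd.
have aE := aE0; have bE := bE0.
move/ae_pointwise : aE => aE; move/ae_pointwise : bE => bE.
have iB := slant_inner k0 sW ib.
have ab : alpha * b' = slant_adj k beta * a' %[ae (@circle_measure R)].
  apply/ae_pointwise; apply: filterS2 aE bE => z; rewrite !fctE => -> ->; ring.
have g0 : {ae (@circle_measure R), forall z, gamma z != 0}.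
  apply: filterS ig.2 => z gz; apply/eqP => g0; move: gz; rewrite g0 normc0.
  by move=> /esym/eqP; rewrite oner_eq0.
split.
  move=> /(intertwining_of_eq k0 sW ia ib Lphi bU) H.
  have [h1 [h [Hh1 Hh pE]]] := symbol_decomposition k0 sW ia ib Lphi dk H.
  have Lh1 := H2_L2 Hh1; have Lh := H2_L2 Hh.
  have phiE : phi = conjf (alpha * h1) +
      zpow (- k.-1%:Z) * (conjf alpha * (slant_adj k beta * h)) %[ae (@circle_measure R)].
    apply/ae_pointwise; apply: filterS (inner_unit ia) => z h2.
    have h3 : alpha z * conjf alpha z = 1 := h2.
    have := congr1 (fun F => F z) pE; rewrite conjfM !fctE => h4.
    rewrite -[phi z]mulr1 -h3 mulrA h4; ring.
  have [g mg gn0] := model_const_coef ib nb.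
  have [f mf|y Hy /ae_pointwise e] := H2_orth_model_inf ia (H2_innerM iB Hh).
    exact: (remainder_orth k0 sW ia ib Lphi H Hh1 Hh pE mg gn0 mf).
  (* (V beta) h = alpha y reads gamma b' h = gamma a' y, and [gamma] is nonzero almost
     everywhere. *)
  have bh : b' * h = a' * y %[ae (@circle_measure R)].
    have gbh : {ae (@circle_measure R), forall z,
        gamma z * (b' z * h z) = gamma z * (a' z * y z)}.
      apply: filterS3 aE bE e => z; rewrite !fctE => h2 h3.
      by rewrite h2 h3 -!mulrA.
    apply/ae_pointwise; apply: filterS2 gbh g0 => z h2 h3.
    exact: (mulfI h3).
  have cop := gcd_cofactors_coprime gcd ia' ib' aE0 bE0.
  have [u Hu /ae_pointwise hE] := coprime_divides ia' ib' Hh Hy bh cop.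
  have [h2 Hh2 mh3] := model_decomp ig Hu.
  exists h1, h2, (u - gamma * h2); split => //.
  move/ae_pointwise : phiE => phiE; move/ae_pointwise : ab => ab.
  have S1 : {ae (@circle_measure R), forall z,
      conjf alpha z * (slant_adj k beta z * h z) = b' z * u z}.
    apply: filterS3 ab hE (inner_unit ia) => z; rewrite !fctE => h3 h4 h5.
    have h6 : alpha z * conjf alpha z = 1 := h5.
    rewrite h4 (mulrA (slant_adj k beta z)) -h3 -[RHS]mul1r -h6; ring.
  have S2 : {ae (@circle_measure R), forall z, slant_adj k beta z * h2 z +
      slant_adj k beta z / gamma z * (u z - gamma z * h2 z) = b' z * u z}.
    by apply: filterS2 bE g0 => z h3 h4; rewrite h3 fctE; field.
  apply/ae_pointwise; apply: filterS3 phiE S1 S2 => z; rewrite conj_zpow !fctE.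
  by move=> -> -> <-; ring.
move=> [h1 [h2 [h3 [Hh1 Hh2 mh3 /ae_pointwise pE]]]].
apply: (eq_of_intertwining k0 sW ia ib Lphi bU).
(* The last two summands merge into b' (gamma h2 + h3), since b' gamma = V beta and b' = V beta /
   gamma almost everywhere. *)
apply: (@intertwining_of_form _ k W alpha beta k0 sW ia ib phi a' b' h1 (gamma * h2 + h3)) => //.
- exact: inner_Hinf.
- exact: inner_Hinf.
- by apply: H2D; [exact: H2_innerM|exact: model_H2 mh3].
- apply/ae_pointwise; apply: filterS3 pE bE g0 => z.
  rewrite conj_zpow !fctE => -> h4 h5; rewrite h4.
  by field.
Qed.
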